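(* Let $(\varepsilon_k)_{k\ge 0}$ be i.i.d. Rademacher random variables (uniform on $\{-1,1\}$) and let $f_n(x)=\sum_{k=0}^n\varepsilon_k x^k$. Then, almost surely, \[ \liminf_{n\to\infty}\frac{\log\big(\max_{x\in[-1,1]}|f_n(x)|/\sqrt n\big)}{(\log\log n)^{1/3}}=-\Big(\frac{3\pi^2}{4}\Big)^{1/3}. \]
   Context: All logarithms are natural; the expression is considered for $n\ge 3$. *)

(* Defs.v *)
From HB Require Import structures.
From mathcomp Require Import all_boot all_order all_algebra finmap.
From mathcomp Require Import all_classical all_reals all_analysis.
Import Order.TTheory GRing.Theory Num.Theory.
Import numFieldNormedType.Exports.

Set Implicit Arguments.
Unset Strict Implicit.
Unset Printing Implicit Defensive.

Local Open Scope classical_set_scope.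
Local Open Scope ring_scope.

Definition mutually_independent d d' (T : measurableType d)
    (T' : measurableType d') (R : realType) (P : probability T R)
    (I : choiceType) (X : I -> {RV P >-> T'}) : Prop :=
  forall (J : {fset I}) (B : I -> set T'), (forall i, measurable (B i)) ->
    P (\bigcap_(i in [set` J]) (X i @^-1` B i)) =
      (\prod_(i <- J) P (X i @^-1` B i))%E.

Definition rademacher d (T : measurableType d) (R : realType)
    (P : probability T R) (X : {RV P >-> R}) : Prop :=
  P (X @^-1` [set 1]) = (2^-1)%:E /\ P (X @^-1` [set -1]) = (2^-1)%:E.

Definition iid_rademacher d (T : measurableType d) (R : realType)
    (P : probability T R) (X : nat -> {RV P >-> R}) : Prop :=
  mutually_independent X /\ forall k, rademacher (X k).

Definition partial_poly (R : realType) (a : nat -> R) (n : nat) : {poly R} :=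
  \poly_(k < n.+1) a k.

(* This supremum is attained: see max_absP. *)
Definition max_abs (R : realType) (p : {poly R}) : R :=
  sup [set `|p.[x]| | x in `[-1, 1]].

Lemma max_absP (R : realType) (p : {poly R}) :
  (exists2 c, c \in `[-1, 1] & max_abs p = `|p.[c]|) /\
  forall x, x \in `[-1, 1] -> `|p.[x]| <= max_abs p.
Proof.
have cp : {within `[-1, 1], continuous (fun x => `|p.[x]|)}.
  apply: continuous_subspaceT => x.
  apply: (@continuous_comp _ _ _ (horner p) Num.norm).
    exact: continuous_horner.
  exact: norm_continuous.
have [|c cI cmax] := @EVT_max R _ (-1) 1 _ cp.
  by rewrite (@le_trans _ _ 0)// lerN10.
have ub : ubound [set `|p.[x]| | x in `[-1, 1]] `|p.[c]|.
  by move=> _ [x xI <-]; exact: cmax.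
have pc : [set `|p.[x]| | x in `[-1, 1]] `|p.[c]| by exists c.
have E : max_abs p = `|p.[c]|.
  apply/eqP; rewrite eq_le; apply/andP; split.
    by apply: ge_sup => //; exists `|p.[c]|.
  by apply: ub_le_sup => //; exists `|p.[c]|.
by rewrite E; split => //; exists c.
Qed.

(* Main.v *)
(* The heart of the matter is the small-ball estimate
     P (max_[-1,1] |f_n| <= e^-l sqrt n) = exp (- (4 / (3 pi^2) + o(1)) l^3),
   valid uniformly for n >= e^(8 l); the constant (3 pi^2 / 4)^(1/3) comes from solving
   (4 / (3 pi^2)) l^3 = ln (ln n).  Both halves expand the kernel 1 / (1 - w z) in the
   Takenaka-Malmquist system of a sequence of points y_j of ]-1, 1[, in which
   1 / (1 - w z) = sum_j phi_j(w) phi_j(z) + (a remainder), and measure points in the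
   hyperbolic coordinate v = artanh y.

   Upper bound: test f_n at well-chosen points, replace the signs one at a time by
   Gaussians, and bound the resulting determinant below by prod_j phi_j(y_j)^2.

   Lower bound: choose y_j greedily, so that |phi_j| <= M_j := phi_j(y_j) on the whole
   interval, and sort the sign patterns according to the rounded coefficients of f_n in
   the system.  By the pigeonhole principle two independent copies U, U' of half the signs
   fall in the same cell with probability at least about the inverse of the number of
   cells, and then U - U' is small on [-1, 1].  Placing U on the exponents 0, 1 modulo 4
   and - U' on the exponents 2, 3 gives the random polynomial
   U - x^2 U' = (U - U') + (1 - x^2) U', whose last term is at most 2.  The number of
   cells is about prod_j max (1, M_j / theta), which a logarithmic energy inequality for
   points on a line bounds by exp ((4 / (3 pi^2) + o(1)) l^3).

   The lower bound on the liminf then follows from the first Borel-Cantelli lemma, after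
   covering each dyadic block of degrees by few grid points with the help of a maximal
   inequality.  For the upper bound, inspect the degrees 2^(i j) - 1 with
   2^i < j <= 2^(i+1): the blocks of coefficients between two consecutive ones are
   independent, and the earlier coefficients are negligible. *)
Require Import Defs.
From HB Require Import structures.
From mathcomp Require Import all_boot all_order all_algebra finmap.
From mathcomp Require Import all_classical all_reals all_analysis.
From mathcomp Require Import ring lra zify.
Import Order.TTheory GRing.Theory Num.Theory.
Import numFieldNormedType.Exports.

Local Open Scope classical_set_scope.
Local Open Scope ring_scope.

Set Implicit Arguments.
Unset Strict Implicit.
Unset Printing Implicit Defensive.

(** * Averages over random signs *)

Section SignAverage.
Variable R : realType.
Implicit Types (F G : (nat -> R) -> R) (s : nat -> R).

(** The variational problem behind [4 / (3 pi^2)]: with [V = ln n / 2], a node at hyperbolic depth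
    [x = V - |v|] has height about [e^(l - x)] relative to the threshold, and each earlier node at
    distance [d] divides it by [coth d]. Since [ln coth] has integral [pi^2 / 8] on the half-line,
    nodes of density [g] near one end have total logarithmic height
    [int ((l - x) g - (pi^2 / 8) g^2) dx], maximal at [g = 4 (l - x) / pi^2]; each of the two ends
    then contributes [2 l^3 / (3 pi^2)]. No continuum limit is taken: the upper bound uses explicit
    nodes, the lower bound an inequality for arbitrary nodes. There the singularity of [ln coth] at
    [0] is an obstacle, as the self-energy of a node would be infinite; the kernel is truncated to a
    finite sum of exponentials. The interleaving [U - x^2 U'] answers another obstacle: pigeonhole
    yields a difference of sign vectors, with coefficients in [{-2, 0, 2}] instead of [{-1, 1}].
    Counting cells and grid points costs only [exp (O (l^2 ln l))]. Up to the transfer to [P],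
    probabilities are averages over finitely many signs. *)

Definition scons (a : R) (s : nat -> R) (k : nat) : R :=
  if k is k'.+1 then s k' else a.

(** The recursion reveals the first sign, so inductions condition on one sign at a time. Coordinates
    from [n] on are set to [0], so that one type of infinite sequences serves every length. *)
Fixpoint sign_avg n F : R :=
  if n is n'.+1 then
    (sign_avg n' (fun s => F (scons 1 s)) +
     sign_avg n' (fun s => F (scons (-1) s))) / 2
  else F (fun=> 0).

Definition sign_prob n (Q : (nat -> R) -> Prop) : R :=
  sign_avg n (fun s => (`[< Q s >])%:R).

Definition is_signs n s :=
  (forall k, (k < n)%N -> s k = 1 \/ s k = -1) /\
  (forall k, (n <= k)%N -> s k = 0).

Lemma is_signs_cons n a s : a = 1 \/ a = -1 -> is_signs n s ->
  is_signs n.+1 (scons a s).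
Proof.
move=> ha [h1 h2]; split=> [[|k]|[|k]] //=.
- by rewrite ltnS; exact: h1.
- by rewrite ltnS; exact: h2.
Qed.

Lemma is_signs_norm n s k : is_signs n s -> `|s k| <= 1.
Proof.
move=> [h1 h2]; case: (ltnP k n) => [/h1|/h2 ->]; last by rewrite normr0.
by case=> ->; rewrite ?normrN normr1.
Qed.

Lemma le_sign_avg n F G : (forall s, is_signs n s -> F s <= G s) ->
  sign_avg n F <= sign_avg n G.
Proof.
elim: n F G => [|n IH] F G h /=; first by apply: h; split.
rewrite ler_pM2r ?invr_gt0// lerD//; apply: IH => s hs; apply: h;
  by apply: is_signs_cons => //; tauto.
Qed.

Lemma eq_sign_avg n F G : (forall s, is_signs n s -> F s = G s) ->
  sign_avg n F = sign_avg n G.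
Proof.
by move=> h; apply/le_anti/andP; split; apply: le_sign_avg => s /h ->.
Qed.

Lemma sign_avgD n F G :
  sign_avg n (fun s => F s + G s) = sign_avg n F + sign_avg n G.
Proof.
by elim: n F G => [|n IH] F G //=; rewrite !IH -mulrDl addrACA.
Qed.

Lemma sign_avgZ n a F : sign_avg n (fun s => a * F s) = a * sign_avg n F.
Proof.
by elim: n F => [|n IH] F //=; rewrite !IH -mulrDr mulrA.
Qed.

Lemma sign_avg_cst n a : sign_avg n (fun=> a) = a.
Proof. by elim: n => [|n IH] //=; rewrite !IH; lra. Qed.

Lemma sign_avg_ge0 n F : (forall s, is_signs n s -> 0 <= F s) ->
  0 <= sign_avg n F.
Proof. by move=> h; rewrite -(sign_avg_cst n 0); exact: le_sign_avg. Qed.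

Lemma sign_avg_sum n (I : Type) (r : seq I) (P : pred I) (F : I -> (nat -> R) -> R) :
  sign_avg n (fun s => \sum_(i <- r | P i) F i s) =
  \sum_(i <- r | P i) sign_avg n (F i).
Proof.
elim: r => [|i r IH].
  rewrite big_nil -[RHS](sign_avg_cst n 0).
  by apply: eq_sign_avg => s _; rewrite big_nil.
rewrite big_cons; case: ifPn => Pi.
  rewrite -IH -sign_avgD; apply: eq_sign_avg => s _.
  by rewrite big_cons Pi.
by rewrite -IH; apply: eq_sign_avg => s _; rewrite big_cons (negbTE Pi).
Qed.

Lemma sign_prob_ge0 n Q : 0 <= sign_prob n Q.
Proof. by apply: sign_avg_ge0 => s _; rewrite ler0n. Qed.

Lemma le_sign_prob n (Q Q' : (nat -> R) -> Prop) :
  (forall s, is_signs n s -> Q s -> Q' s) -> sign_prob n Q <= sign_prob n Q'.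
Proof.
move=> h; apply: le_sign_avg => s hs; rewrite ler_nat.
case: (asboolP (Q s)) => // /(h _ hs) q.
by case: asboolP.
Qed.

Lemma sign_prob_le1 n Q : sign_prob n Q <= 1.
Proof.
rewrite -[leRHS](sign_avg_cst n 1); apply: le_sign_avg => s _.
by case: asboolP => _; rewrite ?ler01.
Qed.

Lemma sign_prob_not n Q : sign_prob n (fun s => ~ Q s) = 1 - sign_prob n Q.
Proof.
rewrite /sign_prob -[X in _ = X - _](sign_avg_cst n 1) -mulN1r -sign_avgZ -sign_avgD.
by apply: eq_sign_avg => s _; rewrite asbool_neg; case: asboolP => _ /=; lra.
Qed.

Lemma sign_prob_or n Q Q' :
  sign_prob n (fun s => Q s \/ Q' s) <= sign_prob n Q + sign_prob n Q'.
Proof.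
rewrite -sign_avgD; apply: le_sign_avg => s _; rewrite asbool_or.
by do 2 case: asboolP => _ /=; lra.
Qed.

Lemma sign_prob_exists n m (Q : nat -> (nat -> R) -> Prop) :
  sign_prob n (fun s => exists2 i, (i < m)%N & Q i s) <=
  \sum_(i < m) sign_prob n (Q i).
Proof.
elim: m => [|m IH].
  rewrite big_ord0 -[leRHS](sign_avg_cst n 0); apply: le_sign_avg => s _.
  by case: asboolP => // -[].
rewrite big_ord_recr/=; apply: le_trans (lerD IH (lexx _)).
apply: le_trans (sign_prob_or _ _ _); apply: le_sign_prob => s _ [i].
rewrite ltnS leq_eqVlt => /orP[/eqP->|im] q; first by right.
by left; exists i.
Qed.

Lemma sign_avg_exp n (c : nat -> R) :
  sign_avg n (fun s => expR (\sum_(k < n) c k * s k)) =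
  \prod_(k < n) ((expR (c k) + expR (- c k)) / 2).
Proof.
elim: n c => [|n IH] c /=; first by rewrite !big_ord0 expR0.
rewrite big_ord_recl /= -(IH (c \o S)) /=.
have E a : sign_avg n (fun s => expR (\sum_(k < n.+1) c k * scons a s k)) =
    expR (c 0%N * a) * sign_avg n (fun s => expR (\sum_(k < n) c k.+1 * s k)).
  rewrite -sign_avgZ; apply: eq_sign_avg => s _.
  by rewrite big_ord_recl /= expRD.
by rewrite (E 1) (E (-1)) mulr1 mulrN1 -mulrDl mulrAC.
Qed.

Definition scat n (s t : nat -> R) (k : nat) : R :=
  if (k < n)%N then s k else t (k - n)%N.

Lemma sign_avg_cat a b F :
  sign_avg (a + b) F = sign_avg a (fun s => sign_avg b (fun t => F (scat a s t))).
Proof.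
elim: a F => [|a IH] F /=.
  by rewrite add0n; congr sign_avg; apply/funext => s; congr F;
    apply/funext => k; rewrite /scat subn0.
have E c : sign_avg (a + b) (fun s => F (scons c s)) =
  sign_avg a (fun s => sign_avg b (fun t => F (scat a.+1 (scons c s) t))).
  rewrite IH; congr sign_avg; apply/funext => s; congr sign_avg.
  apply/funext => t; congr F; apply/funext => -[|k] //=.
by rewrite !E.
Qed.

End SignAverage.

(** * Elementary estimates *)

Section ExpBounds.
Variable R : realType.
Implicit Types x b q : R.

Lemma series_exp_le x n : 0 <= x -> \sum_(0 <= k < n) x ^+ k / k`!%:R <= expR x.
Proof.
move=> x0; apply: (@nondecreasing_cvgn_le _ (series (exp_coeff x))).
  apply: nondecreasing_series => k _ _; exact: exp_coeff_ge0.
exact: is_cvg_series_exp_coeff.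
Qed.

Lemma expR_ge_quad x : 0 <= x -> 1 + x + x ^+ 2 / 2 <= expR x.
Proof.
move=> x0; apply: le_trans (series_exp_le 3 x0).
by rewrite !big_nat_recr//= big_nil expr0 expr1 (_ : 0`! = 1)%N// (_ : 1`! = 1)%N// (_ : 2`! = 2)%N//; lra.
Qed.

Lemma expR_ge_pow6 x : 0 <= x -> x ^+ 6 / 720 <= expR x.
Proof.
move=> x0; apply: le_trans (series_exp_le 7 x0).
rewrite big_nat_recr//= (_ : 6`! = 720)%N// lerDr.
by apply: sumr_ge0 => i _; rewrite divr_ge0// exprn_ge0.
Qed.

(** The quotient [(2 i)! / (2^i i!)] is the product of the odd numbers below [2 i], which contains
    the factor [3] as soon as [i >= 2]. This is the slack that pays for [1 - q] in
    [cosh_le_expR]. *)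
Lemma fact_double i : (2 <= i)%N -> (3 * 2 ^ i * i`! <= i.*2`!)%N.
Proof.
elim: i => // -[//|[|i]] IH _; first by [].
have := IH isT; set j := i.+2 => h.
rewrite doubleS !factS expnS.
apply: leq_trans (_ : (j.*2.+2 * j.*2`! <= _)%N).
  rewrite (_ : (3 * (2 * 2 ^ j) * (j.+1 * j`!) = j.*2.+2 * (3 * 2 ^ j * j`!))%N).
    by rewrite leq_mul2l h orbT.
  by rewrite -doubleS -muln2; ring.
by rewrite leq_mul2l leq_pmull ?orbT.
Qed.

(** With [s = b^2 / 2] the Taylor series of [cosh b] and [e^s] are compared term by term: they agree
    up to order one in [s], and [fact_double] gains a factor [3] on every later term. *)
Lemma coshM2_le b : expR b + expR (- b) <=
  2 * (1 + b ^+ 2 / 2 + (expR (b ^+ 2 / 2) - 1 - b ^+ 2 / 2) / 3).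
Proof.
set s := b ^+ 2 / 2.
pose f := (series (exp_coeff b) \+ series (exp_coeff (- b)) : R^nat).
pose g (n : nat) := 2 * (1 + s + (series (exp_coeff s) n - 1 - s) / 3).
have fl : f @ \oo --> expR b + expR (- b).
  by apply: cvgD; exact: is_cvg_series_exp_coeff.
have gl : g @ \oo --> 2 * (1 + s + (expR s - 1 - s) / 3).
  apply: cvgMr; apply: cvgD; first exact: cvg_cst.
  apply: cvgMl; apply: cvgB; last exact: cvg_cst.
  by apply: cvgB; [exact: is_cvg_series_exp_coeff|exact: cvg_cst].
apply: (ler_cvg_to fl gl); exists 2%N => // n /= n2.
have s0 : 0 <= s by rewrite divr_ge0// sqr_ge0.
pose a (k : nat) := (b ^+ k + (- b) ^+ k) / k`!%:R.
have a0 k : 0 <= a k.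
  rewrite /a exprNn -signr_odd; case: (boolP (odd k)) => ok /=.
    by rewrite expr1 mulN1r subrr mul0r.
  rewrite expr0 mul1r divr_ge0// addr_ge0// exprn_even_ge0//.
have -> : f n = \sum_(0 <= k < n) a k.
  rewrite /f /series /= -big_split /=; apply: eq_bigr => k _.
  by rewrite /a mulrDl.
apply: le_trans (_ : \sum_(0 <= k < n.*2) a k <= _).
  rewrite [leRHS](big_cat_nat _ (n := n))//= ?lerDl ?sumr_ge0//.
  by rewrite -addnn leq_addr.
have -> : \sum_(0 <= k < n.*2) a k = 2 * \sum_(0 <= i < n) b ^+ i.*2 / i.*2`!%:R.
  elim: n {n2} => [|n IH]; first by rewrite !big_nil mulr0.
  rewrite doubleS !big_nat_recr //= IH /a.
  have e : (- b) ^+ n.*2 = b ^+ n.*2 by rewrite -mul2n !exprM sqrrN.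
  by rewrite [(- b) ^+ _.+1]exprS [b ^+ _.+1]exprS e; ring.
rewrite /g ler_pM2l//.
have H i : (2 <= i)%N -> b ^+ i.*2 / i.*2`!%:R <= s ^+ i / i`!%:R / 3.
  move=> i2; rewrite -mul2n exprM /s expr_div_n -!mulrA ler_wpM2l//.
    by rewrite exprn_ge0// sqr_ge0.
  rewrite -!invfM lef_pV2 ?posrE ?mulr_gt0 ?exprn_gt0 ?ltr0n ?fact_gt0//.
  rewrite -natrX -!natrM ler_nat mul2n; apply: leq_trans (fact_double i2).
  by rewrite leq_eqVlt; apply/orP; left; apply/eqP; ring.
have -> : series (exp_coeff s) n = 1 + s + \sum_(2 <= i < n) s ^+ i / i`!%:R.
  rewrite /series /= (@big_cat_nat _ _ _ 2)//=; congr (_ + _).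
  by rewrite !big_nat_recr//= big_nil /exp_coeff /= expr0 expr1 (_ : 0`! = 1)%N// (_ : 1`! = 1)%N//; lra.
rewrite (@big_cat_nat _ _ _ 2)//= [X in X + _ <= _](_ : _ = 1 + s); last first.
  by rewrite !big_nat_recr//= big_nil /exp_coeff /= expr0 /s (_ : 0`! = 1)%N// (_ : 2`! = 2)%N//; lra.
rewrite lerD2l (_ : 1 + s + _ - 1 - s = \sum_(2 <= i < n) s ^+ i / i`!%:R); last by ring.
rewrite mulr_suml big_nat_cond [leRHS]big_nat_cond ler_sum// => i.
by rewrite andbT => /andP[i2 _]; exact: H.
Qed.

(* The factor [1 - q] is what the Gaussian integration step needs; the price
   [8 * q ^+ 2] is harmless because [q] will be of order [1 / n]. *)
Lemma cosh_le_expR b q : 0 <= q <= 1 / 8 ->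
  (expR b + expR (- b)) / 2 <= expR ((1 - q) * (b ^+ 2 / 2) + 8 * q ^+ 2).
Proof.
move=> /andP[q0 q8]; have := coshM2_le b.
set s := b ^+ 2 / 2; have s0 : 0 <= s by rewrite divr_ge0// sqr_ge0.
(* For [s > 3] the crude bound [cosh b <= e^|b|] suffices, because [|b| <= (7 / 8) s] once
   [|b| >= 16 / 7]. *)
have [s3 h|s3 _] := leP s 3.
  apply: le_trans (_ : 2 / 3 * (1 + s) + expR s / 3 <= _); first lra.
  rewrite (_ : (1 - q) * s + 8 * q ^+ 2 = s + (8 * q ^+ 2 - q * s)); last by ring.
  rewrite expRD.
  have h1 : 1 + (8 * q ^+ 2 - q * s) <= expR (8 * q ^+ 2 - q * s).
    exact: expR_ge1Dx.
  have h2 := expR_ge_quad s0.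
  have h3 := expR_gt0 s.
  apply: le_trans (_ : expR s * (1 + (8 * q ^+ 2 - q * s)) <= _); last first.
    by rewrite ler_pM2l.
  rewrite -subr_ge0.
  suff : 0 <= expR s * (2 / 3 + 8 * q ^+ 2 - q * s) - 2 / 3 * (1 + s) by lra.
  have qs : q * s <= 3 / 8 by nra.
  have p0 : 0 <= 2 / 3 + 8 * q ^+ 2 - q * s by nra.
  suff : 0 <= (1 + s + s ^+ 2 / 2) * (2 / 3 + 8 * q ^+ 2 - q * s) - 2 / 3 * (1 + s).
    by nra.
  rewrite [leRHS](_ : _ = s ^+ 2 / 3 - (q * s - 8 * q ^+ 2) * (1 + s + s ^+ 2 / 2)); last by field.
  have [u0|u0] := leP (q * s - 8 * q ^+ 2) 0; first by nra.
  have : (q * s - 8 * q ^+ 2) * (1 + s + s ^+ 2 / 2) <= (q * s - 8 * q ^+ 2) * (17 / 2).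
    by rewrite ler_pM2l//; nra.
  have := sqr_ge0 (s - 51 / 4 * q); have := sqr_ge0 q.
  by set w := (_ - _) * _; lra.
apply: le_trans (_ : expR `|b| <= _).
  have : expR b <= expR `|b| by rewrite ler_expR ler_norm.
  have : expR (- b) <= expR `|b| by rewrite ler_expR -normrN ler_norm.
  by lra.
rewrite ler_expR; have bb : s = `|b| ^+ 2 / 2 by rewrite real_normK// num_real.
move: s3 s0; rewrite bb; have := normr_ge0 b; set t := `|b| => t0 t3 _.
have t2 : 16 / 7 <= t by nra.
have : t <= 7 / 8 * (t ^+ 2 / 2) by nra.
by have := sqr_ge0 q; nra.
Qed.

End ExpBounds.

(** * The sum of the inverse odd squares *)

Section OddSquares.
Variable R : realType.
Implicit Types x : R.

Lemma sin_le x : 0 <= x -> sin x <= x.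
Proof.
move=> x0; have [c _] := @MVT_segment R sin cos 0 x x0
  (fun c _ => is_derive_sin c) (continuous_subspaceT (@continuous_sin R)).
by rewrite sin0 !subr0 => ->; rewrite ler_piMl// cos_le1.
Qed.

Lemma tan_ge x : 0 <= x < pi / 2 -> x <= tan x.
Proof.
move=> /andP[x0 xpi].
have cosp c : c \in `[0, x] -> 0 < cos c.
  rewrite in_itv /= => /andP[c0 cx]; apply: cos_gt0_pihalf.
  by rewrite (le_lt_trans cx xpi) (lt_le_trans _ c0)// oppr_lt0 divr_gt0// pi_gt0.
have [] := @MVT_segment R tan (fun c => (cos c) ^- 2) 0 x x0.
- move=> c cx; apply: is_derive_tan; rewrite gt_eqF// cosp//.
  by move: cx; apply: subset_itvW.
- apply: continuous_in_subspaceT => c /set_mem /= cx.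
  by apply: continuous_tan; rewrite gt_eqF// cosp.
- move=> c cx; rewrite tan0 !subr0 => ->; rewrite ler_peMl//.
  have := cosp _ cx; have := cos_le1 c => h1 h2.
  by rewrite invf_ge1 ?exprn_gt0// expr_le1// ltW.
Qed.

Definition odd_angle N k : R := k.*2.+1%:R * pi / (4 * N%:R).

Lemma odd_angle_itv N k : (k < N)%N -> 0 < odd_angle N k < pi / 2.
Proof.
move=> kN; have N0 : 0 < N%:R :> R by rewrite ltr0n (leq_ltn_trans _ kN).
have p0 := @pi_gt0 R; rewrite /odd_angle; apply/andP; split.
  by rewrite divr_gt0 ?mulr_gt0.
rewrite ltr_pdivrMr ?mulr_gt0// (_ : pi / 2 * (4 * N%:R) = (2 * N%:R) * pi); last by field.
by rewrite ltr_pM2r// -natrM ltr_nat mul2n -doubleS leq_double.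
Qed.

(** Doubling the number of angles pairs [t] with [pi / 2 - t], and [1 / sin^2 t + 1 / cos^2 t = 4 /
    sin^2 (2 t)], so each doubling multiplies the sum by [4]. *)
Lemma sum_inv_sin_sq n :
  \sum_(k < 2 ^ n) (sin (odd_angle (2 ^ n) k)) ^- 2 = 2 * (2 ^ n)%:R ^+ 2 :> R.
Proof.
elim: n => [|n IH].
  rewrite big_ord1 /= expn0.
  have -> : odd_angle 1 0 = pi / 4 by rewrite /odd_angle mul1r mulr1.
  have := cos_mulr2n (pi / 4 : R); rewrite (_ : pi / 4 *+ 2 = pi / 2 :> R); last first.
    by rewrite -mulr_natr; field.
  rewrite cos_pihalf sin2cos2 => /esym h.
  have -> : cos (pi / 4) ^+ 2 = 1 / 2 :> R by lra.
  rewrite (_ : 1 - 1 / 2 = 2^-1); last by lra.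
  by rewrite invrK expr1n mulr1.
rewrite expnS mul2n -addnn big_split_ord /=.
have -> : \sum_(i < 2 ^ n) (sin (odd_angle (2 ^ n + 2 ^ n) (2 ^ n + i))) ^- 2 =
   \sum_(i < 2 ^ n) (cos (odd_angle (2 ^ n + 2 ^ n) i)) ^- 2 :> R.
  rewrite (reindex_inj rev_ord_inj) /=; apply: eq_bigr => i _.
  rewrite (_ : odd_angle _ _ = pi / 2 - odd_angle (2 ^ n + 2 ^ n) i); last first.
    rewrite /odd_angle; set N := (2 ^ n)%N.
    have N0 : N%:R != 0 :> R by rewrite pnatr_eq0 -lt0n expn_gt0.
    have iN : (i < N)%N by [].
    have -> : (N + rev_ord i).*2.+1%:R = 4 * N%:R - i.*2.+1%:R :> R.
      apply/eqP; rewrite eq_sym subr_eq -natrM -natrD eqr_nat /=; apply/eqP.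
      by move: iN; rewrite -/N; lia.
    by rewrite natrD; field; rewrite -natrD pnatr_eq0 -lt0n addn_gt0 expn_gt0.
  by rewrite sinB sin_pihalf cos_pihalf mul1r mul0r subr0.
rewrite -big_split /=.
transitivity (\sum_(i < 2 ^ n) 4 * (sin (odd_angle (2 ^ n) i)) ^- 2); last first.
  by rewrite -mulr_sumr IH natrD; ring.
apply: eq_bigr => i _; set t := odd_angle (_ + _) i.
have iN : (i < 2 ^ n + 2 ^ n)%N by rewrite ltn_addr.
have [t0 tp] := andP (odd_angle_itv iN).
have -> : odd_angle (2 ^ n) i = t *+ 2.
  have N0 : (2 ^ n)%:R != 0 :> R by rewrite pnatr_eq0 -lt0n expn_gt0.
  rewrite /t /odd_angle -mulr_natr natrD; field.
  by rewrite N0 -natrD pnatr_eq0 -lt0n addn_gt0 expn_gt0.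
have s0 : sin t != 0 by rewrite gt_eqF// sin_gt0_pihalf// t0.
have c0 : cos t != 0.
  by rewrite gt_eqF// cos_gt0_pihalf// tp andbT (lt_trans _ t0)// oppr_lt0 divr_gt0// pi_gt0.
rewrite sin_mulr2n -mulr_natr.
apply: (@mulIf _ ((sin t * cos t) ^+ 2)); first by rewrite sqrf_eq0 mulf_neq0.
transitivity (cos t ^+ 2 + sin t ^+ 2); first by field; rewrite s0 c0.
by rewrite cos2Dsin2; field; rewrite s0 c0.
Qed.

(** Tends to [pi^2 / 8], the integral of [ln coth] on the half-line: this is where [pi] enters. *)
Definition odd_sq_sum n : R := \sum_(k < n) (k.*2.+1%:R ^+ 2)^-1.

Lemma odd_sq_sum_nd m n : (m <= n)%N -> odd_sq_sum m <= odd_sq_sum n.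
Proof.
move=> /subnKC <-; rewrite /odd_sq_sum big_split_ord /= lerDl sumr_ge0//.
Qed.

(** Inserting [sin x <= x] in [sum_inv_sin_sq] gives the bound along powers of two. *)
Lemma odd_sq_sum_le n : odd_sq_sum n <= pi ^+ 2 / 8.
Proof.
apply: le_trans (odd_sq_sum_nd (ltnW (ltn_expl n (isT : (1 < 2)%N)))) _.
have := sum_inv_sin_sq n; set N := (2 ^ n)%N => h.
have N0 : 0 < N%:R :> R by rewrite ltr0n expn_gt0.
have p0 := @pi_gt0 R.
have : odd_sq_sum N * (16 * N%:R ^+ 2 / pi ^+ 2) <= 2 * N%:R ^+ 2.
  rewrite -h mulr_suml ler_sum// => k _.
  have /andP[t0 tp] := odd_angle_itv (ltn_ord k).
  have s0 : 0 < sin (odd_angle N k) by rewrite sin_gt0_pihalf// t0.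
  apply: le_trans (_ : (odd_angle N k) ^- 2 <= _); last first.
    by rewrite lef_pV2 ?posrE ?exprn_gt0// lerXn2r ?nnegrE ?(ltW s0) ?(ltW t0)// sin_le// ltW.
  rewrite le_eqVlt; apply/orP; left; apply/eqP; rewrite /odd_angle.
  have : 0 < k.*2.+1%:R :> R by [].
  move: (k.*2.+1%:R : R) (@pi R) p0 => c p p0 c0.
  by field; rewrite !gt_eqF.
rewrite -ler_pdivlMr; last by rewrite divr_gt0 ?mulr_gt0 ?exprn_gt0.
move/le_trans; apply.
move: (@pi R) p0 => p p0.
by rewrite le_eqVlt; apply/orP; left; apply/eqP; field; rewrite !gt_eqF.
Qed.

(** Here [x <= tan x] enters through [1 / sin^2 = 1 + 1 / tan^2]; the summand [1] costs [N = 2 ^ n]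
    in total, hence an error [pi^2 / (16 N)], weakened at the end by [n < 2 ^ n]. *)
Lemma odd_sq_sum_ge (n : nat) : pi ^+ 2 / 8 - pi ^+ 2 / 16 / n.+1%:R <= odd_sq_sum (2 ^ n).
Proof.
have := sum_inv_sin_sq n; set N := (2 ^ n)%N => h.
have N0 : 0 < N%:R :> R by rewrite ltr0n expn_gt0.
have p0 := @pi_gt0 R.
have : 2 * N%:R ^+ 2 <= odd_sq_sum N * (16 * N%:R ^+ 2 / pi ^+ 2) + N%:R.
  rewrite [X in _ <= _ + X](_ : _ = \sum_(k < N) 1); last by rewrite sumr_const card_ord.
  rewrite -h mulr_suml -big_split ler_sum// => k _ /=.
  have /andP[t0 tp] := odd_angle_itv (ltn_ord k); set t := odd_angle N k in t0 tp *.
  have s0 : 0 < sin t by rewrite sin_gt0_pihalf// t0.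
  have c0 : 0 < cos t.
    by rewrite cos_gt0_pihalf// tp andbT (lt_trans _ t0)// oppr_lt0 divr_gt0// pi_gt0.
  have -> : (sin t) ^- 2 = 1 + (tan t) ^- 2.
    have := cos2Dsin2 t; rewrite /tan => e; apply: (@mulIf _ (sin t ^+ 2)).
      by rewrite sqrf_eq0 gt_eqF.
    rewrite mulVf ?sqrf_eq0 ?gt_eqF// -[LHS]e; field.
    by rewrite !gt_eqF.
  rewrite [leRHS]addrC lerD2l; apply: le_trans (_ : t ^- 2 <= _).
    have tt : t <= tan t by rewrite tan_ge// tp ltW.
    rewrite lef_pV2 ?posrE ?exprn_gt0//; last exact: lt_le_trans tt.
    by rewrite lerXn2r ?nnegrE ?(ltW t0)// (le_trans (ltW t0)).
  rewrite le_eqVlt; apply/orP; left; apply/eqP; rewrite /t /odd_angle.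
  have : 0 < k.*2.+1%:R :> R by [].
  move: (k.*2.+1%:R : R) (@pi R) p0 => c p p0 c1.
  by field; rewrite !gt_eqF.
rewrite -lerBlDr -ler_pdivrMr; last by rewrite divr_gt0 ?mulr_gt0 ?exprn_gt0.
apply: le_trans.
have -> : (2 * N%:R ^+ 2 - N%:R) / (16 * N%:R ^+ 2 / pi ^+ 2) =
   pi ^+ 2 / 8 - pi ^+ 2 / 16 / N%:R :> R.
  by move: (@pi R) p0 => p p0; field; rewrite !gt_eqF.
rewrite lerD2l lerN2 ler_pM2l ?divr_gt0 ?exprn_gt0// lef_pV2 ?posrE ?ltr0n ?expn_gt0//.
by rewrite ler_nat ltn_expl.
Qed.

End OddSquares.

(** * The kernel [ln coth] and its power series *)

Section LogRatio.
Variable R : realType.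
Implicit Types q d : R.

(** At [q = exp (- 2 d)] this is [ln (coth d)], minus the logarithm of the pseudo-hyperbolic
    distance of two points whose hyperbolic coordinates differ by [d]. *)
Definition ln_ratio q := ln ((1 + q) / (1 - q)).

(** Partial sums of the power series of [ln_ratio]. At [q = exp (- 2 d)] they are positive
    combinations of exponentials in [d], finite even at [d = 0]. *)
Definition odd_series n q : R := \sum_(i < n) 2 * q ^+ i.*2.+1 / i.*2.+1%:R.

Lemma ln_ratioE q : 0 <= q < 1 -> ln_ratio q = ln (1 + q) - ln (1 - q).
Proof. by move=> /andP[q0 q1]; rewrite /ln_ratio ln_div// posrE; lra. Qed.

Lemma is_derive_ln_ratio_sub (n : nat) (x : R) : 0 <= x < 1 ->
  is_derive x 1 (fun y : R => ln (1 + y) - ln (1 - y) - odd_series n y)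
    (2 * x ^+ n.*2 / (1 - x ^+ 2)).
Proof.
move=> /andP[x0 x1]; elim: n => [|n IH].
  rewrite (_ : (fun y => _) = (fun y => ln (1 + y) - ln (1 - y))); last first.
    by apply/funext => y; rewrite /odd_series big_ord0 subr0.
  have d1 : is_derive (1 + x) 1 (@ln R) (1 + x)^-1 by apply: is_derive1_ln; lra.
  have d2 : is_derive (1 - x) 1 (@ln R) (1 - x)^-1 by apply: is_derive1_ln; lra.
  have e1 : is_derive x 1 (fun y : R => 1 + y) (0 + 1) by exact: is_deriveD.
  have e2 : is_derive x 1 (fun y : R => 1 - y) (0 - 1) by exact: is_deriveB.
  have f1 := @is_derive1_comp _ _ (fun y : R => 1 + y) x _ _ d1 e1.
  have f2 := @is_derive1_comp _ _ (fun y : R => 1 - y) x _ _ d2 e2.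
  apply: is_derive_eq (is_deriveB f1 f2) _.
  by rewrite double0 expr0; field; rewrite !subr_eq0 !gt_eqF//; nra.
rewrite (_ : (fun y => _) = (fun y => (ln (1 + y) - ln (1 - y) - odd_series n y)
    - (2 / n.*2.+1%:R) *: y ^+ n.*2.+1)); last first.
  apply/funext => y; rewrite /odd_series big_ord_recr /= opprD addrA; congr (_ - _).
  by rewrite /GRing.scale /=; ring.
have e : is_derive x 1 (fun y : R => (2 / n.*2.+1%:R) *: y ^+ n.*2.+1)
    ((2 / n.*2.+1%:R) *: (n.*2.+1%:R * x ^+ n.*2 *: 1)).
  by apply: is_deriveZ; have := @is_deriveX R _ id n.*2.+1 x 1 1 _; rewrite exprfctE; exact.
apply: is_derive_eq (is_deriveB IH e) _.
rewrite /GRing.scale /= mulr1 doubleS !exprS.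
have : 0 < n.*2.+1%:R :> R by [].
move: (n.*2.+1%:R : R) => c c0.
have x2 : 1 - x ^+ 2 != 0 by rewrite subr_eq0 eq_sym lt_eqF// expr_lt1.
by field; rewrite -expr2 x2 gt_eqF.
Qed.

(** The difference of [ln_ratio] and [odd_series n] has derivative [2 x^(2 n) / (1 - x^2)],
    nonnegative and nondecreasing; the mean value theorem does the rest. *)
Lemma ln_ratio_bounds n q : 0 <= q < 1 ->
  odd_series n q <= ln_ratio q <= odd_series n q + 2 * q ^+ n.*2.+1 / (1 - q ^+ 2).
Proof.
move=> /andP[q0 q1]; rewrite ln_ratioE ?q0//.
pose F y := ln (1 + y) - ln (1 - y) - odd_series n y.
have D x : 0 <= x <= q -> is_derive x 1 F (2 * x ^+ n.*2 / (1 - x ^+ 2)).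
  by move=> /andP[x0 xq]; apply: is_derive_ln_ratio_sub; rewrite x0 (le_lt_trans xq).
have D1 x : x \in `]0, q[ -> is_derive x 1 F (2 * x ^+ n.*2 / (1 - x ^+ 2)).
  by rewrite in_itv /= => /andP[x0 xq]; apply: D; rewrite !ltW.
have D2 : {within `[0, q], continuous F}.
  apply: continuous_in_subspaceT => x /set_mem /=; rewrite in_itv /= => xq.
  by apply: differentiable_continuous; apply/derivable1_diffP; case: (D _ xq).
have [c] := MVT_segment q0 D1 D2.
rewrite in_itv /= => /andP[c0 cq].
have -> : F 0 = 0.
  rewrite /F addr0 subr0 ln1 /odd_series big1 ?subrr// => i _.
  by rewrite expr0n mulr0 mul0r.
rewrite !subr0 /F => E.
have c2 : c ^+ 2 <= q ^+ 2 by rewrite lerXn2r.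
have q2 : q ^+ 2 < 1 by rewrite expr_lt1.
have c0' : 0 <= 2 * c ^+ n.*2 / (1 - c ^+ 2).
  by rewrite divr_ge0 ?mulr_ge0 ?exprn_ge0//; lra.
have c1' : 2 * c ^+ n.*2 / (1 - c ^+ 2) <= 2 * q ^+ n.*2 / (1 - q ^+ 2).
  rewrite ler_pM ?mulr_ge0 ?exprn_ge0 ?invr_ge0//; first by lra.
    by rewrite ler_pM2l// lerXn2r.
  by rewrite lef_pV2 ?posrE; lra.
apply/andP; split; first by nra.
rewrite -lerBlDl E (exprS q n.*2) [leRHS](_ : _ = 2 * q ^+ n.*2 / (1 - q ^+ 2) * q); last by ring.
by rewrite ler_wpM2r.
Qed.

Lemma sum_geom_le q n : 0 <= q < 1 -> \sum_(1 <= m < n.+1) q ^+ m <= q / (1 - q).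
Proof.
move=> /andP[q0 q1]; rewrite ler_pdivlMr; last lra.
suff -> : (\sum_(1 <= m < n.+1) q ^+ m) * (1 - q) = q - q ^+ n.+1.
  by rewrite lerBlDr lerDl exprn_ge0.
elim: n => [|n IH]; first by rewrite big_geq// mul0r expr1 subrr.
by rewrite big_nat_recr//= mulrDl IH [in RHS]exprS; ring.
Qed.

Lemma sum_expR_le (x : R) n : 0 < x -> \sum_(1 <= m < n.+1) expR (- (m%:R * x)) <= x^-1.
Proof.
move=> x0; have q0 := expR_gt0 (- x).
have q1 : expR (- x) < 1 by rewrite expR_lt1 oppr_lt0.
rewrite (eq_bigr (fun m => expR (- x) ^+ m)); last first.
  by move=> m _; rewrite -mulrN expRM_natl.
have q01 : 0 <= expR (- x) < 1 by rewrite ltW.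
apply: le_trans (sum_geom_le n q01) _.
rewrite ler_pdivrMr ?subr_gt0// mulrC ler_pdivlMr//.
have := expR_ge1Dx x; have e : expR x * expR (- x) = 1 by rewrite expRxMexpNx_1.
by nra.
Qed.

(** A Riemann sum: [ln coth] is decreasing, so its values at the multiples of [d] sum to at most
    [1 / d] times its integral [pi^2 / 8]. The proof works termwise, bounding a geometric sum for
    each exponential of the series. *)
Lemma sum_ln_ratio_le d n : 0 < d ->
  \sum_(1 <= m < n.+1) ln_ratio (expR (- (m%:R * (2 * d)))) <= pi ^+ 2 / (8 * d).
Proof.
move=> d0; apply/ler_addgt0Pr => e e0.
pose q := expR (- (2 * d)).
have q0 : 0 < q := expR_gt0 _.
have q1 : q < 1 by rewrite expR_lt1 oppr_lt0 mulr_gt0.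
have q2 : q ^+ 2 < 1 by rewrite expr_lt1// ltW.
have [N HN] : exists N, n%:R * (2 * q ^+ N.*2.+1 / (1 - q ^+ 2)) <= e.
  have := @cvg_expr R q; rewrite ger0_norm 1?ltW// => /(_ q1).
  pose e' := e * (1 - q ^+ 2) / (2 * n.+1%:R).
  have e'0 : 0 < e' by rewrite divr_gt0 ?mulr_gt0// subr_gt0.
  move/cvgr0Pnorm_lt => /(_ _ e'0) [N _ HN]; exists N.
  have := HN N.*2.+1; rewrite /= -addnn => /(_ (leqW (leq_addr _ _))).
  rewrite addnn ger0_norm ?exprn_ge0 ?(ltW q0)// => h.
  apply: le_trans (_ : n.+1%:R * (2 * q ^+ N.*2.+1 / (1 - q ^+ 2)) <= _).
    by rewrite ler_wpM2r ?ler_nat// divr_ge0 ?mulr_ge0 ?exprn_ge0 ?subr_ge0 ?(ltW q0) ?(ltW q2).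
  apply: le_trans (_ : n.+1%:R * (2 * e' / (1 - q ^+ 2)) <= _).
    by rewrite ler_pM2l// ler_pM2r ?invr_gt0 ?subr_gt0// ler_pM2l// ltW.
  rewrite le_eqVlt; apply/orP; left; apply/eqP; rewrite /e'.
  have : 0 < n.+1%:R :> R by [].
  move: (n.+1%:R : R) => c c0; field.
  by rewrite !gt_eqF// subr_gt0.
apply: le_trans (_ : \sum_(1 <= m < n.+1) (\sum_(i < N) (2 / i.*2.+1%:R) *
    expR (- (m%:R * (2 * d * i.*2.+1%:R))) + 2 * q ^+ N.*2.+1 / (1 - q ^+ 2)) <= _).
  rewrite big_nat_cond [leRHS]big_nat_cond ler_sum// => m; rewrite andbT => /andP[m1 _].
  set p := expR _.
  have pE : p = q ^+ m by rewrite /p -mulrN expRM_natl.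
  have p0 : 0 < p := expR_gt0 _.
  have pq : p <= q by rewrite pE -(prednK m1) exprS ler_piMr ?exprn_ile1 ?(ltW q0) ?(ltW q1).
  have p01 : 0 <= p < 1 by rewrite ltW//= (le_lt_trans pq).
  have /andP[_] := ln_ratio_bounds N p01; move/le_trans; apply.
  apply: lerD.
    rewrite /odd_series ler_sum// => i _; rewrite le_eqVlt; apply/orP; left; apply/eqP.
    by rewrite /p -expRM_natl mulrAC; congr (_ * expR _); ring.
  have p2 : p ^+ 2 <= q ^+ 2 by rewrite lerXn2r ?nnegrE ?(ltW p0) ?(ltW q0).
  rewrite ler_pM ?mulr_ge0 ?exprn_ge0 ?invr_ge0 ?(ltW p0)//; first by lra.
    by rewrite ler_pM2l// lerXn2r ?nnegrE ?(ltW p0) ?(ltW q0).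
  by rewrite lef_pV2 ?posrE; lra.
rewrite big_split /=; apply: lerD; last first.
  by rewrite sumr_const_nat subn1 /= -[_ *+ n]mulr_natl.
rewrite exchange_big /=.
apply: le_trans (_ : \sum_(i < N) d^-1 * (i.*2.+1%:R ^+ 2)^-1 <= _).
  apply: ler_sum => i _; rewrite -mulr_sumr.
  have i0 : 0 < i.*2.+1%:R :> R by [].
  apply: le_trans (_ : 2 / i.*2.+1%:R * (2 * d * i.*2.+1%:R)^-1 <= _).
    by rewrite ler_pM2l ?divr_gt0// sum_expR_le// !mulr_gt0.
  rewrite le_eqVlt; apply/orP; left; apply/eqP.
  by move: (i.*2.+1%:R : R) i0 => c c0; field; rewrite !gt_eqF.
rewrite -mulr_sumr; apply: le_trans (_ : d^-1 * (pi ^+ 2 / 8) <= _).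
  by rewrite ler_pM2l ?invr_gt0//; exact: odd_sq_sum_le.
by rewrite invfM mulrCA mulrA [_^-1 * _]mulrC mulrA.
Qed.

End LogRatio.

(** * Takenaka-Malmquist systems *)

Section TakenakaMalmquist.
Variable R : realType.
Implicit Types (a w z x : R) (y : nat -> R) (f g : nat -> R).

Definition blaschke a w := (w - a) / (1 - a * w).

Definition blaschke_prod y j w := \prod_(i < j) blaschke (y i) w.

(** For distinct nodes these are, up to sign, the result of Gram-Schmidt in the Hardy space applied
    to the kernels [1 / (1 - y j * w)]; the formula makes sense for repeated nodes as well. *)
Definition tm_fun y j w :=
  Num.sqrt (1 - y j ^+ 2) / (1 - y j * w) * blaschke_prod y j w.

(* Squared distance, in the Hardy space, of the kernel at [w] to the span of the
   kernels at [y 0], ..., [y j.-1]. *)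
Definition residual y j w := blaschke_prod y j w ^+ 2 / (1 - w ^+ 2).

Lemma blaschke_prodS y j w :
  blaschke_prod y j.+1 w = blaschke_prod y j w * blaschke (y j) w.
Proof. by rewrite /blaschke_prod big_ord_recr. Qed.

Lemma mul_lt1 w z : `|w| < 1 -> `|z| < 1 -> 0 < 1 - w * z.
Proof.
move=> w1 z1; rewrite subr_gt0 (le_lt_trans (ler_norm _))// normrM.
by rewrite mulr_ilt1.
Qed.

Lemma sqr_lt1 w : `|w| < 1 -> 0 < 1 - w ^+ 2.
Proof. by move=> w1; rewrite expr2 mul_lt1. Qed.

(** Telescopes, since [1 - blaschke a w * blaschke a z = (1 - a^2) (1 - w z) / ((1 - a w) (1 - a
    z))]. *)
Lemma tm_kernel y J w z : (forall i, `|y i| < 1) -> `|w| < 1 -> `|z| < 1 ->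
  (1 - w * z)^-1 = \sum_(j < J) tm_fun y j w * tm_fun y j z +
    blaschke_prod y J w * blaschke_prod y J z / (1 - w * z).
Proof.
move=> y1 w1 z1; elim: J => [|J IH].
  by rewrite big_ord0 /blaschke_prod !big_ord0 add0r mulr1 mul1r.
rewrite {1}IH big_ord_recr /= -!addrA; congr (_ + _).
rewrite !blaschke_prodS /tm_fun /blaschke.
have hs := sqr_sqrtr (ltW (sqr_lt1 (y1 J))).
have hw := mul_lt1 (y1 J) w1; have hz := mul_lt1 (y1 J) z1; have hwz := mul_lt1 w1 z1.
set s := Num.sqrt _ in hs *; set A := blaschke_prod _ _ _; set B := blaschke_prod _ _ _.
rewrite (_ : s / (1 - y J * w) * A * (s / (1 - y J * z) * B) =
   s ^+ 2 * A * B / ((1 - y J * w) * (1 - y J * z))); last first.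
  by field; rewrite !gt_eqF.
rewrite hs; field.
by rewrite !gt_eqF.
Qed.

Lemma residual_sub y j w : `|y j| < 1 -> `|w| < 1 ->
  residual y j w = tm_fun y j w ^+ 2 + residual y j.+1 w.
Proof.
move=> y1 w1; rewrite /residual blaschke_prodS /tm_fun /blaschke.
have hs := sqr_sqrtr (ltW (sqr_lt1 y1)).
have hw := mul_lt1 y1 w1; have hww := sqr_lt1 w1.
set s := Num.sqrt _ in hs *; set A := blaschke_prod _ _ _.
rewrite (_ : (s / (1 - y j * w) * A) ^+ 2 = s ^+ 2 * A ^+ 2 / (1 - y j * w) ^+ 2); last first.
  by field; rewrite !gt_eqF.
rewrite hs; field.
by rewrite -?expr2 !gt_eqF.
Qed.

Lemma residual_ge0 y j w : `|w| < 1 -> 0 <= residual y j w.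
Proof. by move=> w1; rewrite /residual divr_ge0 ?sqr_ge0// ltW// sqr_lt1. Qed.

Lemma tm_fun_sqr_le y j w : `|y j| < 1 -> `|w| < 1 ->
  tm_fun y j w ^+ 2 <= residual y j w.
Proof. by move=> y1 w1; rewrite residual_sub// lerDl residual_ge0. Qed.

Lemma residual_nincr y j w : `|y j| < 1 -> `|w| < 1 ->
  residual y j.+1 w <= residual y j w.
Proof. by move=> y1 w1; rewrite (residual_sub y1 w1) lerDr sqr_ge0. Qed.

Lemma blaschke_prod_node y i j : (i < j)%N -> blaschke_prod y j (y i) = 0.
Proof.
move=> ij; rewrite /blaschke_prod (bigD1 (Ordinal ij)) //=.
by rewrite /blaschke subrr !mul0r.
Qed.

Lemma tm_fun_diag_sqr y j : `|y j| < 1 -> tm_fun y j (y j) ^+ 2 = residual y j (y j).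
Proof.
by move=> y1; rewrite residual_sub// /residual blaschke_prod_node// expr0n mul0r addr0.
Qed.

(** Power series encoded by their coefficients: [geom_conv a f] is the series [f] divided by
    [1 - a z], and [blaschke_seq a f] is [f] times the Blaschke factor [(z - a) / (1 - a z)]. *)
Fixpoint geom_conv a f k : R :=
  if k is k'.+1 then f k + a * geom_conv a f k' else f 0%N.

Definition blaschke_seq a f k : R :=
  (if k is k'.+1 then geom_conv a f k' else 0) - a * geom_conv a f k.

Fixpoint blaschke_seqs y j f : nat -> R :=
  if j is j'.+1 then blaschke_seqs y j' (blaschke_seq (y j') f) else f.

Lemma geom_conv_lin a (c c' : R) f g k :
  geom_conv a (fun k => c * f k + c' * g k) k =
  c * geom_conv a f k + c' * geom_conv a g k.
Proof. by elim: k => [|k IH] //=; rewrite IH; ring. Qed.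

Lemma blaschke_seqs_lin y j (c c' : R) f g k :
  blaschke_seqs y j (fun k => c * f k + c' * g k) k =
  c * blaschke_seqs y j f k + c' * blaschke_seqs y j g k.
Proof.
elim: j f g => [|j IH] f g //=; rewrite -IH; congr blaschke_seqs.
apply/funext => i; rewrite /blaschke_seq.
case: i => [|i]; first by rewrite /=; ring.
by rewrite !geom_conv_lin; ring.
Qed.

(** Multiplication by a Blaschke factor is an isometry of the Hardy space. Cutting after [n]
    coefficients loses exactly [1 - a^2] times the square of the last coefficient of
    [f / (1 - a z)]. *)
Lemma blaschke_seq_contract a f n : `|a| <= 1 ->
  \sum_(k < n) blaschke_seq a f k ^+ 2 <= \sum_(k < n) f k ^+ 2.
Proof.
move=> a1; have a2 : 0 <= 1 - a ^+ 2.
  by rewrite subr_ge0 -real_normK ?num_real// expr_le1.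
suff -> : \sum_(k < n) f k ^+ 2 = \sum_(k < n) blaschke_seq a f k ^+ 2 +
    (1 - a ^+ 2) * (if n is n'.+1 then geom_conv a f n' ^+ 2 else 0).
  by rewrite lerDl mulr_ge0//; case: n => // n; exact: sqr_ge0.
elim: n => [|n IH]; first by rewrite !big_ord0 mulr0 addr0.
rewrite !big_ord_recr /= IH; case: n {IH} => [|n] /=.
  by rewrite /blaschke_seq /=; ring.
by rewrite /blaschke_seq /=; ring.
Qed.

Lemma blaschke_seqs_contract y j f n : (forall i, `|y i| < 1) ->
  \sum_(k < n) blaschke_seqs y j f k ^+ 2 <= \sum_(k < n) f k ^+ 2.
Proof.
move=> y1; elim: j f => [|j IH] f //=.
by rewrite (le_trans (IH _))// blaschke_seq_contract// ltW.
Qed.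

Lemma geom_conv_pow a x k :
  (x - a) * geom_conv a (fun k => x ^+ k) k = x ^+ k.+1 - a ^+ k.+1.
Proof.
elim: k => [|k IH] /=; first by rewrite expr0 mulr1 !expr1.
by rewrite mulrDr mulrCA IH !exprS; ring.
Qed.

(** Partial fractions of [(z - a) / ((1 - a z) (1 - x z))], cleared of the denominator [x - a],
    which may vanish. *)
Lemma blaschke_seq_pow a x k :
  (x - a) * blaschke_seq a (fun k => x ^+ k) k =
  (1 - a * x) * x ^+ k - (1 - a ^+ 2) * a ^+ k.
Proof.
rewrite /blaschke_seq mulrBr [(x - a) * (a * _)]mulrCA geom_conv_pow.
case: k => [|k]; first by rewrite mulr0 !expr0 !expr1; ring.
by rewrite geom_conv_pow !exprS; ring.
Qed.

(** The [k]-th Taylor coefficient of [tm_fun y j]: a geometric series multiplied by the earlier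
    Blaschke factors. *)
Definition tm_coef y j k :=
  Num.sqrt (1 - y j ^+ 2) * blaschke_seqs y j (fun k => y j ^+ k) k.

(** This is the coefficient of [z^k] in [tm_kernel], proved as an identity between sequences so that
    no convergence is involved. *)
Lemma tm_expansion y J x k : (forall i, `|y i| < 1) -> `|x| < 1 ->
  x ^+ k = \sum_(j < J) tm_fun y j x * tm_coef y j k +
    blaschke_prod y J x * blaschke_seqs y J (fun k => x ^+ k) k.
Proof.
move=> y1 x1; elim: J => [|J IH].
  by rewrite big_ord0 /blaschke_prod big_ord0 /= mul1r add0r.
rewrite {1}IH big_ord_recr /= -addrA; congr (_ + _).
have hx := mul_lt1 (y1 J) x1.
have -> : blaschke_seqs y J (fun k => x ^+ k) k =
   blaschke (y J) x * blaschke_seqs y J (blaschke_seq (y J) (fun k => x ^+ k)) k +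
   (1 - y J ^+ 2) / (1 - y J * x) * blaschke_seqs y J (fun k => y J ^+ k) k.
  rewrite -blaschke_seqs_lin; congr blaschke_seqs; apply/funext => i.
  rewrite /blaschke mulrAC blaschke_seq_pow; field.
  by rewrite gt_eqF.
rewrite blaschke_prodS /tm_fun /tm_coef.
have hs := sqr_sqrtr (ltW (sqr_lt1 (y1 J))).
set s := Num.sqrt _ in hs *.
rewrite -hs; ring.
Qed.

Lemma sum_sqr_pow_le x n : `|x| < 1 -> (1 - x ^+ 2) * \sum_(k < n) (x ^+ k) ^+ 2 <= 1.
Proof.
move=> x1.
suff -> : (1 - x ^+ 2) * \sum_(k < n) (x ^+ k) ^+ 2 = 1 - (x ^+ 2) ^+ n.
  by rewrite gerBl exprn_ge0// sqr_ge0.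
elim: n => [|n IH]; first by rewrite big_ord0 mulr0 expr0 subrr.
have e : (x ^+ n) ^+ 2 = (x ^+ 2) ^+ n by rewrite -!exprM mulnC.
by rewrite big_ord_recr /= mulrDr IH (exprS (x ^+ 2)) e; ring.
Qed.

Lemma tm_coef_sqr_sum y j n : (forall i, `|y i| < 1) ->
  \sum_(k < n) tm_coef y j k ^+ 2 <= 1.
Proof.
move=> y1; apply: le_trans (sum_sqr_pow_le n (y1 j)).
rewrite /tm_coef; under eq_bigr do rewrite exprMn sqr_sqrtr ?(ltW (sqr_lt1 _))//.
by rewrite -mulr_sumr ler_pM2l ?sqr_lt1// blaschke_seqs_contract.
Qed.

Lemma residual_coef_sqr_sum y J x n : (forall i, `|y i| < 1) -> `|x| < 1 ->
  \sum_(k < n) (blaschke_prod y J x * blaschke_seqs y J (fun k => x ^+ k) k) ^+ 2 <=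
  residual y J x.
Proof.
move=> y1 x1; under eq_bigr do rewrite exprMn.
rewrite -mulr_sumr /residual ler_wpM2l ?sqr_ge0//.
apply: le_trans (blaschke_seqs_contract _ _ _ y1) _.
by rewrite -[leRHS]mul1r ler_pdivlMr ?sqr_lt1// mulrC sum_sqr_pow_le.
Qed.

End TakenakaMalmquist.

(** * Gaussian comparison *)

Section QuadraticForms.
Variable R : realType.

Definition quad p (A : 'M[R]_p) (x : 'cV[R]_p) : R := (x^T *m A *m x) 0 0.

Definition dot p (x y : 'cV[R]_p) : R := (x^T *m y) 0 0.

Definition coercive p (c : R) (A : 'M[R]_p) :=
  A^T = A /\ forall x, c * dot x x <= quad A x.

Lemma dotE p (x y : 'cV[R]_p) : dot x y = \sum_i x i 0 * y i 0.
Proof. by rewrite /dot mxE; apply: eq_bigr => i _; rewrite mxE. Qed.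

Lemma dot_ge0 p (x : 'cV[R]_p) : 0 <= dot x x.
Proof. by rewrite dotE sumr_ge0// => i _; rewrite -expr2 sqr_ge0. Qed.

Lemma dotC p (x y : 'cV[R]_p) : dot x y = dot y x.
Proof. by rewrite !dotE; apply: eq_bigr => i _; rewrite mulrC. Qed.

Lemma quadE p (A : 'M[R]_p) x : quad A x = dot x (A *m x).
Proof. by rewrite /quad /dot mulmxA. Qed.

Lemma quadD p (A B : 'M[R]_p) x : quad (A + B) x = quad A x + quad B x.
Proof. by rewrite /quad mulmxDr mulmxDl mxE. Qed.

Lemma quad_rank1 p (v w x : 'cV[R]_p) : quad (v *m w^T) x = dot x v * dot w x.
Proof. by rewrite /quad mulmxA -mulmxA mxE big_ord1. Qed.

(** Gaussian elimination of the first coordinate: the pivot is at least [1], and the Schur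
    complement is the form minimised over that coordinate, hence dominates the identity again. *)
Lemma det_coercive1_ge1 p (A : 'M[R]_p) : coercive 1 A -> 1 <= \det A.
Proof.
elim: p A => [|p IH] A; first by rewrite det_mx00.
move: A; rewrite -[p.+1]add1n => A; rewrite -[A]submxK.
set a := ulsubmx _; set r := ursubmx _; set c := dlsubmx _; set M := drsubmx _.
case; rewrite tr_block_mx => /eq_block_mx[_ cr _ MM] pos.
have a1 : 1 <= a 0 0.
  have := pos (col_mx 1%:M 0); rewrite quadE mul_block_col !mulmx0 !addr0 !mulmx1.
  rewrite /dot !tr_col_mx !mul_row_col trmx0 !mul0mx !addr0 trmx1 !mul1mx mxE mxE eqxx mul1r.
  by rewrite mulr1n.
have a0 : a 0 0 != 0 by rewrite gt_eqF// (lt_le_trans ltr01).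
have aE : a = (a 0 0)%:M by exact: mx11_scalar.
pose S := M - (a 0 0)^-1 *: (c *m r).
have -> : block_mx a r c M = block_mx 1%:M 0 ((a 0 0)^-1 *: c) 1%:M *m block_mx a r 0 S.
  rewrite mulmx_block !mul1mx !mul0mx !addr0; congr block_mx.
    by rewrite {2}aE -scalemxAl mul_mx_scalar scalerA mulVf// scale1r.
  by rewrite /S -scalemxAl addrC subrK.
rewrite det_mulmx det_lblock !det1 !mul1r det_ublock det_mx11.
rewrite -[leLHS]mulr1 ler_pM//; apply: IH; split.
  by rewrite /S linearB /= linearZ /= trmx_mul MM -cr trmxK.
move=> y; have := pos (col_mx (- (a 0 0)^-1 *: (r *m y)) y).
rewrite quadE mul_block_col /dot !tr_col_mx !mul_row_col -!/(dot _ _).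
have -> : a *m (- (a 0 0)^-1 *: (r *m y)) + r *m y = 0.
  by rewrite {1}aE mul_scalar_mx scalerA mulrN mulfV// scaleN1r addNr.
rewrite mulmx0 add0r => h.
rewrite quadE; apply: le_trans (le_trans _ h) _.
  rewrite !mul1r [leRHS]mxE lerDr; exact: dot_ge0.
rewrite le_eqVlt; apply/orP; left; apply/eqP; congr dot.
rewrite /S mulmxBl -scalemxAl addrC; congr (_ + _).
by rewrite -scalemxAr scaleNr mulmxA.
Qed.

Lemma coercive_unit p c (A : 'M[R]_p) : 0 < c -> coercive c A -> 0 < \det A /\ A \in unitmx.
Proof.
move=> c0 [h1 h2]; suff h : 0 < \det A by rewrite unitmxE unitfE gt_eqF.
have /det_coercive1_ge1 : coercive 1 (c^-1 *: A).
  split=> [|x]; first by rewrite linearZ /= h1.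
  rewrite mul1r /quad -scalemxAr -scalemxAl mxE -/(quad _ _) mulrC ler_pdivlMr//.
  by rewrite mulrC.
rewrite detZ => /(lt_le_trans ltr01).
by rewrite pmulr_rgt0// exprn_gt0// invr_gt0.
Qed.

(** [A >= F F^T] becomes [F^-1 A F^-T >= 1] after conjugation, and [det_coercive1_ge1] applies. *)
Lemma det_ge_triangular p (A F : 'M[R]_p) : A^T = A ->
  (forall x, dot (F^T *m x) (F^T *m x) <= quad A x) ->
  is_trig_mx F -> (forall i, F i i != 0) ->
  \prod_i F i i ^+ 2 <= \det A.
Proof.
move=> h1 h2 tF F0.
have dF : \det F = \prod_i F i i by exact: det_trig.
have dF0 : \det F != 0 by rewrite dF; apply/prodf_neq0 => i _; exact: F0.
have uF : F \in unitmx by rewrite unitmxE unitfE.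
pose G := invmx F.
have FG : F *m G = 1%:M by exact: mulmxV.
have /det_coercive1_ge1 : coercive 1 (G *m A *m G^T).
  split=> [|x]; first by rewrite !trmx_mul trmxK h1 mulmxA.
  have := h2 (G^T *m x); rewrite mulmxA -trmx_mul.
  have GF : G *m F = 1%:M by exact: mulVmx.
  rewrite GF trmx1 mul1mx mul1r; move/le_trans; apply.
  by rewrite /quad trmx_mul trmxK !mulmxA.
rewrite !det_mulmx det_tr det_inv => h.
rewrite prodrXl -dF.
have : 0 < \det F ^+ 2 by rewrite exprn_even_gt0.
move=> d0; rewrite -[leLHS]mulr1.
have -> : \det A = \det F ^+ 2 * ((\det F)^-1 * \det A * (\det F)^-1).
  by field.
by rewrite ler_pM2l.
Qed.

(** Matrix determinant lemma: both sides are the determinant of one bordered matrix, eliminated in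
    the two possible orders. *)
Lemma det_rank1 p (B : 'M[R]_p) (v w : 'cV[R]_p) : B \in unitmx ->
  \det (B + v *m w^T) = (1 + dot w (invmx B *m v)) * \det B.
Proof.
move=> uB; pose M := block_mx (1%:M : 'M[R]_1) (- w^T) v B.
have -> : \det (B + v *m w^T) = \det M.
  have -> : M = block_mx 1%:M 0 v 1%:M *m block_mx (1%:M : 'M[R]_1) (- w^T) 0 (B + v *m w^T).
    rewrite mulmx_block !mul1mx !mul0mx !addr0 !mulmx1 mulmxN.
    by rewrite addrC addrK.
  by rewrite det_mulmx det_lblock det_ublock !det1 !mul1r.
have -> : M = block_mx (1%:M + w^T *m (invmx B *m v) : 'M[R]_1) (- w^T) 0 B *m
    block_mx 1%:M 0 (invmx B *m v) 1%:M.
  rewrite mulmx_block !mulmx0 !mulmx1 !add0r mulNmx addrK.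
  by rewrite mulKVmx.
rewrite det_mulmx det_lblock det_ublock !det1 !mulr1 det_mx11 !mxE.
by congr ((_ + _) * _); rewrite /dot mxE.
Qed.

Lemma quad_invmx_ge0 p c (B : 'M[R]_p) (v : 'cV[R]_p) : 0 < c -> coercive c B ->
  0 <= quad (invmx B) v /\ c * quad (invmx B) v <= dot v v.
Proof.
move=> c0 cB; have [_ uB] := coercive_unit c0 cB; have [sB pB] := cB.
pose y := invmx B *m v.
have qE : quad (invmx B) v = dot v y by rewrite quadE.
have qB : quad B y = dot v y by rewrite quadE dotC /y mulKVmx.
have := pB y; rewrite qB -qE => h.
have y0 := dot_ge0 y.
split; first by apply: le_trans h; rewrite mulr_ge0// ltW.
have := dot_ge0 (v - c *: y).
have -> : dot (v - c *: y) (v - c *: y) = dot v v - 2 * c * dot v y + c ^+ 2 * dot y y.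
  rewrite !dotE !mulr_sumr -sumrB -big_split /=; apply: eq_bigr => i _.
  by rewrite !mxE; ring.
rewrite -qE; nra.
Qed.

Lemma coercive_rank1 p c (B : 'M[R]_p) (v : 'cV[R]_p) : coercive c B -> coercive c (B + v *m v^T).
Proof.
move=> [h1 h2]; split; first by rewrite linearD /= h1 trmx_mul trmxK.
move=> x; rewrite quadD quad_rank1 (dotC v x) (le_trans (h2 x))// lerDl -expr2.
exact: sqr_ge0.
Qed.

(** The Sherman-Morrison formula in terms of quadratic forms; coercivity keeps the denominator
    positive. *)
Lemma quad_invmx_rank1 p c (B : 'M[R]_p) (v x : 'cV[R]_p) : 0 < c -> coercive c B ->
  quad (invmx (B + v *m v^T)) x =
  quad (invmx B) x - (dot v (invmx B *m x)) ^+ 2 / (1 + quad (invmx B) v).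
Proof.
move=> c0 cB; have [_ uB] := coercive_unit c0 cB.
have [_ uB1] := coercive_unit c0 (coercive_rank1 v cB).
have [q0 _] := quad_invmx_ge0 v c0 cB.
set A := invmx B; set q := quad A v in q0 *.
have sA : A^T = A by rewrite /A trmx_inv; case: cB => ->.
have q1 : 1 + q != 0 by rewrite gt_eqF// ltr_wpDr.
pose X := A - (1 + q)^-1 *: (A *m v *m (v^T *m A)).
have BX : (B + v *m v^T) *m X = 1%:M.
  rewrite /X mulmxBr -scalemxAr !mulmxDl mulmxV// !mulmxA mulmxV// mul1mx.
  have -> : v *m v^T *m A *m v *m v^T *m A = q *: (v *m v^T *m A).
    rewrite -[v *m v^T *m A *m v]mulmxA -[v *m v^T *m (A *m v)]mulmxA.
    rewrite [v^T *m _]mx11_scalar -/(quad A v).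
    have -> : (v^T *m (A *m v)) 0 0 = q by rewrite /q quadE.
    by rewrite mul_mx_scalar -!scalemxAl.
  rewrite -[X in _ *: (X + _)]scale1r -scalerDl scalerA mulVf// scale1r.
  by rewrite addrK.
have -> : invmx (B + v *m v^T) = X by rewrite -[invmx _]mulmx1 -BX mulKmx.
rewrite /X /quad mulmxBr mulmxBl mxE; congr (_ + _).
rewrite -scalemxAr -scalemxAl mxE [X in - X]mxE mulrC; congr (- (_ * _)).
rewrite !mulmxA -[x^T *m A *m v *m v^T *m A *m x]mulmxA.
rewrite -[x^T *m A *m v *m v^T *m _]mulmxA mxE big_ord1 expr2.
congr (_ * _).
by rewrite [RHS]dotC /dot trmx_mul sA.
Qed.

End QuadraticForms.

(** * Replacing signs by Gaussians at given test points *)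

Section GaussianComparison.
Variable R : realType.

(* Replacing one random sign by a Gaussian: the left side is the average over
   the sign, the right side its Gaussian counterpart up to [expR (8 q ^ 2)]. *)
Lemma sign_step_le (q b a : R) : 0 <= q <= 1 / 8 ->
  (expR (- ((a + 2 * b + q) / 2)) + expR (- ((a - 2 * b + q) / 2))) / 2 <=
  expR (8 * q ^+ 2) / Num.sqrt (1 + q) * expR (- ((a - b ^+ 2 / (1 + q)) / 2)).
Proof.
move=> /andP[q0 q8].
have q1 : 0 < 1 + q by rewrite ltr_wpDr.
have -> : - ((a + 2 * b + q) / 2) = - ((a + q) / 2) - b by field.
have -> : - ((a - 2 * b + q) / 2) = - ((a + q) / 2) + b by field.
rewrite !expRD -mulrDr -mulrA [expR (- b) + _]addrC.
have h1 : (expR b + expR (- b)) / 2 <= expR ((1 - q) * (b ^+ 2 / 2) + 8 * q ^+ 2).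
  by apply: cosh_le_expR; rewrite q0.
have h2 : Num.sqrt (1 + q) <= expR (q / 2).
  rewrite -[leRHS](@ger0_norm _ _) ?expR_ge0// -sqrtr_sqr ler_wsqrtr//.
  by rewrite -expRM_natl mulrC divfK// expR_ge1Dx.
have h3 : 1 <= expR (q / 2) / Num.sqrt (1 + q).
  by rewrite ler_pdivlMr ?mul1r// sqrtr_gt0.
apply: le_trans (_ : expR (- ((a + q) / 2)) * (expR ((1 - q) * (b ^+ 2 / 2) + 8 * q ^+ 2) *
  (expR (q / 2) / Num.sqrt (1 + q))) <= _).
  by rewrite ler_pM2l ?expR_gt0// -[leLHS]mulr1 ler_pM.
rewrite [X in X <= _](_ : _ = expR (8 * q ^+ 2) / Num.sqrt (1 + q) *
  expR (- ((a - (1 - q) * b ^+ 2) / 2))); last first.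
  by rewrite [RHS]mulrAC -expRD !mulrA -!expRD; congr (expR _ / _); field.
rewrite ler_pM2l ?divr_gt0 ?expR_gt0 ?sqrtr_gt0//.
rewrite ler_expR lerN2 ler_pM2r ?invr_gt0// lerD2l lerN2.
rewrite mulrC ler_wpM2l ?sqr_ge0//.
by rewrite -[leRHS]mul1r ler_pdivlMr//; nra.
Qed.

(** For standard Gaussians in place of the signs the average equals the last two factors exactly.
    The signs after the first are averaged by induction; the first then sees the form inverse to
    [B'], on which [sign_step_le] loses [8 q^2] with [q <= k0] by coercivity. The rank-one formulas
    for determinant and inverse reassemble the Gaussian expression. *)
Lemma gauss_comparison p (c k0 : R) n (B : 'M[R]_p) (v : nat -> 'cV[R]_p) (x : 'cV[R]_p) :
  0 < c -> coercive c B -> (forall k, dot (v k) (v k) <= c * k0) -> k0 <= 1 / 8 ->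
  sign_avg n (fun s => expR (- (quad (invmx B) (x + \sum_(k < n) s k *: v k) / 2))) <=
  expR (8 * k0 ^+ 2 * n%:R) *
  Num.sqrt (\det B / \det (B + \sum_(k < n) v k *m (v k)^T)) *
  expR (- (quad (invmx (B + \sum_(k < n) v k *m (v k)^T)) x / 2)).
Proof.
move=> c0 cB vb k08; elim: n v vb x => [|n IH] v vb x.
  rewrite /= !big_ord0 !addr0 mulr0 expR0 mul1r divff ?sqrtr1 ?mul1r//.
  by rewrite gt_eqF//; case: (coercive_unit c0 cB).
pose B' := B + \sum_(k < n) v k.+1 *m (v k.+1)^T.
have cB' : coercive c B'.
  rewrite /B'; elim: n {IH B'} => [|n IHn]; first by rewrite big_ord0 addr0.
  by rewrite big_ord_recr /= addrA; exact: coercive_rank1.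
have [dB _] := coercive_unit c0 cB.
have [dB' uB'] := coercive_unit c0 cB'.
have sA : (invmx B')^T = invmx B' by rewrite trmx_inv; case: cB' => ->.
have EB : B + \sum_(k < n.+1) v k *m (v k)^T = B' + v 0%N *m (v 0%N)^T.
  by rewrite big_ord_recl addrCA addrC.
set q := quad (invmx B') (v 0%N).
have [q0 qc] := quad_invmx_ge0 (v 0%N) c0 cB'; rewrite -/q in q0 qc.
have qk : q <= k0 by rewrite -(ler_pM2l c0) (le_trans qc).
set b := dot (v 0%N) (invmx B' *m x).
have quadS a : quad (invmx B') (x + a *: v 0%N) = quad (invmx B') x + 2 * a * b + a ^+ 2 * q.
  have e : dot x (invmx B' *m v 0%N) = b by rewrite dotC /dot trmx_mul sA -mulmxA.
  have dl u z : dot (x + a *: v 0%N) (u + a *: z) =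
      dot x u + a * dot x z + a * dot (v 0%N) u + a ^+ 2 * dot (v 0%N) z.
    rewrite !dotE !mulr_sumr -!big_split /=; apply: eq_bigr => i _.
    by rewrite !mxE; ring.
  by rewrite !quadE mulmxDr -scalemxAr dl e -/b /q quadE; ring.
pose K := expR (8 * k0 ^+ 2 * n%:R) * Num.sqrt (\det B / \det B').
have half a : sign_avg n (fun s => expR (- (quad (invmx B)
      (x + \sum_(k < n.+1) scons a s k *: v k) / 2))) <=
    K * expR (- (quad (invmx B') (x + a *: v 0%N) / 2)).
  rewrite (eq_sign_avg (G := fun s => expR (- (quad (invmx B)
      ((x + a *: v 0%N) + \sum_(k < n) s k *: v k.+1) / 2)))); last first.
    by move=> s _; rewrite big_ord_recl addrA.
  exact: (IH (fun k => v k.+1)).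
rewrite [sign_avg _ _]/=.
apply: le_trans (_ : K * ((expR (- (quad (invmx B') (x + 1 *: v 0%N) / 2)) +
   expR (- (quad (invmx B') (x + (-1) *: v 0%N) / 2))) / 2) <= _).
  by rewrite mulrA mulrDr ler_pM2r ?invr_gt0// lerD// half.
rewrite !quadS EB (quad_invmx_rank1 _ _ c0 cB') -/b -/q det_rank1// -quadE -/q.
set a := quad (invmx B') x.
have q8 : 0 <= q <= 1 / 8 by rewrite q0 (le_trans qk).
have := sign_step_le b a q8.
rewrite !mulr1 sqrrN expr1n mulrN1 mul1r mulNr => st.
have K0 : 0 <= K by rewrite mulr_ge0 ?expR_ge0 ?sqrtr_ge0.
apply: le_trans (ler_wpM2l K0 st) _.
rewrite mulrA ler_pM2r ?expR_gt0//.
have q1 : 0 < 1 + q by rewrite ltr_wpDr.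
have -> : Num.sqrt (\det B / ((1 + q) * \det B')) =
    Num.sqrt (\det B / \det B') / Num.sqrt (1 + q).
  rewrite -sqrtrV ?ltW// -sqrtrM; last by rewrite divr_ge0 ?ltW.
  by congr Num.sqrt; field; rewrite !gt_eqF.
rewrite /K [X in X <= _](_ : _ = expR (8 * k0 ^+ 2 * n%:R + 8 * q ^+ 2) *
  (Num.sqrt (\det B / \det B') / Num.sqrt (1 + q))); last by rewrite expRD; ring.
rewrite ler_wpM2r ?divr_ge0 ?sqrtr_ge0// ler_expR -natr1.
have : q ^+ 2 <= k0 ^+ 2 by rewrite lerXn2r ?nnegrE// (le_trans q0).
by lra.
Qed.

Lemma sum_gram (p n : nat) (x : 'I_p -> R) (y : 'I_n -> 'I_p -> R) :
  \sum_k (\sum_i x i * y k i) ^+ 2 = \sum_i \sum_j x i * x j * \sum_k y k i * y k j.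
Proof.
under eq_bigr => k _.
  rewrite expr2 mulr_suml; under eq_bigr do rewrite mulr_sumr; over.
rewrite exchange_big; apply: eq_bigr => i _ /=.
rewrite exchange_big; apply: eq_bigr => j _ /=.
by rewrite mulr_sumr; apply: eq_bigr => k _; ring.
Qed.

Definition point_vec (y : nat -> R) p k : 'cV[R]_p := \col_i y i ^+ k.

(** The full Gram matrix [1 / (1 - y i * y j)] is [F F^T] with [F i j = tm_fun y j (y i)],
    triangular because [tm_fun y j] vanishes at earlier nodes. Truncating the geometric series at
    [n] changes each entry by at most [Y^(2 n) / (1 - Y^2)], and [t^2] times the identity absorbs
    [p] such errors. *)
Lemma det_gram_ge (y : nat -> R) (p n : nat) (Y t : R) :
  0 < t -> Y < 1 -> (forall i, `|y i| <= Y) ->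
  p%:R * (Y ^+ (2 * n) / (1 - Y ^+ 2)) <= t ^+ 2 ->
  (forall i : 'I_p, residual y i (y i) != 0) ->
  \prod_(i < p) residual y i (y i) <=
  \det ((t ^+ 2)%:M + \sum_(k < n) point_vec y p k *m (point_vec y p k)^T).
Proof.
move=> t0 Y1 yY tl r0.
have Y0 : 0 <= Y := le_trans (normr_ge0 _) (yY 0%N).
have y1 i : `|y i| < 1 by rewrite (le_lt_trans (yY i)).
pose F : 'M[R]_p := \matrix_(i, j) tm_fun y j (y i).
have FE i : F i i ^+ 2 = residual y i (y i) by rewrite mxE tm_fun_diag_sqr.
under eq_bigr do rewrite -FE.
apply: det_ge_triangular.
- rewrite linearD /= tr_scalar_mx; congr (_ + _); rewrite linear_sum /=.
  by apply: eq_bigr => k _; rewrite trmx_mul trmxK.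
- move=> x.
  have -> : dot (F^T *m x) (F^T *m x) = \sum_i \sum_j x i 0 * x j 0 * (1 - y i * y j)^-1.
    rewrite dotE; transitivity (\sum_(l < p) (\sum_i x i 0 * tm_fun y l (y i)) ^+ 2).
      apply: eq_bigr => l _; rewrite -expr2; congr (_ ^+ 2).
      by rewrite mxE; apply: eq_bigr => i _; rewrite !mxE mulrC.
    rewrite sum_gram; apply: eq_bigr => i _; apply: eq_bigr => j _; congr (_ * _).
    by rewrite (@tm_kernel _ y p)// blaschke_prod_node// !mul0r addr0.
  have qs (m : nat) : quad (\sum_(k < m) point_vec y p k *m (point_vec y p k)^T) x =
      \sum_(k < m) (dot x (point_vec y p k)) ^+ 2.
    elim: m => [|m IH]; first by rewrite !big_ord0 /quad mulmx0 mul0mx mxE.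
    by rewrite !big_ord_recr /= quadD IH quad_rank1 (dotC (point_vec y p m) x) expr2.
  have -> : quad ((t ^+ 2)%:M + \sum_(k < n) point_vec y p k *m (point_vec y p k)^T) x =
     t ^+ 2 * \sum_i x i 0 ^+ 2 +
     \sum_i \sum_j x i 0 * x j 0 * \sum_(k < n) (y i * y j) ^+ k.
    rewrite quadD qs; congr (_ + _).
      rewrite quadE mul_scalar_mx dotE mulr_sumr; apply: eq_bigr => i _.
      by rewrite mxE; ring.
    transitivity (\sum_(k < n) (\sum_i x i 0 * y i ^+ k) ^+ 2).
      by apply: eq_bigr => k _; rewrite dotE; congr (_ ^+ 2); apply: eq_bigr => i _; rewrite mxE.
    rewrite sum_gram; apply: eq_bigr => i _; apply: eq_bigr => j _; congr (_ * _).
    by apply: eq_bigr => k _; rewrite exprMn.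
  rewrite -lerBlDr -sumrB.
  apply: le_trans (_ : \sum_(i < p) \sum_(j < p) (x i 0 ^+ 2 + x j 0 ^+ 2) / 2 *
       (Y ^+ (2 * n) / (1 - Y ^+ 2)) <= _).
    apply: ler_sum => i _; rewrite -sumrB; apply: ler_sum => j _.
    rewrite -mulrBr.
    have w0 := mul_lt1 (y1 i) (y1 j).
    have -> : (1 - y i * y j)^-1 - \sum_(k < n) (y i * y j) ^+ k =
        (y i * y j) ^+ n / (1 - y i * y j).
      have e : (1 - y i * y j) * \sum_(k < n) (y i * y j) ^+ k = 1 - (y i * y j) ^+ n.
        rewrite -[in RHS](expr1n R n) -[in LHS]opprB mulNr -subrX1 opprB.
        by rewrite expr1n.
      apply: (@mulfI _ (1 - y i * y j)); first by rewrite gt_eqF.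
      by rewrite mulrBr e [RHS]mulrCA !divff ?gt_eqF// mulr1 opprB addrC subrK.
    apply: le_trans (ler_norm _) _; rewrite normrM.
    have Y2 : Y ^+ 2 < 1 by rewrite expr_lt1.
    have yy : `|y i * y j| <= Y ^+ 2 by rewrite normrM expr2 ler_pM.
    rewrite ler_pM//.
      rewrite normrM.
      have := sqr_ge0 (`|x i 0| - `|x j 0|).
      rewrite -[x i 0 ^+ 2]real_normK ?num_real// -[x j 0 ^+ 2]real_normK ?num_real//.
      by nra.
    rewrite normrM normfV normrX ler_pM ?exprn_ge0 ?invr_ge0//.
      by rewrite exprM lerXn2r ?nnegrE ?exprn_ge0.
    rewrite ger0_norm ?(ltW w0)// lef_pV2 ?posrE// ?subr_gt0//.
    by rewrite lerD2l lerN2 (le_trans (ler_norm _)).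
  under eq_bigr do rewrite -mulr_suml -mulr_suml big_split /= sumr_const card_ord.
  rewrite -!mulr_suml big_split /= sumr_const card_ord.
  have s0 : 0 <= \sum_(i < p) x i 0 ^+ 2 by rewrite sumr_ge0// => i _; exact: sqr_ge0.
  rewrite [X in X <= _](_ : _ = p%:R * (Y ^+ (2 * n) / (1 - Y ^+ 2)) * \sum_(i < p) x i 0 ^+ 2).
    by rewrite ler_wpM2r.
  rewrite sumrMnl -mulr_natr; set S := \sum_(i < p) _; field.
  by rewrite subr_eq0 eq_sym lt_eqF// expr_lt1.
- apply/is_trig_mxP => i j ij; rewrite mxE /tm_fun blaschke_prod_node ?mulr0//.
- by move=> i; rewrite -sqrf_eq0 FE r0.
Qed.

(** Exponential Markov inequality: on the event, the sum of the [p] squared values divided by [t^2]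
    is at most [p], so the indicator is at most [e^(p / 2)] times the exponential averaged in
    [gauss_comparison], with [B] equal to [t^2] times the identity. *)
Lemma small_ball_nodes (y : nat -> R) (p n : nat) (Y t : R) :
  0 < t -> Y < 1 -> (forall i, `|y i| <= Y) ->
  p%:R * (Y ^+ (2 * n) / (1 - Y ^+ 2)) <= t ^+ 2 -> 8 * p%:R <= t ^+ 2 ->
  (forall i : 'I_p, residual y i (y i) != 0) ->
  sign_prob n (fun s => forall i, (i < p)%N -> `|\sum_(k < n) s k * y i ^+ k| <= t) <=
  expR (p%:R / 2 + 8 * (p%:R / t ^+ 2) ^+ 2 * n%:R) *
  Num.sqrt (\prod_(i < p) (t ^+ 2 / residual y i (y i))).
Proof.
move=> t0 Y1 yY tl tp r0.
have Y0 : 0 <= Y := le_trans (normr_ge0 _) (yY 0%N).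
have y1 i : `|y i| < 1 by rewrite (le_lt_trans (yY i)).
have t2 : 0 < t ^+ 2 by rewrite exprn_gt0.
pose B : 'M[R]_p := (t ^+ 2)%:M.
have cB : coercive (t ^+ 2) B.
  split; first by rewrite tr_scalar_mx.
  move=> x; rewrite quadE mul_scalar_mx !dotE mulr_sumr le_eqVlt; apply/orP; left.
  by apply/eqP; apply: eq_bigr => i _; rewrite mxE; ring.
have vb k : dot (point_vec y p k) (point_vec y p k) <= t ^+ 2 * (p%:R / t ^+ 2).
  rewrite mulrCA divff ?gt_eqF// mulr1 dotE.
  apply: le_trans (_ : \sum_(i < p) 1 <= _); last by rewrite sumr_const card_ord.
  apply: ler_sum => i _; rewrite mxE -expr2 -real_normK ?num_real// normrX -exprM.
  by rewrite exprn_ile1// ltW.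
have k8 : p%:R / t ^+ 2 <= 1 / 8 by rewrite ler_pdivrMr//; lra.
have := gauss_comparison n 0 t2 cB vb k8.
set Bn := B + _.
have -> : quad (invmx Bn) 0 = 0 by rewrite /quad mulmx0 mxE.
rewrite mul0r oppr0 expR0 mulr1 => G.
apply: le_trans (_ : expR (p%:R / 2) * sign_avg n (fun s => expR (- (quad (invmx B)
    (0 + \sum_(k < n) s k *: point_vec y p k) / 2))) <= _).
  rewrite -sign_avgZ; apply: le_sign_avg => s _; case: asboolP => h; last first.
    by rewrite mulr_ge0// expR_ge0.
  rewrite -expRD -[leLHS]expR0 ler_expR subr_ge0 ler_pM2r ?invr_gt0// add0r.
  rewrite /B invmx_scalar quadE mul_scalar_mx dotE.
  apply: le_trans (_ : \sum_(i < p) 1 <= _); last by rewrite sumr_const card_ord.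
  apply: ler_sum => i _; rewrite [X in _ * X]mxE mulrCA -expr2.
  rewrite mulrC ler_pdivrMr// mul1r.
  have -> : (\sum_(k < n) s k *: point_vec y p k) i 0 = \sum_(k < n) s k * y i ^+ k.
    by rewrite summxE; apply: eq_bigr => k _; rewrite !mxE.
  by rewrite -real_normK ?num_real// lerXn2r ?nnegrE ?(ltW t0)// h.
rewrite expRD -mulrA ler_pM2l ?expR_gt0//; apply: le_trans G _.
rewrite ler_pM2l ?expR_gt0// ler_wsqrtr//.
have D := det_gram_ge t0 Y1 yY tl r0.
have P0 : 0 < \prod_(i < p) residual y i (y i).
  by apply: prodr_gt0 => i _; rewrite lt_neqAle eq_sym r0 residual_ge0.
rewrite det_scalar -/Bn in D *.
rewrite big_split /= prodfV prodr_const card_ord.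
by rewrite ler_pM2l ?exprn_gt0// lef_pV2// posrE// (lt_le_trans P0).
Qed.

End GaussianComparison.

(** * Upper bound for small-ball probabilities *)

Section SmallBallUpper.
Variable R : realType.

Lemma ln_le_linear (C e : R) : 0 < C -> 0 < e ->
  exists2 L : R, 1 <= L & forall l, L <= l -> C * ln l + C <= e * l.
Proof.
move=> C0 e0; exists (Num.max 1 ((3 * C / e) ^+ 2)); first by rewrite le_max lexx.
move=> l; rewrite ge_max => /andP[l1 lL].
have l0 : 0 < l by rewrite (lt_le_trans ltr01).
pose r := Num.sqrt l.
have rr : r ^+ 2 = l by rewrite sqr_sqrtr// ltW.
have r1 : 1 <= r by rewrite -(@sqrtr1 R) ler_wsqrtr.
have rC : 3 * C / e <= r.
  rewrite -[leLHS]ger0_norm ?divr_ge0 ?mulr_ge0 ?(ltW C0) ?(ltW e0)// -sqrtr_sqr.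
  by rewrite /r ler_wsqrtr.
have h : ln l <= 2 * r.
  have r0 : 0 < r by rewrite (lt_le_trans ltr01).
  by rewrite -rr lnXn// mulr2n; have := ln_sublinear r0; lra.
have : 3 * C <= e * r by rewrite [leRHS]mulrC -ler_pdivrMr.
move=> h1; apply: le_trans (_ : 3 * C * r <= _); first by nra.
by rewrite -rr; nra.
Qed.

Lemma ln_ratio_mono (q q' : R) : 0 <= q -> q <= q' -> q' < 1 -> ln_ratio q <= ln_ratio q'.
Proof.
move=> q0 qq q1; rewrite /ln_ratio ler_ln ?posrE ?divr_gt0//; try lra.
rewrite ler_pM ?invr_ge0 ?lef_pV2 ?posrE//; lra.
Qed.

Lemma ln_ratio_expR (q : R) : 0 <= q < 1 -> (1 - q) / (1 + q) = expR (- ln_ratio q).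
Proof.
move=> /andP[q0 q1]; rewrite /ln_ratio expRN lnK ?invf_div// posrE divr_gt0//; lra.
Qed.

(* [cayley q] is [tanh v] for [q = exp (- 2 v)]. *)
Definition cayley (q : R) := (1 - q) / (1 + q).

(** Blaschke factors are differences in the hyperbolic coordinate: [tanh v] and [tanh v'] are sent
    to [tanh (v - v')]. In the next lemma the nodes lie on opposite sides and the coordinates
    add. *)
Lemma cayley_blaschke_same (q q' : R) : 0 < q' -> q' < q ->
  blaschke (cayley q') (cayley q) ^+ 2 = expR (- ln_ratio (q' / q)) ^+ 2.
Proof.
move=> q0 qq; have q1 : 0 < q by apply: lt_trans qq.
rewrite -ln_ratio_expR; last first.
  by rewrite divr_ge0 ?ltW//= ltr_pdivrMr// mul1r.
rewrite /blaschke /cayley.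
have h : q + q' != 0 by rewrite gt_eqF// addr_gt0.
by field; repeat (apply/andP; split); rewrite gt_eqF//; nra.
Qed.

Lemma cayley_blaschke_opp (q q' : R) : 0 < q' < 1 -> 0 < q < 1 ->
  blaschke (cayley q') (- cayley q) ^+ 2 = expR (- ln_ratio (q' * q)) ^+ 2.
Proof.
move=> /andP[q0' q1'] /andP[q0 q1].
have qq : 0 < q' * q < 1 by rewrite mulr_gt0//= mulr_ilt1// ltW.
rewrite -ln_ratio_expR; last by case/andP: qq => /ltW -> ->.
by rewrite /blaschke /cayley; field; repeat (apply/andP; split); rewrite gt_eqF//; nra.
Qed.

Lemma cayley_norm (q q0 : R) : 0 < q0 -> q0 <= q -> q <= 1 ->
  0 <= cayley q <= cayley q0.
Proof.
move=> h0 h1 h2; rewrite /cayley; apply/andP; split.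
  by rewrite divr_ge0//; lra.
by rewrite ler_pM ?invr_ge0 ?lef_pV2 ?posrE//; lra.
Qed.

Lemma cayley_sqr (q : R) : 0 < q -> (1 - cayley q ^+ 2)^-1 = (1 + q) ^+ 2 / (4 * q).
Proof.
move=> q0; by rewrite /cayley; field; repeat (apply/andP; split); rewrite gt_eqF//; nra.
Qed.

(** Comparison with the integral of the decreasing function [sqrt (b^2 - h x)]. One step reads
    [A^3 - B^3 <= (3 / 2) A (A^2 - B^2)], with defect [(A - B)^2 (A + 2 B) / 2]. *)
Lemma sum_sqrt_ge (b h : R) D : 0 < h -> 0 <= b -> h * D%:R <= b ^+ 2 ->
  2 / (3 * h) * (b ^+ 3 - Num.sqrt (b ^+ 2 - h * D%:R) ^+ 3) <=
  \sum_(j < D) Num.sqrt (b ^+ 2 - h * j%:R).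
Proof.
move=> h0 b0; elim: D => [|D IH] hD.
  by rewrite big_ord0 mulr0 subr0 sqrtr_sqr ger0_norm// subrr mulr0.
rewrite big_ord_recr /=; move: hD; rewrite -natr1 mulrDr mulr1 => hD.
have {}IH := IH (le_trans (ler_wpDr (ltW h0) (lexx _)) hD).
have e1 : Num.sqrt (b ^+ 2 - h * D%:R) ^+ 2 = b ^+ 2 - h * D%:R by rewrite sqr_sqrtr; lra.
have e2 : Num.sqrt (b ^+ 2 - (h * D%:R + h)) ^+ 2 = b ^+ 2 - (h * D%:R + h).
  by rewrite sqr_sqrtr; lra.
move: IH e1 e2; set A := Num.sqrt _; set B := Num.sqrt (_ - (_ + _)) => IH e1 e2.
have A0 : 0 <= A by exact: sqrtr_ge0.
have B0 : 0 <= B by exact: sqrtr_ge0.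
have hAB : h = A ^+ 2 - B ^+ 2 by lra.
rewrite -lerBlDl; apply: le_trans (lerB (lexx _) IH) _.
rewrite -mulrBr (_ : b ^+ 3 - B ^+ 3 - (b ^+ 3 - A ^+ 3) = A ^+ 3 - B ^+ 3); last by ring.
rewrite -ler_pdivlMl ?divr_gt0 ?mulr_gt0// invf_div.
rewrite [leRHS](_ : _ = 3 / 2 * A * h); last by field.
rewrite hAB -subr_ge0.
rewrite [leRHS](_ : _ = (A - B) ^+ 2 * (A + 2 * B) / 2); last by field.
by rewrite divr_ge0// mulr_ge0 ?sqr_ge0// addr_ge0// mulr_ge0.
Qed.

End SmallBallUpper.

Section SmallBallCore.
Variable R : realType.

Lemma big_triangle (V : nmodType) (F : nat -> nat -> V) D :
  \sum_(i < D) \sum_(j < i) F i j = \sum_(j < D) \sum_(1 <= m < D - j) F (j + m)%N j.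
Proof.
elim: D => [|D IH]; first by rewrite !big_ord0.
rewrite !big_ord_recr /= IH subSnn big_geq// addr0 -big_split /=.
apply: eq_bigr => j _; have jD := ltn_ord j.
rewrite subSn; last exact: ltnW.
by rewrite big_nat_recr ?subn_gt0//= subnKC// ltnW.
Qed.

Lemma blaschkeN (a w : R) : blaschke (- a) (- w) = - blaschke a w.
Proof. by rewrite /blaschke mulrNN -opprD mulNr. Qed.

Lemma pi_sqr_bounds : 4 <= @pi R ^+ 2 <= 16.
Proof.
have h1 := @pi_ge2 R; have h2 : @pi R <= 4 by have := @pihalf_lt2 R; lra.
by apply/andP; split; nra.
Qed.

Lemma ln_ratio_small (x T : R) : 0 < x -> x <= T -> T <= 1 / 2 -> ln_ratio x <= 3 * T.
Proof.
move=> x0 xT T2.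
have x01 : 0 <= x < 1 by rewrite (ltW x0) /=; lra.
have /andP[_ /le_trans] := ln_ratio_bounds 0 x01; apply.
have x4 : x ^+ 2 <= 1 / 4 by nra.
rewrite /odd_series big_ord0 add0r double0 expr1 ler_pdivrMr; last by lra.
have : 0 <= T * (1 / 4 - x ^+ 2) by rewrite mulr_ge0; lra.
by lra.
Qed.

Lemma cross_total (U : R) (D : nat) : 1 <= U -> 18 * D%:R <= U ->
  3 * U^-1 ^+ 2 *+ D *+ D <= 1.
Proof.
move=> U1 DU; have U0 : 0 < U by rewrite (lt_le_trans ltr01).
have -> (x : R) : x *+ D *+ D = x * (D%:R * D%:R) by rewrite -mulrnA -natrM mulr_natr.
rewrite [leLHS](_ : _ = 3 * (D%:R / U) ^+ 2); last by field; rewrite gt_eqF.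
have h : D%:R / U <= 1 / 18 by rewrite ler_pdivrMr//; lra.
have h0 : 0 <= D%:R / U by rewrite divr_ge0// ltW.
by nra.
Qed.

(* The nodes are [cayley (q j)] and their opposites, where [- ln (q j) / 2] runs
   from [V] downwards and [a j] is the remaining height: [a] solves the
   equilibrium equation [a' = - pi ^ 2 / (4 a)]. *)
Lemma small_ball_upper_core (l : R) (n : nat) :
  let b := l - ln (2 * l) / 2 - ln 2 - 1 / 2 in
  1 <= l -> 1 <= b -> expR (8 * l) <= n%:R ->
  sign_prob n (fun s => forall x : R, `|x| <= 1 ->
      `|\sum_(k < n) s k * x ^+ k| <= expR (- l) * Num.sqrt n%:R) <=
  expR (34 - 4 / (3 * pi ^+ 2) * b ^+ 3).
Proof.
move=> b l1 b1 nl.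
have l0 : 0 < l by rewrite (lt_le_trans ltr01).
have b0 : 0 < b by rewrite (lt_le_trans ltr01).
have n0 : 0 < n%:R :> R by rewrite (lt_le_trans (expR_gt0 _) nl).
have ln2l : 0 <= ln (2 * l) by rewrite ln_ge0//; lra.
have ln2 : 0 <= ln (2 : R) by rewrite ln_ge0//; lra.
have bl : b <= l by rewrite /b; lra.
set t := expR (- l) * Num.sqrt n%:R.
have t0 : 0 < t by rewrite mulr_gt0 ?expR_gt0// sqrtr_gt0.
have t2E : t ^+ 2 = expR (- (2 * l)) * n%:R.
  by rewrite exprMn sqr_sqrtr ?ltW// -expRM_natl; congr (expR _ * _); ring.
have t2l : expR (6 * l) <= t ^+ 2.
  rewrite t2E; apply: le_trans (_ : expR (- (2 * l)) * expR (8 * l) <= _).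
    by rewrite -expRD ler_expR; lra.
  by rewrite ler_pM2l ?expR_gt0.
have lnt : ln t = - l + ln n%:R / 2.
  have : ln (t ^+ 2) = - (2 * l) + ln n%:R.
    by rewrite t2E lnM ?posrE ?expR_gt0// expRK.
  by rewrite lnXn// mulr2n; lra.
clearbody t.
(* With this step [a j ^+ 2] decreases linearly in [j], so the node [m] places after [j] is at
   distance at least [m h / (2 a j)]; at that spacing [sum_ln_ratio_le] charges [a j / 2]. *)
set h : R := pi ^+ 2 / 2.
have /andP[pi4 pi16] := pi_sqr_bounds.
have h0 : 0 < h by rewrite /h; lra.
have [D /andP[hD1 hD2]] : exists D, h * D%:R <= b ^+ 2 < h * D.+1%:R.
  exists (Num.truncn (b ^+ 2 / h)).
  have x0 : 0 <= b ^+ 2 / h by rewrite divr_ge0 ?sqr_ge0// ltW.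
  have /andP[h1 h2] := truncn_itv x0.
  apply/andP; split; first by rewrite mulrC -ler_pdivlMr.
  by rewrite [ltRHS]mulrC -ltr_pdivrMr.
pose a (j : nat) := Num.sqrt (b ^+ 2 - h * j%:R).
have a_ge0 j : 0 <= a j by exact: sqrtr_ge0.
have a_le j : a j <= b.
  rewrite -[leRHS]ger0_norm ?(ltW b0)// -sqrtr_sqr ler_wsqrtr// lerBlDr lerDl.
  by rewrite mulr_ge0// ltW.
have a_sqr j : (j <= D)%N -> a j ^+ 2 = b ^+ 2 - h * j%:R.
  move=> jD; rewrite sqr_sqrtr// subr_ge0 (le_trans _ hD1)// ler_pM2l//.
  by rewrite ler_nat.
have a_gt0 j : (j < D)%N -> 0 < a j.
  move=> jD; rewrite sqrtr_gt0 subr_gt0 (lt_le_trans _ hD1)// ltr_pM2l//.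
  by rewrite ltr_nat.
(* Normalised so that [4 t^2 q j = exp (- 1 - 2 a j)]: the [4] comes from
   [1 / (1 - y^2) = (1 + q)^2 / (4 q)], and over the [2 D] nodes the [- 1] gives, after the square
   root, the factor [e^(- D)] that cancels [e^(p / 2)] in [small_ball_nodes]. *)
pose W := ln t + ln 2 + 1 / 2.
pose q j := expR (- (2 * (W + a j))).
have q_gt0 j : 0 < q j by exact: expR_gt0.
(* The value of [q] at height [b], a lower bound for all others. The definition of [b] makes it
   [2 l / n], whence [cayley q0 ^+ (2 * n) <= exp (- 4 l)] and the truncation at [n] terms is
   harmless. *)
have [q0 q0def] : exists q0, q0 = 2 * l / n%:R by exists (2 * l / n%:R).
have q00 : 0 < q0 by rewrite q0def divr_gt0// mulr_gt0.
have q0E : q0 = expR (- (2 * (W + b))).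
  apply: ln_inj; rewrite ?posrE ?expR_gt0//.
  rewrite expRK q0def ln_div ?posrE ?mulr_gt0//.
  by rewrite /W lnt /b; lra.
have q0_le j : q0 <= q j by rewrite q0E ler_expR; have := a_le j; lra.
have qt j : q j <= (t ^+ 2)^-1.
  have -> : (t ^+ 2)^-1 = expR (- (2 * ln t)).
    by rewrite expRN mulrC expRM_natr lnK.
  by rewrite ler_expR /W; have := a_ge0 j; lra.
have t21 : 1 <= t ^+ 2.
  by apply: le_trans t2l; rewrite -[leLHS]expR0 ler_expR; lra.
have q_le1 j : q j <= 1 by apply: le_trans (qt j) _; rewrite invf_le1// (lt_le_trans ltr01).
have el (c : R) : 0 <= c -> c ^+ 2 / 2 <= expR c.
  by move=> c0; apply: le_trans (expR_ge_quad c0); lra.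
have t2q : 18 * l ^+ 2 <= t ^+ 2.
  by apply: le_trans t2l; apply: le_trans (el (6 * l) _); lra.
have Dl : D%:R <= l ^+ 2.
  have : 2 * D%:R <= h * D%:R by rewrite ler_wpM2r// /h; lra.
  have : b ^+ 2 <= l ^+ 2 by rewrite lerXn2r ?nnegrE ?(ltW b0) ?(ltW l0).
  have : 0 <= D%:R :> R by [].
  lra.
pose y (i : nat) := if (i < D)%N then cayley (q i) else - cayley (q (i - D)%N).
have yY i : `|y i| <= cayley q0.
  rewrite /y; case: ifP => _; rewrite ?normrN.
    have /andP[c1 c2] := cayley_norm q00 (q0_le i) (q_le1 i).
    by rewrite ger0_norm.
  have /andP[c1 c2] := cayley_norm q00 (q0_le (i - D)%N) (q_le1 (i - D)%N).
  by rewrite ger0_norm.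
have q01 : q0 <= 1 by apply: le_trans (q0_le 0%N) (q_le1 0%N).
have Y1 : cayley q0 < 1 by rewrite /cayley ltr_pdivrMr; clear - q00; lra.
have Y0 : 0 <= cayley q0 := le_trans (normr_ge0 _) (yY 0%N).
pose p := (D + D)%N.
have pE : p%:R = 2 * D%:R :> R by rewrite /p natrD; ring.
have c1 : p%:R * (cayley q0 ^+ (2 * n) / (1 - cayley q0 ^+ 2)) <= t ^+ 2.
  rewrite cayley_sqr//.
  have Yn : cayley q0 ^+ (2 * n) <= expR (- (4 * l)).
    apply: le_trans (_ : expR (- q0) ^+ (2 * n) <= _).
      rewrite lerXn2r ?nnegrE ?expR_ge0// (le_trans _ (expR_ge1Dx _))//.
      by rewrite /cayley ler_pdivrMr; clear - q00 q01; nra.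
    rewrite -expRM_natl ler_expR natrM q0def le_eqVlt; apply/orP; left; apply/eqP.
    by field; rewrite gt_eqF.
  have Yq : (1 + q0) ^+ 2 / (4 * q0) <= n%:R / (2 * l).
    have -> : n%:R / (2 * l) = q0^-1 by rewrite q0def invf_div.
    rewrite ler_pdivrMr ?mulr_gt0// mulrCA mulVf ?gt_eqF//; clear - q00 q01; nra.
  apply: le_trans (_ : p%:R * (expR (- (4 * l)) * (n%:R / (2 * l))) <= _).
    rewrite ler_wpM2l// ler_pM// ?exprn_ge0//.
    by rewrite divr_ge0 ?sqr_ge0// mulr_ge0 ?(ltW q00).
  rewrite t2E pE.
  have -> : expR (- (4 * l)) = expR (- (2 * l)) * expR (- (2 * l)) by rewrite -expRD; congr expR; ring.
  have -> : 2 * D%:R * (expR (- (2 * l)) * expR (- (2 * l)) * (n%:R / (2 * l))) =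
    expR (- (2 * l)) * n%:R * (D%:R * expR (- (2 * l)) / l).
    by field; rewrite gt_eqF.
  rewrite ler_piMr ?mulr_ge0 ?expR_ge0// ler_pdivrMr// mul1r.
  have e2 := expR_ge1Dx (2 * l).
  have e3 : expR (2 * l) * expR (- (2 * l)) = 1 by rewrite expRxMexpNx_1.
  have := expR_gt0 (- (2 * l)); clear - e2 e3 Dl l1; nra.
have c2 : 8 * p%:R <= t ^+ 2 by have := sqr_ge0 l; rewrite pE; clear - t2q Dl; lra.
pose lam i j := ln_ratio (q j / q i).
pose cr i j := ln_ratio (q j * q i).
have qlt i j : (j < i)%N -> (i < D)%N -> q j < q i.
  move=> ji iD; rewrite ltr_expR ltrN2 ltr_pM2l// ltrD2l ltr_sqrt.
    by rewrite ltrD2l ltrN2 ltr_pM2l// ltr_nat.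
  rewrite subr_gt0 (lt_le_trans _ hD1)// ltr_pM2l//.
  by rewrite ltr_nat (ltn_trans ji).
have q_lt1 j : q j < 1.
  apply: le_lt_trans (qt j) _; rewrite invf_lt1 ?exprn_gt0//.
  by apply: lt_le_trans t2q; nra.
(* Half the logarithm of the bound for [t ^+ 2 / residual]. Only earlier nodes enter the Blaschke
   product, so the cross terms [cr] appear for the mirrored nodes only. *)
pose ex i := - (1 / 2) - a (if (i < D)%N then i else (i - D)%N) +
   (if (i < D)%N then \sum_(j < i) lam i j
    else \sum_(j < D) cr (i - D)%N j + \sum_(j < i - D) lam (i - D)%N j).
have resE i : (i < p)%N -> 0 < residual y i (y i) /\
    t ^+ 2 / residual y i (y i) <= expR (2 * ex i).
  move=> ip.
  have hprod : blaschke_prod y i (y i) ^+ 2 = expR (- (2 *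
   (if (i < D)%N then \sum_(j < i) lam i j
    else \sum_(j < D) cr (i - D)%N j + \sum_(j < i - D) lam (i - D)%N j))).
    rewrite /blaschke_prod -prodrXl; case: (ltnP i D) => iD.
      rewrite mulr_sumr -sumrN expR_sum; apply: eq_bigr => j _.
      have jD : (j < D)%N by rewrite (ltn_trans _ iD).
      rewrite /y iD jD cayley_blaschke_same//; last exact: qlt.
      by rewrite -expRM_natl mulrN.
    have iD' : (i < D)%N = false by rewrite ltnNge iD.
    have jD' j : (D + j < D)%N = false by rewrite ltnNge leq_addr.
    have ipD : (i - D < D)%N by rewrite ltn_subLR.
    rewrite -(big_mkord xpredT (fun j => blaschke (y j) (y i) ^+ 2)).
    rewrite -[X in \prod_(0 <= _ < X) _](subnKC iD) big_mkord big_split_ord /= mulrDr opprD expRD.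
    congr (_ * _).
      rewrite mulr_sumr -sumrN expR_sum; apply: eq_bigr => j _.
      rewrite /y iD' ltn_ord cayley_blaschke_opp ?q_gt0 ?q_lt1//.
      by rewrite -expRM_natl mulrN.
    rewrite mulr_sumr -sumrN expR_sum; apply: eq_bigr => j _.
    rewrite /y iD' jD' addKn blaschkeN sqrrN.
    rewrite cayley_blaschke_same//; last by apply: qlt.
    by rewrite -expRM_natl mulrN.
  have yq : (1 - y i ^+ 2)^-1 =
      (1 + q (if (i < D)%N then i else (i - D)%N)) ^+ 2 /
      (4 * q (if (i < D)%N then i else (i - D)%N)).
    by rewrite /y; case: ifP => _; rewrite ?sqrrN cayley_sqr.
  rewrite /residual hprod yq /ex.
  set S := (if _ then \sum_(j < i) _ else _); set i' := (if _ then i else _).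
  have qi := q_gt0 i'.
  have X0 : 0 < expR (- (2 * S)) * ((1 + q i') ^+ 2 / (4 * q i')).
    by rewrite mulr_gt0 ?expR_gt0// divr_gt0 ?mulr_gt0 ?exprn_gt0 ?addr_gt0.
  split => //; rewrite ler_pdivrMr//.
  have -> : 2 * (- (1 / 2) - a i' + S) = - 1 - 2 * a i' + 2 * S by field.
  rewrite [leRHS]mulrA -expRD.
  have -> : - 1 - 2 * a i' + 2 * S - 2 * S = - 1 - 2 * a i' by ring.
  rewrite [leRHS]mulrA ler_pdivlMr ?mulr_gt0//.
  have -> : t ^+ 2 * (4 * q i') = expR (- 1 - 2 * a i').
    apply: ln_inj; rewrite ?posrE ?mulr_gt0 ?expR_gt0 ?exprn_gt0//.
    have lq : ln (q i') = - (2 * (W + a i')) by exact: expRK.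
    rewrite expRK !lnM ?posrE ?mulr_gt0 ?exprn_gt0// lq /W.
    have -> : ln (4 : R) = ln 2 + ln 2 by rewrite -lnM ?posrE//; congr ln; ring.
    by clear; lra.
  by rewrite ler_peMr ?expR_ge0//; clear - qi; nra.
have := small_ball_nodes t0 Y1 yY c1 c2 (fun i => lt0r_neq0 (resE i (ltn_ord i)).1).
move=> SB; apply: le_trans (_ : sign_prob n (fun s => forall i, (i < p)%N ->
  `|\sum_(k < n) s k * y i ^+ k| <= t) <= _).
  by apply: le_sign_prob => s _ H i _; apply: H; rewrite (le_trans (yY i))// ltW.
apply: le_trans SB _.
(* The factor [e^(D + 6)] covers the exponential prefactor, in which the Gaussian replacement costs
   at most [6]. In the remaining exponent the heights give [- 2 A], same-side interactions at most
   [A], cross terms at most [1], and [A] falls short of [4 b^3 / (3 pi^2)] by at most [27]. *)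
have -> : expR (34 - 4 / (3 * pi ^+ 2) * b ^+ 3) =
  expR (D%:R + 6) * expR (28 - D%:R - 4 / (3 * pi ^+ 2) * b ^+ 3).
  by rewrite -expRD; congr expR; ring.
rewrite ler_pM ?expR_ge0 ?sqrtr_ge0//.
  rewrite ler_expR pE; have -> : 2 * D%:R / 2 = D%:R :> R by field.
  rewrite lerD2l.
  have e4 : 11 / 2 * l ^+ 4 <= expR (4 * l).
    apply: le_trans (expR_ge_pow6 _); last by lra.
    have -> : (4 * l) ^+ 6 / 720 = 256 / 45 * l ^+ 4 * l ^+ 2 by field.
    have : 0 <= l ^+ 4 by rewrite exprn_ge0// ltW.
    have : 1 <= l ^+ 2 by rewrite exprn_ege1.
    clear; nra.
  have -> : 8 * (2 * D%:R / t ^+ 2) ^+ 2 * n%:R = 32 * D%:R ^+ 2 * (n%:R / (t ^+ 2) ^+ 2).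
    by field; rewrite gt_eqF.
  have -> : n%:R / (t ^+ 2) ^+ 2 = expR (4 * l) / n%:R.
    rewrite t2E exprMn -expRM_natl; have -> : 2%:R * - (2 * l) = - (4 * l) by ring.
    rewrite expRN; have E0 := expR_gt0 (4 * l); move: (expR _) E0 => E E0.
    by field; rewrite !gt_eqF.
  have En : expR (4 * l) / n%:R <= (expR (4 * l))^-1.
    rewrite ler_pdivrMr// [leRHS]mulrC ler_pdivlMr ?expR_gt0// -expRD.
    by apply: le_trans nl; rewrite ler_expR; lra.
  apply: le_trans (_ : 32 * (l ^+ 2) ^+ 2 * (expR (4 * l))^-1 <= _).
    rewrite ler_pM ?mulr_ge0 ?divr_ge0 ?sqr_ge0 ?expR_ge0//.
    by rewrite ler_pM2l// lerXn2r ?nnegrE ?sqr_ge0.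
  rewrite -exprM ler_pdivrMr ?expR_gt0//.
  have : 0 <= l ^+ 4 by rewrite exprn_ge0// ltW.
  by rewrite (_ : 2 * 2 = 4)%N//; lra.
apply: le_trans (_ : Num.sqrt (expR (\sum_(i < p) 2 * ex i)) <= _).
  rewrite ler_wsqrtr// expR_sum ler_prod// => i _.
  have [r1 r2] := resE i (ltn_ord i).
  by rewrite divr_ge0 ?sqr_ge0 ?(ltW r1).
rewrite -mulr_sumr expRM_natl sqrtr_sqr ger0_norm ?expR_ge0// ler_expR.
rewrite /p big_split_ord /=.
rewrite (eq_bigr (fun i : 'I_D => (- (1 / 2) - a i) + \sum_(j < i) lam i j)); last first.
  by move=> i _; rewrite /ex ltn_ord.
rewrite [X in _ + X <= _](eq_bigr (fun i : 'I_D => (- (1 / 2) - a i) +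
    (\sum_(j < D) cr i j + \sum_(j < i) lam i j))); last first.
  by move=> i _; rewrite /ex ltnNge leq_addr /= addKn.
rewrite !big_split /= !sumrN !sumr_const card_ord.
have -> : \sum_(i < D) \sum_(j < i) lam i j = \sum_(j < D) \sum_(1 <= m < D - j) lam (j + m)%N j.
  exact: big_triangle.
set A := \sum_(i < D) a i; set L := \sum_(j < D) _; set C := \sum_(i < D) _.
have HL : L <= A / 2.
  rewrite /L /A mulr_suml; apply: ler_sum => j _.
  have jD := ltn_ord j; have aj := a_gt0 j jD.
  have d0 : 0 < h / (2 * a j) by rewrite divr_gt0// mulr_gt0.
  have -> : a j / 2 = pi ^+ 2 / (8 * (h / (2 * a j))).
    rewrite /h; have : 0 < pi ^+ 2 :> R by lra.
    by move: (pi ^+ 2 : R) => P P0; field; rewrite !gt_eqF.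
  apply: le_trans (sum_ln_ratio_le (D - j).-1 d0).
  rewrite prednK ?subn_gt0// big_nat_cond [leRHS]big_nat_cond ler_sum// => m.
  rewrite andbT => /andP[m1 mD].
  have jmD : (j + m < D)%N by rewrite -ltn_subRL.
  have qq : q j / q (j + m)%N = expR (- (2 * (a j - a (j + m)%N))).
    by rewrite -expRB; congr expR; ring.
  apply: ln_ratio_mono; first by rewrite divr_ge0 ?ltW.
    rewrite qq ler_expR lerN2 mulrCA ler_pM2l//.
    have s1 := a_sqr j (ltnW jD); have s2 := a_sqr (j + m)%N (ltnW jmD).
    rewrite mulrA ler_pdivrMr ?mulr_gt0//.
    move: s1 s2; rewrite natrD mulrDr => s1 s2.
    have a1 := a_ge0 (j + m)%N.
    have a2 : a (j + m)%N <= a j.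
      by rewrite -(@ler_pXn2r _ 2)// ?nnegrE// s1 s2 lerD2l lerN2 lerDl mulr_ge0// ltW.
    clear - s1 s2 a1 a2 aj; nra.
  by rewrite expR_lt1 oppr_lt0 mulr_gt0 ?ltr0n// mulr_gt0.
have tt : (t ^+ 2)^-1 ^+ 2 <= 1 / 2.
  have T1 : (t ^+ 2)^-1 <= 1 / 2.
    have l21 : 1 <= l ^+ 2 by rewrite exprn_ege1.
    by rewrite div1r lef_pV2 ?posrE ?exprn_gt0//; clear - t2q l21; lra.
  have T0 : 0 <= (t ^+ 2)^-1 by rewrite invr_ge0 ltW// exprn_gt0.
  by clear - T1 T0; nra.
have t2D : 18 * D%:R <= t ^+ 2 by clear - t2q Dl; lra.
(* Opposite nodes are so far apart that each cross term is at most [3 / t^4]; there are [D^2] of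
   them, and [18 D <= t^2]. *)
have HC : C <= 1.
  rewrite /C; apply: le_trans (_ : \sum_(i < D) \sum_(j < D) 3 * (t ^+ 2)^-1 ^+ 2 <= _).
    apply: ler_sum => i _; apply: ler_sum => j _.
    apply: ln_ratio_small; first by rewrite mulr_gt0.
      by rewrite expr2 ler_pM ?(ltW (q_gt0 _))// qt.
    exact: tt.
  by rewrite !sumr_const !card_ord; exact: cross_total.
have HA : 4 / (3 * pi ^+ 2) * b ^+ 3 - 27 <= A.
  have h' : 0 <= b by rewrite ltW.
  have := sum_sqrt_ge h0 h' hD1; rewrite -/A.
  have -> : 2 / (3 * h) = 4 / (3 * pi ^+ 2).
    rewrite /h; have : 0 < pi ^+ 2 :> R by lra.
    by move: (pi ^+ 2 : R) => P P0; field; rewrite !gt_eqF.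
  apply: le_trans; rewrite mulrBr lerD2l lerN2.
  set r := Num.sqrt _.
  have r0 : 0 <= r by exact: sqrtr_ge0.
  have r3 : r <= 3.
    rewrite -(@ler_pXn2r _ 2)// ?nnegrE// sqr_sqrtr ?subr_ge0//.
    by move: hD2; rewrite -natr1 mulrDr mulr1 /h; lra.
  have r27 : r ^+ 3 <= 27 by clear - r0 r3; have : r ^+ 2 <= 9; nra.
  have r30 : 0 <= r ^+ 3 by rewrite exprn_ge0.
  have : 4 / (3 * pi ^+ 2) <= 1 :> R by rewrite ler_pdivrMr; lra.
  have : 0 <= 4 / (3 * pi ^+ 2) :> R by rewrite divr_ge0// mulr_ge0// sqr_ge0.
  clear - r30 r27; nra.
rewrite -[(1 / 2) *+ D]mulr_natl; clear - HL HC HA; lra.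
Qed.

End SmallBallCore.

Section SmallBallAsymptotic.
Variable R : realType.

(** The slack [K] absorbs the constant factor lost when a small polynomial is compared with its
    prefix at a nearby grid degree. *)
Lemma small_ball_upper (d : R) (K : R) : 0 < d -> 0 <= K ->
  exists2 L : R, 1 <= L & forall (l : R) (n : nat), L <= l -> expR (8 * l) <= n%:R ->
  sign_prob n (fun s => forall x : R, `|x| <= 1 ->
      `|\sum_(k < n) s k * x ^+ k| <= expR (K - l) * Num.sqrt n%:R) <=
  expR (- ((4 / (3 * pi ^+ 2) - d) * l ^+ 3)).
Proof.
move=> d0 K0; set c := 4 / (3 * pi ^+ 2).
have /andP[pi4 pi16] := pi_sqr_bounds R.
have c1 : c <= 1 by rewrite /c ler_pdivrMr; lra.
have c0 : 0 < c by rewrite /c divr_gt0//; lra.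
(* Half of [d] pays for [b >= (1 - 2 e) l], through [(1 - 2 e)^3 >= 1 - 6 e] and [c <= 1]; the other
   half absorbs the constant [34]. *)
pose e := Num.min (1 / 4) (d / 12).
have e0 : 0 < e by rewrite lt_min; apply/andP; split; lra.
have e4 : e <= 1 / 4 by rewrite ge_min lexx.
have ed : e <= d / 12 by rewrite ge_min lexx orbT.
have [L0 L01 HL0] := ln_le_linear (ltr0n R 2) e0.
exists (L0 + K + 4 + (K + K) / e + 68 / d).
  have : 0 <= (K + K) / e by rewrite divr_ge0 ?(ltW e0)// addr_ge0.
  have : 0 <= 68 / d by rewrite divr_ge0// ltW.
  lra.
move=> l n lL nl.
have q1 : 0 <= (K + K) / e by rewrite divr_ge0 ?(ltW e0)// addr_ge0.
have q2 : 0 <= 68 / d by rewrite divr_ge0// ltW.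
have l1 : 1 <= l - K by lra.
have ll : ln (2 : R) <= 1.
  by have := @le_ln1Dx R 1; rewrite (_ : 1 + 1 = 2 :> R); [move=> h; apply: h; lra|ring].
have HL := HL0 (l - K) ltac:(lra).
set b := (l - K) - ln (2 * (l - K)) / 2 - ln 2 - 1 / 2.
have bE : (1 - e) * (l - K) <= b.
  rewrite /b lnM ?posrE//; last by lra.
  have : 0 <= ln (l - K) by apply: ln_ge0.
  lra.
have b1 : 1 <= b by apply: le_trans bE; nra.
have nl' : expR (8 * (l - K)) <= n%:R.
  by apply: le_trans nl; rewrite ler_expR; lra.
have := small_ball_upper_core l1 b1 nl'.
rewrite opprB => /le_trans; apply; rewrite ler_expR -/c -/b.
have Ke : K <= e * l.
  have : (K + K) / e <= l by lra.
  by rewrite ler_pdivrMr//; lra.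
have b2 : (1 - 2 * e) * l <= b.
  apply: le_trans bE; nra.
have l0 : 0 <= l by lra.
have b3 : ((1 - 2 * e) * l) ^+ 3 <= b ^+ 3.
  by rewrite lerXn2r ?nnegrE//; [apply: mulr_ge0; lra|lra].
have e3 : 1 - 6 * e <= (1 - 2 * e) ^+ 3.
  rewrite -subr_ge0 [leRHS](_ : _ = 4 * e ^+ 2 * (3 - 2 * e)); last by ring.
  by rewrite !mulr_ge0 ?sqr_ge0//; lra.
rewrite exprMn in b3.
have l3 : l <= l ^+ 3.
  rewrite -[leLHS]expr1; apply: ler_weXn2l => //; lra.
have l30 : 0 <= l ^+ 3 by rewrite exprn_ge0.
have h34 : 34 <= d / 2 * l ^+ 3.
  have : 68 / d <= l ^+ 3 by apply: le_trans l3; lra.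
  by rewrite ler_pdivrMr//; lra.
have h5 : (1 - 6 * e) * l ^+ 3 <= b ^+ 3 by apply: le_trans b3; rewrite ler_wpM2r.
have h6 : c * ((1 - 6 * e) * l ^+ 3) <= c * b ^+ 3 by rewrite ler_pM2l.
have h7 : c * e * l ^+ 3 <= d / 12 * l ^+ 3.
  by rewrite ler_wpM2r// (le_trans _ ed)// ler_piMl// ltW.
move: h34 h6 h7; clear; clearbody b c e.
by move: (l ^+ 3) (b ^+ 3) => l3 b3; lra.
Qed.

End SmallBallAsymptotic.

(** * A maximal inequality for random polynomials *)

Section MaximalInequality.
Variable R : realType.

Definition unimodular (c : nat -> R) := forall i, c i = 1 \/ c i = -1.

(** Doob's inequality for the exponential martingale, stopped when the walk reaches [t]: after the
    crossing the bound already exceeds [1], before it the first sign is averaged. *)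
Lemma maximal_step (c : nat -> R) (t u r : R) m : unimodular c -> 0 <= r ->
  sign_prob m (fun s => exists2 k, (k <= m)%N & t <= u + \sum_(i < k) c i * s i) <=
  expR (r * (u - t)) * ((expR r + expR (- r)) / 2) ^+ m.
Proof.
move=> uc r0; elim: m c uc u => [|m IH] c uc u.
  rewrite expr0 mulr1 /sign_prob /=; case: asboolP => [[k _]|_]; last exact: expR_ge0.
  rewrite big1 ?addr0; last by move=> i _; rewrite mulr0.
  by move=> h; rewrite -[leLHS]expR0 ler_expR mulr_ge0// subr_ge0.
set C := (expR r + expR (- r)) / 2.
have C1 : 1 <= C.
  have := expR_ge1Dx r; have := expR_ge1Dx (- r); rewrite /C; lra.
have [tu|ut] := leP t u.
  apply: le_trans (sign_prob_le1 _ _) _.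
  rewrite -[leLHS]mulr1 ler_pM// ?exprn_ege1//.
  by rewrite -[leLHS]expR0 ler_expR mulr_ge0// subr_ge0.
have half a : a = 1 \/ a = -1 ->
   sign_avg m (fun s => (`[< exists2 k, (k <= m.+1)%N & t <= u + \sum_(i < k) c i * scons a s i >])%:R)
   <= expR (r * (u + c 0%N * a - t)) * C ^+ m.
  move=> _; apply: le_trans (IH (fun i => c i.+1) (fun i => uc i.+1) (u + c 0%N * a)).
  apply: le_sign_prob => s _ [[|k] km].
    by rewrite big_ord0 addr0 leNgt ut.
  by rewrite big_ord_recl /= addrA => h; exists k.
rewrite /sign_prob [sign_avg _ _]/=.
have := half 1 (or_introl erefl); have := half (-1) (or_intror erefl).
set A := sign_avg m _; set B := sign_avg m _ => hA hB.
apply: le_trans (_ : (expR (r * (u + c 0%N * 1 - t)) * C ^+ m +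
   expR (r * (u + c 0%N * -1 - t)) * C ^+ m) / 2 <= _).
  by rewrite ler_pM2r ?invr_gt0//; lra.
rewrite exprS -mulrDl le_eqVlt; apply/orP; left; apply/eqP.
have -> : expR (r * (u + c 0%N * 1 - t)) + expR (r * (u + c 0%N * -1 - t)) =
    expR (r * (u - t)) * (expR r + expR (- r)).
  rewrite [RHS]mulrDr -!expRD; case: (uc 0%N) => ->.
    by congr (expR _ + expR _); ring.
  by rewrite [RHS]addrC; congr (expR _ + expR _); ring.
by rewrite /C; field.
Qed.

Lemma maximal_one_sided (c : nat -> R) (t : R) m : unimodular c -> 0 <= t -> (0 < m)%N ->
  sign_prob m (fun s => exists2 k, (k <= m)%N & t <= \sum_(i < k) c i * s i) <=
  expR (- (t ^+ 2 / (2 * m%:R))).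
Proof.
move=> uc t0 m0; have mR : 0 < m%:R :> R by rewrite ltr0n.
have r0 : 0 <= t / m%:R by rewrite divr_ge0.
apply: le_trans (le_trans _ (maximal_step t 0 m uc r0)) _.
  by apply: le_sign_prob => s _ [k km h]; exists k; rewrite ?add0r.
have ch : (expR (t / m%:R) + expR (- (t / m%:R))) / 2 <= expR ((t / m%:R) ^+ 2 / 2).
  have h : 0 <= (0 : R) <= 1 / 8 by apply/andP; split; lra.
  by have := cosh_le_expR (t / m%:R) h; rewrite subr0 mul1r expr0n /= mulr0 addr0.
apply: le_trans (_ : expR (t / m%:R * (0 - t)) * expR ((t / m%:R) ^+ 2 / 2) ^+ m <= _).
  by rewrite ler_pM2l ?expR_gt0// lerXn2r ?nnegrE ?expR_ge0.
rewrite -expRM_natl -expRD ler_expR le_eqVlt; apply/orP; left; apply/eqP; field.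
by rewrite gt_eqF.
Qed.

Lemma maximal_two_sided (c : nat -> R) (t : R) m : unimodular c -> 0 <= t -> (0 < m)%N ->
  sign_prob m (fun s => exists2 k, (k <= m)%N & t <= `|\sum_(i < k) c i * s i|) <=
  2 * expR (- (t ^+ 2 / (2 * m%:R))).
Proof.
move=> uc t0 m0.
have uc' : unimodular (fun i => - c i) by move=> i; case: (uc i) => ->; rewrite ?opprK; tauto.
rewrite mulr2n mulrDl mul1r.
apply: le_trans (lerD (maximal_one_sided uc t0 m0) (maximal_one_sided uc' t0 m0)).
apply: le_trans (sign_prob_or _ _ _); apply: le_sign_prob => s _ [k km].
rewrite ler_normr => /orP[h|h]; [left|right]; exists k => //.
by move: h; rewrite -sumrN; under eq_bigr do rewrite -mulNr.
Qed.

(** Abel summation: the polynomial is a convex combination of the partial sums, with weights [x^m]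
    and [(1 - x) x^i]. *)
Lemma abel_bound (s : nat -> R) (t x : R) m : 0 <= x <= 1 ->
  (forall k, (k <= m)%N -> `|\sum_(i < k) s i| <= t) ->
  `|\sum_(i < m) s i * x ^+ i| <= t.
Proof.
move=> /andP[x0 x1] h.
have E n : \sum_(i < n) s i * x ^+ i =
   x ^+ n * (\sum_(i < n) s i) + (1 - x) * \sum_(i < n) x ^+ i * (\sum_(j < i.+1) s j).
  elim: n => [|n IH]; first by rewrite !big_ord0 !mulr0 addr0.
  by rewrite !big_ord_recr /= IH exprS; ring.
have G n : x ^+ n + (1 - x) * \sum_(i < n) x ^+ i = 1.
  elim: n => [|n IH]; first by rewrite big_ord0 mulr0 addr0.
  by rewrite big_ord_recr /= -[RHS]IH exprS; ring.
have t0 : 0 <= t by have := h 0%N (leq0n _); rewrite big_ord0 normr0.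
rewrite E; apply: le_trans (ler_normD _ _) _.
rewrite -[leRHS]mulr1 -[X in _ <= _ * X](G m) mulrDr lerD//.
  by rewrite normrM ger0_norm ?exprn_ge0// mulrC ler_wpM2r ?exprn_ge0// h.
rewrite normrM ger0_norm ?subr_ge0// mulrCA ler_wpM2l ?subr_ge0//.
apply: le_trans (ler_norm_sum _ _ _) _; rewrite mulr_sumr ler_sum// => i _.
by rewrite normrM ger0_norm ?exprn_ge0// mulrC ler_wpM2r ?exprn_ge0// h.
Qed.

(** For [x >= 0] Abel summation reduces to the partial sums of the signs, for [x < 0] to those of
    the signs alternately reversed. This is why the maximal inequality carries coefficients [c]. *)
Lemma poly_sup_tail (t : R) m : 0 <= t -> (0 < m)%N ->
  sign_prob m (fun s => exists2 k, (k <= m)%N &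
    exists2 x : R, `|x| <= 1 & t < `|\sum_(i < k) s i * x ^+ i|) <=
  4 * expR (- (t ^+ 2 / (2 * m%:R))).
Proof.
move=> t0 m0.
have u1 : unimodular (fun=> 1) by move=> _; left.
have u2 : unimodular (fun i => (-1) ^+ i).
  by move=> i; rewrite -signr_odd; case: odd; [right|left].
rewrite (_ : 4 * _ = 2 * expR (- (t ^+ 2 / (2 * m%:R))) + 2 * expR (- (t ^+ 2 / (2 * m%:R)))); last by ring.
apply: le_trans (lerD (maximal_two_sided u1 t0 m0) (maximal_two_sided u2 t0 m0)).
apply: le_trans (sign_prob_or _ _ _); apply: le_sign_prob => s _ [k km [x x1 h]].
apply: contrapT => /not_orP[n1 n2]; move: h; apply/negP; rewrite -leNgt.
have b (c : nat -> R) : ~ (exists2 j, (j <= m)%N & t <= `|\sum_(i < j) c i * s i|) ->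
    forall j, (j <= k)%N -> `|\sum_(i < j) c i * s i| <= t.
  move=> nn j jk; rewrite leNgt; apply/negP => h; apply: nn; exists j; last exact: ltW.
  exact: leq_trans km.
have [x0|x0] := leP 0 x.
  apply: abel_bound => [|j jk]; first by rewrite x0 (le_trans (ler_norm _) x1).
  by have := b (fun=> 1) n1 j jk; under eq_bigr do rewrite mul1r.
have -> : \sum_(i < k) s i * x ^+ i = \sum_(i < k) ((-1) ^+ i * s i) * (- x) ^+ i.
  apply: eq_bigr => i _; rewrite [(- x) ^+ i]exprNn.
  have e : (-1) ^+ i * (-1) ^+ i = 1 :> R by rewrite -expr2 sqrr_sign.
  by rewrite mulrACA e mul1r.
apply: (@abel_bound (fun i => (-1) ^+ i * s i) t (- x) k) => [|j jk].
  by rewrite oppr_ge0 ltW//= (le_trans (ler_norm _))// normrN.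
exact: (b (fun i => (-1) ^+ i) n2 j jk).
Qed.

End MaximalInequality.

(** * Logarithmic energy *)

Section Energy.
Variable R : realType.
Implicit Types (s : seq R) (x y z : R).

(** This is [tanh (x / 2) <= x / 2], taken from the first term of the series of [ln_ratio]. *)
Lemma one_minus_expR_le x : 0 <= x ->
  1 - expR (- x) <= (1 + expR (- x)) * (x / 2).
Proof.
move=> x0; set r := expR (- x); have r0 : 0 < r := expR_gt0 _.
have r1 : r <= 1 by rewrite expR_le1 oppr_le0.
pose q := (1 - r) / (1 + r).
have q01 : 0 <= q < 1.
  by rewrite divr_ge0 ?subr_ge0 ?addr_ge0// ?ltW//= ltr_pdivrMr; lra.
have /andP[+ _] := ln_ratio_bounds 1 q01.
rewrite /odd_series big_ord1 double0 expr1 divr1 /ln_ratio.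
have -> : (1 + q) / (1 - q) = r^-1.
  by rewrite /q; field; repeat (apply/andP; split); rewrite gt_eqF//; lra.
rewrite lnV ?posrE// /r expRK opprK -/r => h.
by rewrite [leRHS]mulrC -ler_pdivrMr -/q; lra.
Qed.

Lemma cauchy_schwarz2 (a b A B W w : R) : 0 <= A -> 0 <= B -> 0 <= W -> 0 <= w ->
  a ^+ 2 <= A * W -> b ^+ 2 <= B * w -> (a + b) ^+ 2 <= (A + B) * (W + w).
Proof.
move=> A0 B0 W0 w0 ha hb.
suff h : 2 * (a * b) <= A * w + B * W.
  rewrite [X in X <= _](_ : _ = a ^+ 2 + b ^+ 2 + 2 * (a * b)); last by ring.
  rewrite [leRHS](_ : _ = A * W + B * w + (A * w + B * W)); last by ring.
  by rewrite !lerD.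
have S0 : 0 <= A * w + B * W by rewrite addr_ge0// mulr_ge0.
apply: le_trans (ler_norm _) _; rewrite -(ger0_norm S0) -ler_sqr ?nnegrE//.
rewrite !real_normK ?num_real//.
have h1 : a ^+ 2 * b ^+ 2 <= (A * W) * (B * w) by rewrite ler_pM ?sqr_ge0.
have := sqr_ge0 (A * w - B * W).
lra.
Qed.

Definition exp_energy (al : R) s := \sum_(x <- s) \sum_(y <- s) expR (- (al * `|x - y|)).

Lemma exp_energy_cons al x s : exp_energy al (x :: s) =
  exp_energy al s + 1 + 2 * \sum_(y <- s) expR (- (al * `|x - y|)).
Proof.
rewrite /exp_energy big_cons big_cons subrr normr0 mulr0 oppr0 expR0.
under [X in _ + X]eq_bigr do rewrite big_cons.
rewrite big_split /=.
have -> : \sum_(i <- s) expR (- (al * `|i - x|)) = \sum_(y <- s) expR (- (al * `|x - y|)).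
  by apply: eq_bigr => i _; rewrite distrC.
by ring.
Qed.

(* With [T] the potential at the first point, [N - T] and [Q - T ^ 2] grow by
   [(1 - r) T] and [(1 - r ^ 2) T ^ 2] at each new point; Cauchy-Schwarz then
   costs [(1 - r) / (1 + r) <= al * gap / 2]. *)
Lemma exp_energy_sorted (al : R) x s : 0 <= al -> sorted <=%R (x :: s) ->
  let T := 1 + \sum_(y <- s) expR (- (al * `|x - y|)) in
  0 <= exp_energy al (x :: s) - T ^+ 2 /\
  ((size s).+1%:R - T) ^+ 2 <=
    (exp_energy al (x :: s) - T ^+ 2) * (al * (last x s - x) / 2).
Proof.
move=> al0; elim: s x => [|y s IH] x.
  by rewrite /= /exp_energy !big_seq1 big_nil subrr normr0 mulr0 oppr0 expR0 addr0 expr1n subrr expr0n !mul0r.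
rewrite [sorted _ _]/= => /andP[xy sy].
have [] := IH y sy; set Ty := 1 + _; set Qy := exp_energy al (y :: s) => Q0 NQ.
set r := expR (- (al * (y - x))).
have d0 : 0 <= al * (y - x) by rewrite mulr_ge0// subr_ge0.
have r0 : 0 < r := expR_gt0 _.
have r1 : r <= 1 by rewrite expR_le1 oppr_le0.
have yz z : z \in y :: s -> y <= z.
  have := sy; rewrite /= (path_sortedE le_trans) => /andP[/allP h _].
  by rewrite inE => /orP[/eqP ->//|/h].
have ST : \sum_(z <- y :: s) expR (- (al * `|x - z|)) = r * Ty.
  have -> : Ty = \sum_(z <- y :: s) expR (- (al * `|y - z|)).
    by rewrite /Ty big_cons subrr normr0 mulr0 oppr0 expR0.
  rewrite mulr_sumr.
  rewrite big_seq [RHS]big_seq; apply: eq_bigr => z /yz yz'.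
  rewrite /r -expRD; congr expR.
  rewrite (distrC x) (distrC y) !ger0_norm ?subr_ge0//; last exact: le_trans yz'.
  by ring.
cbv zeta; rewrite exp_energy_cons ST -/Qy.
have Ty0 : 0 <= Ty by rewrite /Ty addr_ge0// sumr_ge0// => i _; exact: expR_ge0.
have rd : 1 - r <= (1 + r) * (al * (y - x) / 2) by exact: one_minus_expR_le.
have lst : last x (y :: s) = last y s by [].
rewrite lst; set W := al * (last y s - y) / 2 in NQ; set w := al * (y - x) / 2 in rd.
have -> : al * (last y s - x) / 2 = W + w by rewrite /W /w; ring.
have -> : (size (y :: s)).+1%:R - (1 + r * Ty) = ((size s).+1%:R - Ty) + (1 - r) * Ty.
  by rewrite [size _]/= -[(size s).+2%:R]natr1; ring.
have -> : Qy + 1 + 2 * (r * Ty) - (1 + r * Ty) ^+ 2 =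
   (Qy - Ty ^+ 2) + (1 - r ^+ 2) * Ty ^+ 2 by ring.
have B0 : 0 <= (1 - r ^+ 2) * Ty ^+ 2.
  by rewrite mulr_ge0 ?sqr_ge0// subr_ge0 expr_le1// ltW.
have W0 : 0 <= W.
  rewrite /W divr_ge0// mulr_ge0// subr_ge0; apply: yz.
  exact: mem_last.
have w0 : 0 <= w by rewrite divr_ge0.
split; first by rewrite addr_ge0.
apply: cauchy_schwarz2 => //.
rewrite exprMn [leRHS]mulrAC ler_wpM2r ?sqr_ge0//.
have r1' : 0 <= 1 - r by rewrite subr_ge0.
rewrite [leRHS](_ : _ = (1 - r) * ((1 + r) * w)); last by ring.
by rewrite expr2 ler_wpM2l.
Qed.

(** Sharp in the continuum: [1 + al * ta / 2] is the mass of the measure on the interval with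
    constant potential [1], namely [1 / 2] at each end and density [al / 2] in between. *)
Lemma exp_energy_ge (al lo ta : R) s : 0 <= al -> 0 <= ta ->
  (forall x, x \in s -> lo <= x <= lo + ta) ->
  (size s)%:R ^+ 2 <= exp_energy al s * (1 + al * ta / 2).
Proof.
move=> al0 ta0 hs.
have pe : perm_eq (sort <=%R s) s by rewrite perm_sort.
have -> : exp_energy al s = exp_energy al (sort <=%R s).
  rewrite /exp_energy [RHS](perm_big _ pe) /=.
  by apply: eq_bigr => x _; rewrite [RHS](perm_big _ pe).
rewrite -(size_sort <=%R).
have : forall x, x \in sort <=%R s -> lo <= x <= lo + ta.
  by move=> x; rewrite mem_sort; exact: hs.
have := sort_sorted (@le_total _ R) s.
case: (sort _ _) => [|x l] so mem.
  by rewrite /exp_energy big_nil mul0r expr0n.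
have [] := exp_energy_sorted al0 so; set T := 1 + _ => Q0 NQ.
rewrite (_ : (size (x :: l))%:R = ((size l).+1%:R - T) + T); last by rewrite /= subrK.
rewrite (_ : exp_energy al (x :: l) = (exp_energy al (x :: l) - T ^+ 2) + T ^+ 2); last by rewrite subrK.
rewrite [1 + _]addrC.
have /andP[x1 x2] := mem x (mem_head _ _).
have /andP[l1 l2] := mem _ (mem_last x l).
apply: cauchy_schwarz2; rewrite ?sqr_ge0 ?mulr1//.
  by rewrite divr_ge0// mulr_ge0.
apply: le_trans NQ _; rewrite ler_wpM2l// ler_pM2r ?invr_gt0// ler_wpM2l//.
by lra.
Qed.

Definition odd_energy n0 s : R :=
  \sum_(x <- s) \sum_(y <- s) odd_series n0 (expR (- (2 * `|x - y|))).

(** Each exponential of the kernel obeys [exp_energy_ge], and [1 + c ta <= c (1 + ta)] for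
    [c = 2 k + 1] turns the sum of the bounds into a multiple of [odd_sq_sum]. *)
Lemma odd_energy_ge n0 (lo ta : R) s : 0 <= ta ->
  (forall x, x \in s -> lo <= x <= lo + ta) ->
  2 * odd_sq_sum R n0 / (1 + ta) * (size s)%:R ^+ 2 <= odd_energy n0 s.
Proof.
move=> ta0 hs.
have -> : odd_energy n0 s = \sum_(k < n0) 2 / k.*2.+1%:R * exp_energy (2 * k.*2.+1%:R) s.
  rewrite /odd_energy /odd_series; under eq_bigr do rewrite exchange_big.
  rewrite exchange_big; apply: eq_bigr => k _ /=; rewrite mulr_sumr.
  apply: eq_bigr => x _; rewrite mulr_sumr; apply: eq_bigr => y _.
  by rewrite mulrAC -expRM_natl; congr (_ * expR _); ring.
rewrite -!mulrA /odd_sq_sum mulrCA mulr_suml; apply: ler_sum => k _.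
have k0 : 0 < k.*2.+1%:R :> R by [].
have k1 : 1 <= k.*2.+1%:R :> R by rewrite ler1n.
have al0 : 0 <= 2 * k.*2.+1%:R :> R by rewrite mulr_ge0.
have := exp_energy_ge al0 ta0 hs.
move: (k.*2.+1%:R : R) (exp_energy _ _) ((size s)%:R ^+ 2) (sqr_ge0 ((size s)%:R : R)) k0 k1 => c Q N N0 c0 c1 h.
have h' : N / (1 + c * ta) <= Q.
  rewrite ler_pdivrMr; last by rewrite ltr_wpDr// mulr_ge0// ltW.
  by apply: le_trans h _; rewrite le_eqVlt; apply/orP; left; apply/eqP; field.
have X0 : 0 < 1 + c * ta by rewrite ltr_wpDr// mulr_ge0// ltW.
have Y0 : 0 < 1 + ta by rewrite ltr_wpDr.
rewrite -?mulrA [leLHS](_ : _ = 2 * (c^-1 * (N / (c * (1 + ta))))); last first.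
  by field; rewrite !gt_eqF.
rewrite ler_pM2l// ler_pM2l ?invr_gt0//; apply: le_trans h'.
rewrite ler_wpM2l// lef_pV2 ?posrE ?mulr_gt0//.
by rewrite mulrDr mulr1 lerD2r.
Qed.

Lemma odd_series_ge0 n0 (q : R) : 0 <= q -> 0 <= odd_series n0 q.
Proof. by move=> q0; rewrite sumr_ge0// => i _; rewrite divr_ge0// mulr_ge0// exprn_ge0. Qed.

Definition pos_part x := Num.max x 0.

Lemma sum_pos_part_sqr (be ta : R) n : 0 <= be -> 0 < ta ->
  \sum_(i < n) pos_part (be - i%:R * ta) ^+ 2 <= be ^+ 2 + be ^+ 3 / (3 * ta).
Proof.
move=> be0 ta0; case: n => [|n].
  by rewrite big_ord0 addr_ge0 ?exprn_ge0// divr_ge0 ?exprn_ge0// mulr_ge0// ltW.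
apply: le_trans (_ : be ^+ 2 + (be ^+ 3 - pos_part (be - n%:R * ta) ^+ 3) / (3 * ta) <= _); last first.
  rewrite lerD2l ler_pM2r ?invr_gt0 ?mulr_gt0// gerBl exprn_ge0//.
  by rewrite le_max lexx orbT.
elim: n => [|n IH].
  by rewrite big_ord1 mul0r subr0 /pos_part max_l// subrr mul0r addr0.
rewrite big_ord_recr /= -natr1.
set x := be - n%:R * ta in IH *.
have -> : be - (n%:R + 1) * ta = x - ta by rewrite /x; ring.
apply: le_trans (lerD IH (lexx _)) _.
rewrite -addrA lerD2l -lerBrDl -mulrBl.
rewrite ler_pdivlMr ?mulr_gt0//.
rewrite (_ : be ^+ 3 - _ - _ = pos_part x ^+ 3 - pos_part (x - ta) ^+ 3); last by ring.
rewrite /pos_part; have [xt|xt] := leP (x - ta) 0.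
  by rewrite !expr0n /= mul0r subr0 exprn_ge0// le_max lexx orbT.
have x0 : 0 <= x by lra.
rewrite max_l// -subr_ge0.
set u := x - ta in xt *; have -> : x = u + ta by rewrite /u subrK.
rewrite [leRHS](_ : _ = ta ^+ 2 * (3 * u + ta)); last by ring.
by rewrite mulr_ge0 ?sqr_ge0//; lra.
Qed.

(** The half-line is cut into cells of length [ta]; interactions between different cells are
    nonnegative and are dropped. In a cell of [N] points the bound is the quadratic
    [N X - c N^2 / (1 + ta)], at most [(1 + ta) X^2 / (4 c)], and the sum over cells is a Riemann
    sum of [(be - x)^2]. *)
Lemma energy_list_le n0 (be ta : R) s : (0 < n0)%N -> 0 <= be -> 0 < ta ->
  (forall x, x \in s -> 0 <= x) ->
  \sum_(x <- s) (be - x) - odd_energy n0 s / 2 <=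
  (1 + ta) / (4 * odd_sq_sum R n0) * (be ^+ 2 + be ^+ 3 / (3 * ta)).
Proof.
move=> n00 be0 ta0 s0.
pose c := odd_sq_sum R n0.
have c0 : 0 < c.
  apply: lt_le_trans (odd_sq_sum_nd R n00); rewrite /odd_sq_sum big_ord1.
  by rewrite invr_gt0 exprn_gt0.
pose k x := Num.truncn (x / ta).
have kP x : 0 <= x -> (k x)%:R * ta <= x < (k x)%:R * ta + ta.
  move=> x0; have /andP[h1 h2] := truncn_itv (divr_ge0 x0 (ltW ta0)).
  rewrite -ler_pdivlMr// h1 /=; move: h2; rewrite -/(k x) -natr1 ltr_pdivrMr//.
  by rewrite mulrDl mul1r.
pose I := (k be).+1.
pose sec i := [seq x <- s | k x == i].
have sel (x f : R) : (\sum_(i < I) if k x == i then f else 0) = if (k x < I)%N then f else 0.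
  case: ltnP => h.
    rewrite (bigD1 (Ordinal h)) //= eqxx big1 ?addr0// => i ni.
    by case: eqP => // e; move: ni; rewrite -val_eqE /= e eqxx.
  rewrite big1// => i _; case: eqP => // e.
  by have := ltn_ord i; rewrite -e ltnNge h.
have h1 : \sum_(x <- s) (be - x) <= \sum_(i < I) \sum_(x <- sec i) (be - i%:R * ta).
  have -> : \sum_(i < I) \sum_(x <- sec i) (be - i%:R * ta) =
      \sum_(x <- s) \sum_(i < I) (if k x == i then be - (k x)%:R * ta else 0).
    rewrite exchange_big; apply: eq_bigr => i _ /=.
    rewrite /sec big_filter big_mkcond; apply: eq_bigr => x _ /=.
    by case: eqP => // ->.
  rewrite big_seq [leRHS]big_seq; apply: ler_sum => x /s0 x0.
  rewrite sel; have /andP[k1 k2] := kP x x0; case: ltnP => h; first by lra.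
  have /andP[_ b2] := kP be be0.
  have : (k be)%:R * ta + ta <= (k x)%:R * ta.
    by move: h; rewrite -(ler_nat R) /I -natr1 => h; rewrite -[X in _ + X]mul1r -mulrDl ler_pM2r.
  lra.
have h2 : \sum_(i < I) odd_energy n0 (sec i) <= odd_energy n0 s.
  pose G x y : R := odd_series n0 (expR (- (2 * `|x - y|))).
  have -> : \sum_(i < I) odd_energy n0 (sec i) =
     \sum_(x <- s) \sum_(y <- s) \sum_(i < I) (if k x == i then if k y == i then G x y else 0 else 0).
    under [RHS]eq_bigr do rewrite exchange_big.
    rewrite [RHS]exchange_big; apply: eq_bigr => i _ /=.
    rewrite /odd_energy /sec big_filter big_mkcond; apply: eq_bigr => x _ /=.
    case: eqP => _; last by rewrite big1.
    by rewrite big_filter big_mkcond.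
  apply: ler_sum => x _; apply: ler_sum => y _.
  have G0 : 0 <= G x y by rewrite odd_series_ge0// expR_ge0.
  apply: le_trans (_ : \sum_(i < I) (if k x == i then G x y else 0) <= _).
    by apply: ler_sum => i _; case: ifP => // _; case: ifP.
  by rewrite sel; case: ifP.
apply: le_trans (_ : \sum_(i < I) (1 + ta) / (4 * c) * pos_part (be - i%:R * ta) ^+ 2 <= _); last first.
  rewrite -mulr_sumr ler_wpM2l ?sum_pos_part_sqr//.
  by rewrite divr_ge0 ?mulr_ge0 ?addr_ge0 ?(ltW ta0) ?(ltW c0).
apply: le_trans (lerB h1 (ler_wpM2r _ h2)) _; first by rewrite invr_ge0.
rewrite mulr_suml -sumrB; apply: ler_sum => i _.
have -> : \sum_(x <- sec i) (be - i%:R * ta) = (size (sec i))%:R * (be - i%:R * ta).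
  by rewrite big_const_seq count_predT iter_addr_0 [RHS]mulr_natl.
have mem x : x \in sec i -> i%:R * ta <= x <= i%:R * ta + ta.
  rewrite mem_filter => /andP[/eqP <- /s0 /kP /andP[-> /ltW ->]].
  by [].
have := odd_energy_ge n0 (ltW ta0) mem; rewrite -/c.
set N : R := (size _)%:R; set E := odd_energy _ _; set X := be - _ => hE.
have N0 : 0 <= N by exact: ler0n.
have t1 : 0 < 1 + ta by rewrite addr_gt0.
have hE' : c / (1 + ta) * N ^+ 2 <= E / 2.
  by move: hE; clear; set u := (1 + ta)^-1; lra.
apply: le_trans (lerB (lexx _) hE') _.
apply: le_trans (_ : N * pos_part X - c / (1 + ta) * N ^+ 2 <= _).
  by rewrite lerD2r ler_wpM2l// le_max lexx.
set P := pos_part X; rewrite -subr_ge0.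
rewrite [leRHS](_ : _ = (4 * c * (1 + ta))^-1 * ((1 + ta) * P - 2 * c * N) ^+ 2); last first.
  by field; rewrite !gt_eqF.
by rewrite mulr_ge0 ?sqr_ge0// invr_ge0 !mulr_ge0 ?(ltW c0) ?(ltW t1).
Qed.

End Energy.

(** * Nodes in the hyperbolic coordinate and their heights *)

Section PointEnergy.
Variable R : realType.

Definition artanh (y : R) := ln ((1 + y) / (1 - y)) / 2.

Lemma artanh_expR (y : R) : `|y| < 1 -> expR (2 * artanh y) = (1 + y) / (1 - y).
Proof.
rewrite ltr_norml => /andP[h1 h2].
by rewrite /artanh mulrCA divff// mulr1 lnK// posrE divr_gt0//; lra.
Qed.

Lemma artanhN (y : R) : `|y| < 1 -> artanh (- y) = - artanh y.
Proof.
rewrite ltr_norml => /andP[h1 h2]; rewrite /artanh opprK -mulNr -lnV ?posrE ?divr_gt0//; try lra.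
by rewrite invf_div.
Qed.

Lemma artanh_le (y r : R) : -1 < y -> y <= r -> r < 1 -> artanh y <= artanh r.
Proof.
move=> y1 yr r1; rewrite ler_pM2r ?invr_gt0// ler_ln ?posrE ?divr_gt0//; try lra.
by rewrite ler_pM ?invr_ge0 ?lef_pV2 ?posrE//; lra.
Qed.

Lemma artanh_ge0 (y : R) : 0 <= y < 1 -> 0 <= artanh y.
Proof.
move=> /andP[y0 y1]; rewrite divr_ge0// ln_ge0// ler_pdivlMr; lra.
Qed.

Lemma artanh_norm_le (y r : R) : `|y| <= r -> r < 1 -> `|artanh y| <= artanh r.
Proof.
move=> yr r1; have y1 := le_lt_trans yr r1; rewrite ler_norml.
move: (yr) (y1); rewrite ler_norml ltr_norml => /andP[h1 h2] /andP[h3 h4].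
rewrite artanh_le// andbT lerNl -artanhN// artanh_le//; lra.
Qed.

(** Equality would hold with [ln coth] of the distance in the exponent; truncating the series only
    enlarges the right side. *)
Lemma blaschke_norm_le n0 (a w : R) : `|a| < 1 -> `|w| < 1 ->
  `|blaschke a w| <= expR (- odd_series n0 (expR (- (2 * `|artanh a - artanh w|)))).
Proof.
wlog aw : a w / a <= w => [hw a1 w1|].
  have [h|/ltW h] := leP a w; first exact: hw.
  have -> : blaschke a w = - blaschke w a.
    by rewrite /blaschke [w * a]mulrC -[a - w]opprB mulNr opprK.
  by rewrite normrN distrC; exact: hw.
move=> a1 w1; move: (a1) (w1); rewrite !ltr_norml => /andP[a2 a3] /andP[w2 w3].
have aaw : artanh a <= artanh w by exact: artanh_le.
set q := expR (- (2 * _)); have qE : q = (1 + a) / (1 - a) / ((1 + w) / (1 - w)).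
  rewrite -(artanh_expR a1) -(artanh_expR w1) -expRB /q; congr expR.
  by rewrite ler0_norm ?subr_le0//; ring.
have [ew|nw] := eqVneq a w.
  by rewrite ew /blaschke subrr mul0r normr0 expR_ge0.
have aw' : a < w by rewrite lt_neqAle nw.
have q0 : 0 < q by exact: expR_gt0.
have q1 : q < 1.
  have a4 : 0 < 1 - a by rewrite subr_gt0.
  have w4 : 0 < 1 - w by rewrite subr_gt0.
  have w5 : 0 < 1 + w by clear - w2; lra.
  rewrite qE ltr_pdivrMr ?divr_gt0// mul1r.
  apply: lt_le_trans (_ : (1 + w) / (1 - a) <= _).
    by rewrite ltr_pM2r ?invr_gt0// ltrD2l.
  by rewrite ler_pM2l// lef_pV2 ?posrE// lerD2l lerN2.
have q01 : 0 <= q < 1 by rewrite ltW.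
have d0 : 0 < 1 - a * w by exact: mul_lt1.
have -> : `|blaschke a w| = (1 - q) / (1 + q).
  rewrite ger0_norm; last by rewrite /blaschke divr_ge0 ?subr_ge0 ?(ltW aw') ?ltW//; lra.
  rewrite qE /blaschke; clear q qE q0 q1 q01 aaw.
  by field; repeat (apply/andP; split); rewrite gt_eqF//; lra.
rewrite ln_ratio_expR// ler_expR lerN2.
by have /andP[] := ln_ratio_bounds n0 q01.
Qed.

(** In the coordinate [v = artanh y] the left side is [cosh^2 v]. *)
Lemma inv_sqr_le (y : R) : `|y| < 1 -> (1 - y ^+ 2)^-1 <= expR (2 * `|artanh y|).
Proof.
move=> y1.
have E : `|artanh y| = artanh `|y|.
  have [y0|y0] := leP 0 y.
    have h : 0 <= y < 1 by rewrite y0; move: y1; rewrite ger0_norm.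
    by rewrite (ger0_norm y0) ger0_norm// artanh_ge0.
  have h : 0 <= - y < 1 by rewrite -(ltr0_norm y0) normr_ge0.
  have := artanh_ge0 h; rewrite artanhN// oppr_ge0 => h'.
  by rewrite (ltr0_norm y0) artanhN// ler0_norm.
rewrite E artanh_expR ?normr_id// -[y ^+ 2]real_normK ?num_real//.
have := normr_ge0 y; move: `|y| y1 => z z1 z0.
rewrite -[leLHS]mul1r ler_pdivrMr; last by nra.
rewrite (_ : (1 + z) / (1 - z) * (1 - z ^+ 2) = (1 + z) ^+ 2); first by nra.
by field; rewrite gt_eqF//; lra.
Qed.

Lemma sum_symmetric (G : nat -> nat -> R) g D :
  (forall i j, G i j = G j i) -> (forall i, G i i = g) ->
  \sum_(i < D) \sum_(j < D) G i j = 2 * (\sum_(j < D) \sum_(i < j) G i j) + D%:R * g.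
Proof.
move=> sG dG; elim: D => [|D IH]; first by rewrite !big_ord0; ring.
rewrite !big_ord_recr /=.
under eq_bigr do rewrite big_ord_recr /=.
rewrite big_split /= IH dG -natr1.
under [X in _ + (X + _)]eq_bigr do rewrite sG.
by ring.
Qed.

Definition node_height (y : nat -> R) j : R := Num.sqrt (residual y j (y j)).

(** Adding the diagonal terms completes the pair interactions to an energy and costs half of
    [odd_series n0 1] per node, hence [be]; the outer factor [2] counts the two ends of the
    interval. *)
Definition energy_bound n0 (ta b : R) : R :=
  let be := b + odd_series n0 1 / 2 in
  2 * ((1 + ta) / (4 * odd_sq_sum R n0) * (be ^+ 2 + be ^+ 3 / (3 * ta))).

(** In the logarithm each factor contributes at most [|v j| - V + b] minus the interactions with
    earlier nodes, so every pair is counted once. The nodes are split by the sign of [v j],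
    interactions across are dropped, and [energy_list_le] is applied at either end with [V - |v j|]
    as depth. *)
Lemma node_height_prod_le n0 (ta b r : R) (y : nat -> R) D :
  (0 < n0)%N -> 0 < ta -> 0 <= b -> r < 1 -> (forall i, `|y i| <= r) ->
  \prod_(j < D) (node_height y j * expR (b - artanh r)) <= expR (energy_bound n0 ta b).
Proof.
move=> n00 ta0 b0 r1 yr.
have y1 i : `|y i| < 1 := le_lt_trans (yr i) r1.
pose v i := artanh (y i); pose V := artanh r.
have vV i : `|v i| <= V by exact: artanh_norm_le.
pose G i j := odd_series n0 (expR (- (2 * `|v i - v j|))).
have G0 i j : 0 <= G i j by rewrite odd_series_ge0// expR_ge0.
apply: le_trans (_ : \prod_(j < D) expR (`|v j| - V + b - \sum_(i < j) G i j) <= _).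
  apply: ler_prod => j _; rewrite mulr_ge0 ?sqrtr_ge0 ?expR_ge0//=.
  have -> : `|v j| - V + b - \sum_(i < j) G i j =
     (`|v j| - \sum_(i < j) G i j) + (b - V) by ring.
  rewrite [leRHS]expRD ler_pM2r ?expR_gt0//.
  rewrite /node_height -[leRHS]ger0_norm ?expR_ge0// -sqrtr_sqr ler_wsqrtr//.
  rewrite /residual expRD exprMn [leLHS]mulrC ler_pM ?invr_ge0 ?sqr_ge0 ?(ltW (sqr_lt1 _))//.
    by rewrite -expRM_natl; exact: inv_sqr_le.
  rewrite -[leLHS]real_normK ?num_real// lerXn2r ?nnegrE ?expR_ge0//.
  rewrite /blaschke_prod normr_prod -sumrN expR_sum ler_prod// => i _.
  by rewrite normr_ge0 /=; exact: blaschke_norm_le.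
rewrite -expR_sum ler_expR.
pose g := odd_series n0 (1 : R).
have sumG : \sum_(j < D) \sum_(i < j) G i j = (\sum_(i < D) \sum_(j < D) G i j - D%:R * g) / 2.
  rewrite (@sum_symmetric G g D); first by field.
    by move=> i j; rewrite /G distrC.
  by move=> i; rewrite /G subrr normr0 mulr0 oppr0 expR0.
rewrite sumrB sumG /energy_bound -/g.
set be := b + g / 2.
have be0 : 0 <= be by rewrite addr_ge0// divr_ge0// odd_series_ge0.
pose J := iota 0 D.
have toJ (F : nat -> R) : \sum_(j < D) F j = \sum_(j <- J) F j.
  by rewrite -(big_mkord xpredT F) /index_iota subn0.
pose sp := [seq V - v j | j <- J & 0 <= v j].
pose sn := [seq V + v j | j <- J & ~~ (0 <= v j)].
have sp0 x : x \in sp -> 0 <= x.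
  move=> /mapP[j _ ->]; rewrite subr_ge0; exact: le_trans (ler_norm _) (vV j).
have sn0 x : x \in sn -> 0 <= x.
  move=> /mapP[j _ ->]; have := vV j; rewrite ler_norml => /andP[h _]; lra.
have P := energy_list_le n00 be0 ta0 sp0.
have N := energy_list_le n00 be0 ta0 sn0.
set B := (X in _ <= 2 * X); rewrite -/B in P N.
have E1 : \sum_(i < D) (`|v i| - V + b) + D%:R * g / 2 =
   \sum_(x <- sp) (be - x) + \sum_(x <- sn) (be - x).
  have -> : D%:R * g / 2 = \sum_(i < D) g / 2 by rewrite sumr_const card_ord mulr_natl mulrnAl.
  rewrite -big_split /= (toJ (fun i => `|v i| - V + b + g / 2)).
  rewrite (bigID (fun j => 0 <= v j)) /= /sp /sn !big_map !big_filter; congr (_ + _).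
    by apply: eq_bigr => j h; rewrite ger0_norm// /be; ring.
  by apply: eq_bigr => j; rewrite -ltNge => h; rewrite ltr0_norm// /be; ring.
have E2 : odd_energy n0 sp + odd_energy n0 sn <= \sum_(i < D) \sum_(j < D) G i j.
  rewrite (toJ (fun i => \sum_(j < D) G i j)).
  under [leRHS]eq_bigr do rewrite toJ.
  rewrite [leRHS](bigID (fun j => 0 <= v j)) /= /odd_energy /sp /sn !big_map !big_filter.
  apply: lerD; apply: ler_sum => i _; rewrite big_map big_filter.
    rewrite [leRHS](bigID (fun j => 0 <= v j)) /= ler_wpDr ?sumr_ge0//.
    rewrite le_eqVlt; apply/orP; left; apply/eqP; apply: eq_bigr => j _.
    rewrite /G; congr (odd_series _ (expR (- (2 * _)))).
    by rewrite distrC; congr `|_|; ring.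
  rewrite [leRHS](bigID (fun j => 0 <= v j)) /= ler_wpDl ?sumr_ge0//.
  rewrite le_eqVlt; apply/orP; left; apply/eqP; apply: eq_bigr => j _.
  by rewrite /G; congr (odd_series _ (expR (- (2 * `|_|)))); ring.
move: P N E1 E2; clear.
move: (\sum_(i < D) (`|v i| - V + b)) (\sum_(i < D) \sum_(j < D) G i j) => X Y.
move: (\sum_(x <- sp) _) (\sum_(x <- sn) _) (odd_energy _ sp) (odd_energy _ sn) => a1 a2 a3 a4.
by move: (D%:R * g) B => Dg B; lra.
Qed.

Lemma blaschke_prod_continuous (y : nat -> R) j (w : R) :
  (forall i, `|y i| < 1) -> `|w| < 1 -> {for w, continuous (blaschke_prod y j)}.
Proof.
move=> y1 w1; elim: j => [|j IH].
  have -> : blaschke_prod y 0 = cst 1 by apply/funext => x; rewrite /blaschke_prod big_ord0.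
  exact: cvg_cst.
have -> : blaschke_prod y j.+1 = (fun x => blaschke_prod y j x * blaschke (y j) x).
  by apply/funext => x; rewrite blaschke_prodS.
apply: cvgM; first exact: IH.
apply: cvgM; first by apply: cvgB; [exact: cvg_id|exact: cvg_cst].
apply: cvgV; first by rewrite gt_eqF// mul_lt1.
by apply: cvgB; [exact: cvg_cst|apply: cvgM; [exact: cvg_cst|exact: cvg_id]].
Qed.

Lemma residual_argmax (y : nat -> R) j (r : R) :
  (forall i, `|y i| < 1) -> 0 <= r < 1 ->
  exists c, `|c| <= r /\ forall z, `|z| <= r -> residual y j z <= residual y j c.
Proof.
move=> y1 /andP[r0 r1].
have rr : - r <= r by rewrite ge0_cp.
have cont : {within `[- r, r], continuous (residual y j)}.
  apply: continuous_in_subspaceT => w /set_mem /=; rewrite in_itv /= => wr.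
  have w1 : `|w| < 1 by rewrite (le_lt_trans _ r1)// ler_norml.
  have c := @blaschke_prod_continuous y j w y1 w1.
  apply: cvgM; first by apply: cvgM.
  apply: cvgV; first by rewrite gt_eqF// sqr_lt1.
  by apply: cvgB; [exact: cvg_cst|apply: cvgM; exact: cvg_id].
have [c cI cmax] := EVT_max rr cont.
exists c; split; first by rewrite ler_norml; move: cI; rewrite in_itv.
by move=> z zr; apply: cmax; rewrite in_itv /= -ler_norml.
Qed.

Lemma eq_residual (y y' : nat -> R) j w : (forall i, (i < j)%N -> y i = y' i) ->
  residual y j w = residual y' j w.
Proof.
move=> h; rewrite /residual /blaschke_prod; congr (_ ^+ 2 / _).
by apply: eq_bigr => i _; rewrite h.
Qed.

(** The residual at stage [j] depends only on the nodes before [j], so maximisers can be picked one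
    after another. Maximality bounds [tm_fun y j] on the whole interval by its size at [y j] and
    makes the node heights nonincreasing. *)
Lemma greedy_nodes (r : R) : 0 <= r < 1 ->
  exists y : nat -> R, (forall i, `|y i| <= r) /\
    forall j z, `|z| <= r -> residual y j z <= residual y j (y j).
Proof.
move=> r01; have /andP[r0 r1] := r01.
pose ok (y : nat -> R) := forall i, `|y i| <= r.
have pick (y : nat -> R) j : {c | ok y -> `|c| <= r /\
    forall z, `|z| <= r -> residual y j z <= residual y j c}.
  apply: cid; have [h|h] := pselect (ok y); last by exists 0.
  have [c hc] := @residual_argmax (y : nat -> R) j r (fun i => le_lt_trans (h i) r1) r01.
  by exists c.
(* [Y n] holds the first [n] choices, with [0] as default beyond them. *)
pose Y := fix Y n : nat -> R := if n is n'.+1 then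
   (fun i => if i == n' then sval (pick (Y n') n') else Y n' i) else (fun=> 0).
have okY n : ok (Y n).
  elim: n => [|n IH] i /=; first by rewrite normr0.
  case: eqP => // _; exact: (svalP (pick (Y n) n) IH).1.
pose y i := Y i.+1 i.
have yE n i : (i < n)%N -> Y n i = y i.
  elim: n => // n IH; rewrite ltnS leq_eqVlt => /orP[/eqP ->//|h] /=.
  by rewrite ltn_eqF// IH.
exists y; split => [i|j z zr]; first exact: okY.
have yj : y j = sval (pick (Y j) j) by rewrite /y /= eqxx.
rewrite !(@eq_residual y (Y j)); try by move=> i h; rewrite yE.
by rewrite yj; apply: (svalP (pick (Y j) j) (okY j)).2.
Qed.

End PointEnergy.

(** * Lower bound for small-ball probabilities *)

Section Pigeonhole.
Variable R : realType.

Lemma hoeffding (c : nat -> R) N (S u : R) : 0 < S -> 0 <= u ->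
  \sum_(i < N) c i ^+ 2 <= S ->
  sign_prob N (fun s => u <= `|\sum_(i < N) c i * s i|) <= 2 * expR (- (u ^+ 2 / (2 * S))).
Proof.
move=> S0 u0 cS.
have one (c' : nat -> R) : \sum_(i < N) c' i ^+ 2 <= S ->
   sign_prob N (fun s => u <= \sum_(i < N) c' i * s i) <= expR (- (u ^+ 2 / (2 * S))).
  move=> c'S; pose r := u / S.
  have r0 : 0 <= r by rewrite divr_ge0// ltW.
  apply: le_trans (_ : expR (- (r * u)) *
     sign_avg N (fun s => expR (\sum_(i < N) (r * c' i) * s i)) <= _).
    rewrite -sign_avgZ; apply: le_sign_avg => s _; case: asboolP => h; last first.
      by rewrite mulr_ge0// expR_ge0.
    rewrite -expRD -[leLHS]expR0 ler_expR addrC subr_ge0.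
    by under eq_bigr do rewrite -mulrA; rewrite -mulr_sumr ler_wpM2l.
  rewrite (sign_avg_exp N (fun i => r * c' i)).
  have h0 : 0 <= (0 : R) <= 1 / 8 by apply/andP; split; lra.
  apply: le_trans (_ : expR (- (r * u)) * \prod_(k < N) expR ((r * c' k) ^+ 2 / 2) <= _).
    rewrite ler_pM2l ?expR_gt0// ler_prod// => i _.
    rewrite divr_ge0 ?addr_ge0 ?expR_ge0//=.
    by have := cosh_le_expR (r * c' i) h0; rewrite subr0 mul1r expr0n /= mulr0 addr0.
  rewrite -expR_sum -expRD ler_expR.
  have -> : \sum_(i < N) (r * c' i) ^+ 2 / 2 = r ^+ 2 / 2 * \sum_(i < N) c' i ^+ 2.
    by rewrite mulr_sumr; apply: eq_bigr => i _; rewrite exprMn; ring.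
  apply: le_trans (_ : - (r * u) + r ^+ 2 / 2 * S <= _).
    by rewrite lerD2l ler_wpM2l// divr_ge0// sqr_ge0.
  by rewrite /r le_eqVlt; apply/orP; left; apply/eqP; field; rewrite gt_eqF.
have cS' : \sum_(i < N) (- c i) ^+ 2 <= S by under eq_bigr do rewrite sqrrN.
rewrite mulr2n mulrDl mul1r.
apply: le_trans (lerD (one c cS) (one (fun i => - c i) cS')).
apply: le_trans (sign_prob_or _ _ _); apply: le_sign_prob => s _.
rewrite ler_normr => /orP[h|h]; [by left|right].
by move: h; rewrite -sumrN; under eq_bigr do rewrite -mulNr.
Qed.

(** The collision probability is the sum of the squared cell probabilities; their variance around
    the mean is nonnegative, which is the Cauchy-Schwarz inequality. *)
Lemma pigeonhole (I : finType) N (cell : (nat -> R) -> I) (T : (nat -> R) -> Prop) :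
  sign_prob N T ^+ 2 <= #|I|%:R *
  sign_avg N (fun s => sign_prob N (fun s' => [/\ T s, T s' & cell s = cell s'])).
Proof.
pose p c := sign_prob N (fun s => T s /\ cell s = c).
have -> : sign_avg N (fun s => sign_prob N (fun s' => [/\ T s, T s' & cell s = cell s'])) =
    \sum_(c : I) p c ^+ 2.
  transitivity (sign_avg N (fun s => \sum_(c : I) (`[< T s /\ cell s = c >])%:R * p c)).
    apply: eq_sign_avg => s _; rewrite (bigD1 (cell s)) //= big1 ?addr0; last first.
      move=> c /eqP nc; case: asboolP => [[_ e]|_]; last by rewrite mul0r.
      by case: nc.
    rewrite /p /sign_prob -sign_avgZ; apply: eq_sign_avg => s' _.
    rewrite -natrM mulnb -asbool_and; congr ((nat_of_bool _)%:R); apply: asbool_equiv_eq.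
    by split => [[h1 h2 h3]|[[h1 _] [h2 h3]]].
  rewrite sign_avg_sum; apply: eq_bigr => c _.
  under eq_fun do rewrite mulrC.
  by rewrite sign_avgZ -/(sign_prob _ _) expr2.
have -> : sign_prob N T = \sum_(c : I) p c.
  rewrite /p /sign_prob -sign_avg_sum; apply: eq_sign_avg => s _.
  rewrite (bigD1 (cell s)) //= big1 ?addr0; last first.
    by move=> c /eqP nc; case: asboolP => // -[_ e]; case: nc.
  congr ((nat_of_bool _)%:R); apply: asbool_equiv_eq.
  by split => [h|[h _]].
set S := \sum_(c : I) p c.
have [e|n0] := eqVneq #|I| 0%N.
  rewrite e mul0r /S big_pred0 ?expr0n//= => c; apply/negP => _.
  exact: (fintype0 c e).
have I0 : 0 < #|I|%:R :> R by rewrite ltr0n lt0n.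
have h : 0 <= \sum_(c : I) (p c - S / #|I|%:R) ^+ 2.
  by rewrite sumr_ge0// => c _; exact: sqr_ge0.
have E : \sum_(c : I) (p c - S / #|I|%:R) ^+ 2 = \sum_(c : I) p c ^+ 2 - S ^+ 2 / #|I|%:R.
  transitivity (\sum_(c : I) (p c ^+ 2 + - (2 * (S / #|I|%:R)) * p c + (S / #|I|%:R) ^+ 2)).
    by apply: eq_bigr => c _; ring.
  rewrite !big_split /= -mulr_sumr -/S sumr_const.
  rewrite -[_ *+ #|_|]mulr_natl; field.
  by rewrite gt_eqF.
by move: h; rewrite E subr_ge0 ler_pdivrMr// mulrC.
Qed.

Lemma sign_avgN N (F : (nat -> R) -> R) :
  sign_avg N (fun s => F (fun i => - s i)) = sign_avg N F.
Proof.
elim: N F => [|N IH] F /=.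
  by congr F; apply/funext => i; rewrite oppr0.
have E a : sign_avg N (fun s => F (fun i => - scons a s i)) =
    sign_avg N (fun s => F (scons (- a) s)).
  rewrite -(IH (fun s => F (scons (- a) s))); congr sign_avg; apply/funext => s; congr F.
  by apply/funext => -[|i].
by rewrite !E opprK addrC.
Qed.

(* [low s] and [high s] collect the signs whose index is [0, 1] resp. [2, 3]
   modulo [4]; [spread i] is the exponent carried by the [i]-th sign of [low s]. *)
Definition spread i := (4 * i./2 + odd i)%N.

Lemma spreadSS i : spread i.+2 = (spread i).+4.
Proof. by rewrite /spread /= negbK mulnS -addnA. Qed.

Definition low (s : nat -> R) i := s (spread i).
Definition high (s : nat -> R) i := s (spread i).+2.

(** [low] and [high] read disjoint sets of coordinates, hence behave as two independent sign
    vectors. The induction handles one period of four signs. *)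
Lemma sign_avg_low_high m (G : (nat -> R) -> (nat -> R) -> R) :
  sign_avg (4 * m) (fun s => G (low s) (high s)) =
  sign_avg (2 * m) (fun s => sign_avg (2 * m) (fun s' => G s s')).
Proof.
elim: m G => [|m IH] G.
  by rewrite !muln0 /=; congr G; apply/funext => i.
rewrite !mulnS; set n := (4 * m)%N in IH *; set k := (2 * m)%N in IH *.
have lowE a b c e s : low (scons a (scons b (scons c (scons e s)))) = scons a (scons b (low s)).
  by apply/funext => -[|[|i]] //; rewrite /low spreadSS.
have highE a b c e s : high (scons a (scons b (scons c (scons e s)))) = scons c (scons e (high s)).
  by apply/funext => -[|[|i]] //; rewrite /high spreadSS.
have E a b c e : sign_avg n (fun s => G (low (scons a (scons b (scons c (scons e s)))))
     (high (scons a (scons b (scons c (scons e s)))))) =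
   sign_avg k (fun s => sign_avg k (fun s' => G (scons a (scons b s)) (scons c (scons e s')))).
  rewrite -(IH (fun s s' => G (scons a (scons b s)) (scons c (scons e s')))).
  by congr sign_avg; apply/funext => s; rewrite lowE highE.
rewrite [LHS]/= !E [RHS]/=.
have D a b :
  sign_avg k (fun s => ((sign_avg k (fun s' => G (scons a (scons b s)) (scons 1 (scons 1 s'))) +
     sign_avg k (fun s' => G (scons a (scons b s)) (scons 1 (scons (-1) s')))) / 2 +
     (sign_avg k (fun s' => G (scons a (scons b s)) (scons (-1) (scons 1 s'))) +
     sign_avg k (fun s' => G (scons a (scons b s)) (scons (-1) (scons (-1) s')))) / 2) / 2) =
  ((sign_avg k (fun s => sign_avg k (fun s' => G (scons a (scons b s)) (scons 1 (scons 1 s')))) +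
     sign_avg k (fun s => sign_avg k (fun s' => G (scons a (scons b s)) (scons 1 (scons (-1) s'))))) / 2 +
     (sign_avg k (fun s => sign_avg k (fun s' => G (scons a (scons b s)) (scons (-1) (scons 1 s')))) +
     sign_avg k (fun s => sign_avg k (fun s' => G (scons a (scons b s)) (scons (-1) (scons (-1) s'))))) / 2) / 2.
  rewrite -!sign_avgD ![_ / 2]mulrC -!sign_avgZ -!sign_avgD -!sign_avgZ.
  by apply: eq_sign_avg => s _; ring.
by rewrite !D.
Qed.

Lemma sum_spread_le m (F : nat -> R) : (forall k, 0 <= F k) ->
  \sum_(i < 2 * m) F (spread i) <= \sum_(k < 4 * m) F k.
Proof.
move=> F0; elim: m => [|m IH]; first by rewrite !muln0 !big_ord0.
rewrite ![in X in X <= _]mulnSr ![in X in _ <= X]mulnSr !addnS !addn0 !big_ord_recr /=.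
have -> : spread (2 * m) = (4 * m)%N by rewrite /spread mul2n doubleK odd_double addn0.
have -> : spread (2 * m).+1 = (4 * m).+1.
  by rewrite /spread mul2n /= uphalf_double odd_double addn1.
have := F0 (4 * m).+2; have := F0 (4 * m).+3.
move: IH; lra.
Qed.

Lemma low_high_poly m (s : nat -> R) (x : R) :
  \sum_(k < 4 * m) s k * x ^+ k =
  \sum_(i < 2 * m) low s i * x ^+ spread i + x ^+ 2 * \sum_(i < 2 * m) high s i * x ^+ spread i.
Proof.
elim: m => [|m IH]; first by rewrite !muln0 !big_ord0 mulr0 addr0.
rewrite [(4 * _)%N]mulnSr [(2 * _)%N]mulnSr !addnS !addn0 !big_ord_recr /= IH /low /high.
have -> : spread (2 * m) = (4 * m)%N by rewrite /spread mul2n doubleK odd_double addn0.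
have -> : spread (2 * m).+1 = (4 * m).+1.
  by rewrite /spread mul2n /= uphalf_double odd_double addn1.
by rewrite !exprS; ring.
Qed.

(** Exponents [0, 1] modulo [4] leave two terms per power of [x^4], and [1 - x^2 <= 1 - x^4] cancels
    the geometric series. *)
Lemma spread_poly_bound m (s : nat -> R) (x : R) : (forall i, `|s i| <= 1) -> `|x| <= 1 ->
  (1 - x ^+ 2) * `|\sum_(i < 2 * m) s i * x ^+ spread i| <= 2.
Proof.
move=> s1 x1.
have x2 : x ^+ 2 <= 1 by rewrite -real_normK ?num_real// exprn_ile1.
have h : `|\sum_(i < 2 * m) s i * x ^+ spread i| <= 2 * \sum_(k < m) (x ^+ 4) ^+ k.
  elim: m => [|m IH]; first by rewrite !muln0 !big_ord0 normr0 mulr0.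
  rewrite [(2 * _)%N]mulnSr !addnS !addn0 !big_ord_recr /=.
  have -> : spread (2 * m) = (4 * m)%N by rewrite /spread mul2n doubleK odd_double addn0.
  have -> : spread (2 * m).+1 = (4 * m).+1.
    by rewrite /spread mul2n /= uphalf_double odd_double addn1.
  rewrite mulrDr -addrA; apply: le_trans (ler_normD _ _) _; apply: lerD IH _.
  rewrite -exprM; apply: le_trans (ler_normD _ _) _; rewrite !normrM !normrX.
  have e : `|x| ^+ (4 * m) = x ^+ (4 * m).
    by rewrite -normrX ger0_norm// exprM exprn_ge0// exprn_even_ge0.
  have e0 : 0 <= x ^+ (4 * m) by rewrite -e exprn_ge0.
  rewrite exprS e mulr2n mulrDl mul1r; apply: lerD; first by rewrite ler_piMl.
  by rewrite mulrA ler_piMl// mulr_ile1.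
apply: le_trans (ler_wpM2l _ h) _; first by rewrite subr_ge0.
rewrite mulrCA -[leRHS]mulr1 ler_pM2l//.
have x4 : 0 <= x ^+ 4 by rewrite exprn_even_ge0.
have g : (1 - x ^+ 4) * \sum_(k < m) (x ^+ 4) ^+ k = 1 - (x ^+ 4) ^+ m.
  elim: m {h} => [|m IH]; first by rewrite big_ord0 mulr0 expr0 subrr.
  by rewrite big_ord_recr /= mulrDr IH (exprS (x ^+ 4)); ring.
have S0 : 0 <= \sum_(k < m) (x ^+ 4) ^+ k by rewrite sumr_ge0// => k _; rewrite exprn_ge0.
apply: le_trans (_ : (1 - x ^+ 4) * \sum_(k < m) (x ^+ 4) ^+ k <= _).
  rewrite ler_wpM2r// lerD2l lerN2 (_ : 4 = 2 + 2)%N// exprD ler_piMl// sqr_ge0//.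
by rewrite g gerBl exprn_ge0.
Qed.

End Pigeonhole.

(** * Covering by cells of rounded coefficients *)

Section Covering.
Variable R : realType.

Lemma expR1_bounds : 2 <= expR (1 : R) <= 4.
Proof.
have h1 := expR_ge1Dx (1 : R); apply/andP; split; first by lra.
have h2 := expR_ge1Dx (- (1 / 2) : R).
have h3 : expR (1 / 2) * expR (- (1 / 2)) = 1 :> R by rewrite expRxMexpNx_1.
have h4 := expR_gt0 (1 / 2 : R).
have h5 : expR (1 / 2) <= 2 :> R by nra.
have -> : 1 = 1 / 2 + 1 / 2 :> R by field.
by rewrite expRD; nra.
Qed.

(** The thresholds start at [3] so that the union bound over all coefficients, whatever their
    number, leaves probability [1 / 2]. *)
Lemma sum_gauss_tail_le J :
  \sum_(j < J) 2 * expR (- (j.+3%:R ^+ 2 / 2)) <= 1 / 2 :> R.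
Proof.
have /andP[e2 _] := expR1_bounds.
have tail (j : nat) : expR (- (j.+3%:R ^+ 2 / 2)) <= (1 / 2) ^+ j.+3 :> R.
  apply: le_trans (_ : expR (-1) ^+ j.+3 <= _).
    rewrite -expRM_natl ler_expR mulrN1 lerN2.
    have : 3 <= j.+3%:R :> R by rewrite ler_nat.
    by nra.
  rewrite lerXn2r ?nnegrE ?expR_ge0// expRN div1r lef_pV2 ?posrE ?expR_gt0//.
have sum2 : \sum_(j < J) (1 / 2) ^+ j.+3 <= 1 / 4 :> R.
  suff -> : \sum_(j < J) (1 / 2) ^+ j.+3 = 1 / 4 - (1 / 2) ^+ J.+2 :> R.
    by rewrite gerBl exprn_ge0// divr_ge0.
  elim: J => [|J IH]; first by rewrite big_ord0; lra.
  by rewrite big_ord_recr /= IH !exprS; lra.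
apply: le_trans (_ : 2 * \sum_(j < J) (1 / 2) ^+ j.+3 <= _); last by lra.
by rewrite mulr_sumr; apply: ler_sum => j _; rewrite ler_pM2l.
Qed.

Lemma card_dffun_ord J (W : nat -> nat) :
  #|{dffun forall j : 'I_J, 'I_(W j)}| = (\prod_(j < J) W j)%N.
Proof.
rewrite card_dep_ffun /image_mem.
have -> (s : seq 'I_J) : foldr muln 1%N [seq #|'I_(W (nat_of_ord x))| | x <- s] = (\prod_(j <- s) W (nat_of_ord j))%N.
  by elim: s => [|a s IH]; rewrite ?big_nil// big_cons /= IH card_ord.
by rewrite big_enum.
Qed.

(** Coefficients of the polynomial in the system after the substitution [x^k = r^-k (r x)^k], which
    moves [[-1, 1]] into the open interval where the system lives. *)
Definition tm_form (y : nat -> R) (r : R) m j (s : nat -> R) :=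
  \sum_(i < 2 * m) (r ^- spread i * tm_coef y j (spread i)) * s i.

Section Cover.
Variables (m J0 J : nat) (th S : R) (y : nat -> R).
Hypothesis (m0 : (0 < m)%N) (th0 : 0 < th) (JJ : (J0 <= J)%N).

Let n := (4 * m)%N.
(** This radius keeps the weights [r^-k] with [k <= n] at most [e], while [artanh r] is about
    [ln n / 2]. *)
Let r : R := n%:R / n.+1%:R.
Let M j := node_height y j.

Hypothesis (yr : forall i, `|y i| <= r).
Hypothesis (ymax : forall j z, `|z| <= r -> residual y j z <= residual y j (y j)).
Hypothesis tailM : \sum_(J0 <= j < J) 8 * j.+3%:R * M j <= S * th.
Hypothesis lastM : 16 * m%:R * M J <= th.

Let n0 : 0 < n%:R :> R.
Proof. by rewrite ltr0n /n muln_gt0. Qed.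

Let r0 : 0 < r. Proof. by rewrite divr_gt0. Qed.

Let r1 : r < 1. Proof. by rewrite ltr_pdivrMr// mul1r ltr_nat. Qed.

Let y1 i : `|y i| < 1. Proof. exact: le_lt_trans (yr i) r1. Qed.

Let M0 j : 0 <= M j. Proof. exact: sqrtr_ge0. Qed.

Lemma spread_lt i : (i < 2 * m)%N -> (spread i < n)%N.
Proof. by rewrite /spread /n; have := odd_double_half i; rewrite -mul2n; case: odd => /=; lia. Qed.

Lemma weight_bounds k : (k <= n)%N -> 0 <= r ^- k <= 4.
Proof.
move=> kn; rewrite invr_ge0 exprn_ge0 ?(ltW r0)//=.
rewrite -exprVn /r invf_div.
have -> : n.+1%:R / n%:R = 1 + n%:R^-1 :> R by rewrite -natr1 mulrDl divff ?gt_eqF// mul1r.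
apply: le_trans (_ : expR (n%:R^-1) ^+ k <= _).
  by rewrite lerXn2r ?nnegrE ?expR_ge0 ?addr_ge0 ?invr_ge0// expR_ge1Dx.
rewrite -expRM_natl; have /andP[_ e4] := expR1_bounds.
apply: le_trans e4; rewrite ler_expR ler_pdivrMr// mul1r ler_nat//.
Qed.

Lemma tm_form_tail j : sign_prob (2 * m) (fun s => 4 * j.+3%:R <= `|tm_form y r m j s|) <=
  2 * expR (- (j.+3%:R ^+ 2 / 2)).
Proof.
have h : \sum_(i < 2 * m) (r ^- spread i * tm_coef y j (spread i)) ^+ 2 <= 16.
  apply: le_trans (_ : \sum_(i < 2 * m) 16 * tm_coef y j (spread i) ^+ 2 <= _).
    apply: ler_sum => i _; rewrite exprMn ler_wpM2r ?sqr_ge0//.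
    have /andP[w0 w4] := weight_bounds (ltnW (spread_lt (ltn_ord i))).
    by move: (r ^- spread i) w0 w4 => u w0 w4; nra.
  rewrite -mulr_sumr -[leRHS]mulr1 ler_pM2l//.
  apply: le_trans (sum_spread_le m (fun k => sqr_ge0 (tm_coef y j k))) _.
  exact: tm_coef_sqr_sum.
have u0 : 0 <= 4 * j.+3%:R :> R by rewrite mulr_ge0.
have H := @hoeffding R (fun i => r ^- spread i * tm_coef y j (spread i)) (2 * m) 16 _
  (ltr0n R 16) u0 h.
apply: le_trans H _.
by rewrite ler_pM2l// ler_expR lerN2 exprMn; lra.
Qed.

Definition typical (s : nat -> R) := forall j, (j < J)%N -> `|tm_form y r m j s| <= 4 * j.+3%:R.

Lemma typical_prob : 1 / 2 <= sign_prob (2 * m) typical.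
Proof.
have h : sign_prob (2 * m) (fun s => ~ typical s) <= 1 / 2.
  apply: le_trans (sum_gauss_tail_le J).
  apply: le_trans (_ : \sum_(j < J) sign_prob (2 * m) (fun s => 4 * j.+3%:R <= `|tm_form y r m j s|) <= _).
    apply: le_trans (sign_prob_exists _ J (fun j s => 4 * j.+3%:R <= `|tm_form y r m j s|)).
    apply: le_sign_prob => s _ nt; apply: contrapT => ne; apply: nt => j jJ.
    by rewrite leNgt; apply/negP => /ltW h; apply: ne; exists j.
  by apply: ler_sum => j _; exact: tm_form_tail.
by move: h; rewrite sign_prob_not; lra.
Qed.

(** In this unit an error of [1] in the [j]-th coefficient moves the polynomial by at most [th]; the
    shift makes truncation act on nonnegative numbers for typical signs. *)
Let rescaled j (s : nat -> R) := (tm_form y r m j s + 4 * j.+3%:R) * M j / th.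

Let width j := Num.truncn (8 * j.+3%:R * M j / th).

Let cell (s : nat -> R) : {dffun forall j : 'I_J0, 'I_(width j).+1} :=
  [ffun j : 'I_J0 => inord (Num.truncn (rescaled j s)) : 'I_(width j).+1].

Let rescaled_bounds j s : typical s -> (j < J)%N -> 0 <= rescaled j s <= 8 * j.+3%:R * M j / th.
Proof.
move=> /[apply]; rewrite ler_norml => /andP[h1 h2]; apply/andP; split.
  by rewrite divr_ge0 ?(ltW th0)// mulr_ge0//; lra.
by rewrite ler_pM2r ?invr_gt0// ler_wpM2r//; lra.
Qed.

Lemma same_cell s s' j : typical s -> typical s' -> cell s = cell s' -> (j < J0)%N ->
  M j * `|tm_form y r m j s - tm_form y r m j s'| <= th.
Proof.
move=> ts ts' /ffunP ce jJ0.
have jJ := leq_trans jJ0 JJ.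
have /andP[a0 a1] := rescaled_bounds ts jJ.
have /andP[b0 b1] := rescaled_bounds ts' jJ.
have e : Num.truncn (rescaled j s) = Num.truncn (rescaled j s').
  have := congr1 val (ce (Ordinal jJ0)); rewrite !ffunE /= !inordK //.
    by rewrite ltnS; apply: le_truncn.
  by rewrite ltnS; apply: le_truncn.
have /andP[u1 u2] := truncn_itv a0; have /andP[v1 v2] := truncn_itv b0.
rewrite e in u1 u2; rewrite -natr1 in u2 v2.
have d : `|rescaled j s - rescaled j s'| <= 1 by rewrite ler_norml; apply/andP; split; lra.
have -> : M j * `|tm_form y r m j s - tm_form y r m j s'| = `|rescaled j s - rescaled j s'| * th.
  have -> : rescaled j s - rescaled j s' = M j * (tm_form y r m j s - tm_form y r m j s') / th.
    by rewrite /rescaled; ring.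
  by rewrite !normrM normfV (ger0_norm (M0 j)) (gtr0_norm th0) divfK// gt_eqF.
by rewrite -[leRHS]mul1r ler_pM2r.
Qed.

Lemma tm_fun_le_height j x : `|x| <= 1 -> `|tm_fun y j (r * x)| <= M j.
Proof.
move=> x1.
have rx : `|r * x| <= r by rewrite normrM gtr0_norm// ler_piMr// ltW.
have rx1 : `|r * x| < 1 := le_lt_trans rx r1.
rewrite -ler_sqr ?nnegrE// real_normK ?num_real//.
rewrite /M /node_height sqr_sqrtr; last exact: residual_ge0.
by apply: le_trans (ymax j rx); exact: tm_fun_sqr_le.
Qed.

(** Three ranges: rounded coefficients contribute [th] each; those from [J0] to [J] are not rounded
    and are controlled by typicality and [tailM]; the remainder after [J] is bounded trivially, one
    term per sign. *)
Lemma same_cell_poly s s' x : (forall i, `|s i| <= 1) -> (forall i, `|s' i| <= 1) ->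
  typical s -> typical s' -> cell s = cell s' -> `|x| <= 1 ->
  `|\sum_(i < 2 * m) s i * x ^+ spread i - \sum_(i < 2 * m) s' i * x ^+ spread i| <=
  (J0%:R + S + 1) * th.
Proof.
move=> s1 s1' ts ts' ce x1.
have rx : `|r * x| <= r by rewrite normrM gtr0_norm// ler_piMr// ltW.
have rx1 : `|r * x| < 1 := le_lt_trans rx r1.
pose rem k := blaschke_prod y J (r * x) * blaschke_seqs y J (fun k => (r * x) ^+ k) k.
have remM k : (k < n)%N -> `|rem k| <= M J.
  move=> kn; rewrite -ler_sqr ?nnegrE// real_normK ?num_real//.
  rewrite /M /node_height sqr_sqrtr; last exact: residual_ge0.
  apply: le_trans (ymax J rx); apply: le_trans (residual_coef_sqr_sum J n y1 rx1).
  by rewrite (bigD1 (Ordinal kn)) //= lerDl sumr_ge0// => i _; rewrite sqr_ge0.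
have expand (t : nat -> R) : \sum_(i < 2 * m) t i * x ^+ spread i =
    \sum_(j < J) tm_fun y j (r * x) * tm_form y r m j t +
    \sum_(i < 2 * m) t i * (r ^- spread i * rem (spread i)).
  rewrite /tm_form; under [X in _ = X + _]eq_bigr do rewrite mulr_sumr.
  rewrite exchange_big -big_split /=; apply: eq_bigr => i _.
  have -> : x ^+ spread i = r ^- spread i * (r * x) ^+ spread i.
    by rewrite (exprMn (spread i) r x) mulKf// expf_neq0// gt_eqF.
  rewrite (tm_expansion J (spread i) y1 rx1) -/(rem _) !mulrDr; congr (_ + _).
  by rewrite !mulr_sumr; apply: eq_bigr => j _; ring.
rewrite !expand opprD addrACA -!sumrB; apply: le_trans (ler_normD _ _) _.
have -> : (J0%:R + S + 1) * th = (J0%:R * th + S * th) + th by ring.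
apply: lerD.
  apply: le_trans (ler_norm_sum _ _ _) _.
  pose F j := `|tm_fun y j (r * x) * tm_form y r m j s - tm_fun y j (r * x) * tm_form y r m j s'|.
  rewrite -(big_mkord xpredT F) (@big_cat_nat _ _ _ J0)//=.
  have FM j : F j <= M j * `|tm_form y r m j s - tm_form y r m j s'|.
    by rewrite /F -mulrBr normrM ler_wpM2r// tm_fun_le_height.
  apply: lerD.
    apply: le_trans (_ : \sum_(0 <= j < J0) th <= _); last by rewrite sumr_const_nat subn0 mulr_natl.
    rewrite big_nat_cond [leRHS]big_nat_cond; apply: ler_sum => j; rewrite andbT => /andP[_ jJ0].
    by apply: le_trans (FM j) _; exact: same_cell.
  apply: le_trans tailM; rewrite big_nat_cond [leRHS]big_nat_cond.
  apply: ler_sum => j; rewrite andbT => /andP[_ jJ].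
  apply: le_trans (FM j) _; rewrite mulrC ler_wpM2r//.
  apply: le_trans (ler_normB _ _) _; have := ts j jJ; have := ts' j jJ; lra.
apply: le_trans (ler_norm_sum _ _ _) _.
apply: le_trans (_ : \sum_(i < 2 * m) 8 * M J <= _); last first.
  rewrite sumr_const card_ord -[_ *+ (2 * m)]mulr_natr natrM; apply: le_trans lastM.
  by rewrite le_eqVlt; apply/orP; left; apply/eqP; ring.
apply: ler_sum => i _; rewrite -mulrBl normrM.
have il := spread_lt (ltn_ord i).
have /andP[w0 w4] := weight_bounds (ltnW il).
have h2 : `|s i - s' i| <= 2.
  by apply: le_trans (ler_normB _ _) _; have := s1 i; have := s1' i; lra.
have -> : 8 * M J = 2 * (4 * M J) by ring.
by rewrite ler_pM// normrM (ger0_norm w0) ler_pM// remM.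
Qed.

Lemma card_cell : #|{dffun forall j : 'I_J0, 'I_(width j).+1}|%:R <=
  \prod_(j < J0) (8 * j.+3%:R * M j / th + 1) :> R.
Proof.
rewrite (card_dffun_ord J0 (fun j => (width j).+1)) natr_prod ler_prod// => j _.
rewrite ler0n /= -natr1 lerD2r.
have h : 0 <= 8 * j.+3%:R * M j / th by rewrite divr_ge0 ?(ltW th0)// !mulr_ge0.
by have /andP[] := truncn_itv h.
Qed.

(** The second copy is negated before the pigeonhole, as the symmetry [sign_avgN] allows, so that a
    difference of two polynomials becomes a polynomial with signs. The [4] comes from squaring
    [typical_prob], the added [2] from [spread_poly_bound]. *)
Lemma cover_prob :
  (4 * \prod_(j < J0) (8 * j.+3%:R * M j / th + 1))^-1 <=
  sign_prob n (fun s => forall x : R, `|x| <= 1 ->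
     `|\sum_(k < n) s k * x ^+ k| <= (J0%:R + S + 1) * th + 2).
Proof.
set Q := (X in _ <= sign_prob _ X).
have := pigeonhole (2 * m) cell typical.
set E := sign_avg _ _ => ph.
have EQ : E <= sign_prob n Q.
  rewrite /E; under eq_fun do rewrite /sign_prob -sign_avgN.
  rewrite -(sign_avg_low_high m (fun s s' => (`[< [/\ typical s, typical (fun i => - s' i)
     & cell s = cell (fun i => - s' i)] >])%:R)).
  apply: (le_sign_prob (Q := fun s => [/\ typical (low s), typical (fun i => - high s i)
     & cell (low s) = cell (fun i => - high s i)])) => s hs [t1 t2 ce] x x1.
  have sl i : `|low s i| <= 1 by exact: is_signs_norm hs.
  have sh i : `|- high s i| <= 1 by rewrite normrN; exact: is_signs_norm hs.
  have h1 := same_cell_poly sl sh t1 t2 ce x1.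
  have h2 := spread_poly_bound m sh x1.
  rewrite /n low_high_poly.
  set A := \sum_(i < 2 * m) low s i * _ in h1 *.
  have -> : \sum_(i < 2 * m) high s i * x ^+ spread i =
     - \sum_(i < 2 * m) - high s i * x ^+ spread i.
    by rewrite -sumrN; apply: eq_bigr => i _; ring.
  set B := \sum_(i < 2 * m) - high s i * _ in h1 h2 *.
  have -> : A + x ^+ 2 * - B = (A - B) + (1 - x ^+ 2) * B by ring.
  apply: le_trans (ler_normD _ _) (lerD h1 _).
  rewrite normrM ger0_norm// subr_ge0 -real_normK ?num_real//.
  by rewrite exprn_ile1.
have tp : (1 / 2) ^+ 2 <= sign_prob (2 * m) typical ^+ 2.
  by rewrite lerXn2r ?nnegrE ?sign_prob_ge0 ?divr_ge0// typical_prob.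
have P0 : 0 < \prod_(j < J0) (8 * j.+3%:R * M j / th + 1).
  by apply: prodr_gt0 => j _; rewrite ltr_wpDl// divr_ge0 ?(ltW th0)// !mulr_ge0.
rewrite invfM ler_pdivrMr//.
have h : (1 / 2) ^+ 2 <= \prod_(j < J0) (8 * j.+3%:R * M j / th + 1) * sign_prob n Q.
  apply: le_trans tp _; apply: le_trans ph _.
  rewrite ler_pM// ?card_cell//.
  by apply: sign_avg_ge0 => s _; exact: sign_prob_ge0.
by rewrite [leRHS]mulrC; apply: le_trans h; lra.
Qed.

End Cover.
End Covering.

(** * Asymptotics of the energy bound and decay of the node heights *)

Section SmallBallLower.
Variable R : realType.

Let c0 : R := 4 / (3 * pi ^+ 2).

Lemma c0_bounds : 0 < c0 <= 1 / 3.
Proof.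
have /andP[p4 p16] := pi_sqr_bounds R; rewrite /c0.
move: (pi ^+ 2 : R) p4 p16 => P p4 p16.
by rewrite divr_gt0 ?ler_pdivrMr//=; lra.
Qed.

Lemma pow_one_plus_le (e : R) : 0 <= e <= 1 -> (1 + e) ^+ 5 <= 1 + 31 * e.
Proof.
move=> /andP[e0 e1].
have h2 : (1 + e) ^+ 2 <= 1 + 3 * e by nra.
have h20 : 0 <= (1 + e) ^+ 2 by rewrite sqr_ge0.
have h4 : (1 + e) ^+ 4 <= 1 + 15 * e by rewrite (_ : 4 = 2 + 2)%N// exprD; nra.
rewrite (exprS _ 4).
have h40 : 0 <= (1 + e) ^+ 4 by rewrite exprn_ge0// addr_ge0.
nra.
Qed.

(** The leading coefficient of [energy_bound] is [(1 + 1 / ta) / (6 odd_sq_sum)], which tends to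
    [1 / (6 pi^2 / 8) = c0] as [n0] and [ta] grow. With these fixed, a large [b] swallows the
    quadratic term and the self-energy shift. *)
Lemma energy_bound_asymptotic (d : R) : 0 < d ->
  exists n0 (ta b0 : R), [/\ (0 < n0)%N, 0 < ta, 1 <= b0 &
    forall b, b0 <= b -> energy_bound n0 ta b <= (c0 + d) * b ^+ 3].
Proof.
move=> d0; have /andP[c00 c01] := c0_bounds.
(* Five factors [1 + e] accumulate: one from [ta = 1 / e], one from [odd_sq_sum], three from the
   shift of [b]; they cost [31 e], at most half of [d]. *)
pose e := Num.min 1 (d / 62).
have e0 : 0 < e by rewrite lt_min; apply/andP; split; lra.
have e1 : e <= 1 by rewrite ge_min lexx.
have ed : e <= d / 62 by rewrite ge_min lexx orbT.
have [P PE] : exists P : R, P = pi ^+ 2 / 8 by exists (pi ^+ 2 / 8).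
have /andP[p4 p16] := pi_sqr_bounds R.
have P0 : 0 < P by rewrite PE; lra.
have [N HN] : exists N : nat, P / (1 + e) <= odd_sq_sum R (2 ^ N).
  exists (Num.truncn (2 / e)); apply: le_trans (odd_sq_sum_ge R _).
  have := truncnS_gt (2 / e); set t := (Num.truncn (2 / e)).+1 => ht.
  have t0 : 0 < t%:R :> R by rewrite ltr0n.
  have -> : pi ^+ 2 / 8 - pi ^+ 2 / 16 / t%:R = P * (1 - (2 * t%:R)^-1).
    by rewrite PE; move: (t%:R : R) t0 => u u0; move: (@pi R) => p; field; rewrite gt_eqF.
  rewrite ler_pM2l// -[leLHS]div1r ler_pdivrMr ?addr_gt0//.
  have : 2 < t%:R * e by rewrite -ltr_pdivrMr.
  have -> : (1 - (2 * t%:R)^-1) * (1 + e) = 1 + (e - (1 + e) / (2 * t%:R)).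
    by move: (t%:R : R) t0 => u u0; field; rewrite gt_eqF.
  move=> h; rewrite lerDl subr_ge0 ler_pdivrMr ?mulr_gt0//.
  by move: h; lra.
set c := odd_sq_sum R (2 ^ N) in HN.
have cc0 : 0 < c by apply: lt_le_trans HN; rewrite divr_gt0// addr_gt0.
pose ta : R := e^-1; pose g : R := odd_series (2 ^ N) 1 / 2.
have ta0 : 0 < ta by rewrite invr_gt0.
have g0 : 0 <= g by rewrite divr_ge0// odd_series_ge0.
pose Q := (1 + ta) / (2 * c).
have Q0 : 0 < Q by rewrite divr_gt0 ?addr_gt0// mulr_gt0.
have ge : 0 <= g / e := divr_ge0 g0 (ltW e0).
have qd : 0 <= 8 * Q / d := divr_ge0 (mulr_ge0 (ler0n R 8) (ltW Q0)) (ltW d0).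
exists (2 ^ N)%N, ta, (1 + g / e + 8 * Q / d); split => //.
- by rewrite expn_gt0.
- by rewrite -addrA lerDl addr_ge0.
move=> b hb.
have b1 : 1 <= b by lra.
have gb : g <= e * b by rewrite mulrC -ler_pdivrMr//; lra.
have Qb : 8 * Q <= d * b by rewrite [leRHS]mulrC -ler_pdivrMr//; lra.
have E : energy_bound (2 ^ N) ta b = Q * (b + g) ^+ 2 + (1 + e) / (6 * c) * (b + g) ^+ 3.
  rewrite /energy_bound -/g -/c /Q /ta; move: (b + g) => x.
  by field; rewrite !gt_eqF.
rewrite E.
have bg : b + g <= (1 + e) * b by lra.
have bg0 : 0 <= b + g by lra.
have bg2 : b + g <= 2 * b by nra.
have h1 : Q * (b + g) ^+ 2 <= d / 2 * b ^+ 3.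
  have : (b + g) ^+ 2 <= (2 * b) ^+ 2 by rewrite lerXn2r ?nnegrE//; lra.
  have : 0 <= b ^+ 2 by exact: sqr_ge0.
  rewrite (exprS b 2) exprMn; move: (b ^+ 2) ((b + g) ^+ 2) => u w.
  by move: Q0 Qb; nra.
have h2 : (1 + e) / (6 * c) <= (1 + e) ^+ 2 * c0.
  have -> : c0 = (6 * P)^-1.
    by rewrite /c0 PE; have p0 := @pi_gt0 R; move: (@pi R) p0 => p p0; field; rewrite gt_eqF.
  rewrite expr2 -!mulrA ler_pM2l ?addr_gt0// -[leLHS]mul1r.
  rewrite ler_pdivrMr ?mulr_gt0//.
  have hh : P <= c * (1 + e) by rewrite -ler_pdivrMr// addr_gt0.
  rewrite mulrAC -[leRHS]/(_ / (6 * P)) ler_pdivlMr ?mulr_gt0//.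
  by move: hh; lra.
have h3 : (b + g) ^+ 3 <= (1 + e) ^+ 3 * b ^+ 3.
  by rewrite -exprMn lerXn2r ?nnegrE// mulr_ge0//; lra.
have b3 : 0 <= b ^+ 3 by rewrite exprn_ge0//; lra.
have h4 : (1 + e) / (6 * c) * (b + g) ^+ 3 <= ((1 + e) ^+ 2 * c0) * ((1 + e) ^+ 3 * b ^+ 3).
  have q60 : 0 <= (1 + e) / (6 * c).
    exact: divr_ge0 (addr_ge0 ler01 (ltW e0)) (mulr_ge0 (ler0n R 6) (ltW cc0)).
  have g3 : 0 <= (b + g) ^+ 3 by rewrite exprn_ge0.
  exact: ler_pM q60 g3 h2 h3.
have h5 : (1 + e) ^+ 5 <= 1 + 31 * e by apply: pow_one_plus_le; rewrite (ltW e0) e1.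
have h6 : ((1 + e) ^+ 2 * c0) * ((1 + e) ^+ 3 * b ^+ 3) <= (c0 + d / 2) * b ^+ 3.
  rewrite (_ : _ * _ = (1 + e) ^+ 5 * c0 * b ^+ 3); last by ring.
  rewrite ler_wpM2r//; apply: le_trans (_ : (1 + 31 * e) * c0 <= _).
    by rewrite ler_pM2r.
  by move: c00 c01 ed e0; move: (c0) => C; nra.
move: h1 h4 h6; lra.
Qed.

(** For a nonincreasing sequence the maximum with [1] merely cuts the product after the last factor
    that is at least [1]. *)
Lemma prod_max1_le (u : nat -> R) (B : R) J :
  (forall j, 0 <= u j) -> (forall j, u j.+1 <= u j) ->
  (forall D, \prod_(j < D) u j <= B) -> \prod_(j < J) Num.max 1 (u j) <= B.
Proof.
move=> u0 ud uB.
have dec i j : (i <= j)%N -> u j <= u i.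
  by move=> /subnKC <-; elim: (j - i)%N => [|k IH]; rewrite ?addn0// addnS (le_trans (ud _)).
elim: J => [|J IH]; first by have := uB 0%N; rewrite !big_ord0.
have [h|h] := leP 1 (u J).
  apply: le_trans (uB J.+1); rewrite le_eqVlt; apply/orP; left; apply/eqP.
  by apply: eq_bigr => j _; rewrite max_r// (le_trans h)// dec// -ltnS.
by rewrite big_ord_recr /= max_l ?mulr1// ltW.
Qed.

Lemma sum_inv_sqr_le J : \sum_(j < J) (j.+1%:R ^+ 2)^-1 <= 2 :> R.
Proof.
case: J => [|J]; first by rewrite big_ord0.
suff h : \sum_(j < J.+1) (j.+1%:R ^+ 2)^-1 <= 2 - J.+1%:R^-1 :> R.
  by apply: le_trans h _; rewrite gerBl.
elim: J => [|J IH]; first by rewrite big_ord1 expr1n invr1; lra.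
rewrite big_ord_recr /=; apply: le_trans (lerD IH (lexx _)) _.
rewrite -(natr1 J.+1); have : 1 <= J.+1%:R :> R by rewrite ler1n.
move: (J.+1%:R : R) => x x1.
rewrite -subr_ge0 [leRHS](_ : _ = (x * (x + 1) ^+ 2)^-1); last first.
  by field; repeat (apply/andP; split); rewrite gt_eqF//; lra.
by rewrite invr_ge0 mulr_ge0 ?sqr_ge0//; lra.
Qed.

Section Heights.
Variables (n0 : nat) (ta b0 b r K1 : R) (y : nat -> R).
Hypothesis (n00 : (0 < n0)%N) (ta0 : 0 < ta) (b01 : 1 <= b0) (b0b : b0 <= b).
Hypothesis (K1_gt0 : 0 < K1) (K1E : 720 * (32 / 3) ^+ 6 <= K1).
Hypothesis (hE : forall b, b0 <= b -> energy_bound n0 ta b <= 2 * b ^+ 3).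
Hypothesis (r0 : 0 <= r) (r1 : r < 1) (yr : forall i, `|y i| <= r).
Hypothesis (ymax : forall j z, `|z| <= r -> residual y j z <= residual y j (y j)).

Let th := expR (artanh r - b).
Let M j := node_height y j.

Lemma node_height_nincr j : M j.+1 <= M j.
Proof.
have y1 i : `|y i| < 1 := le_lt_trans (yr i) r1.
rewrite /M /node_height ler_wsqrtr//; apply: le_trans (ymax j (yr _)).
exact: residual_nincr.
Qed.

(** The product bound is applied at the higher level [b + x], with [x] proportional to [sqrt j]. As
    heights are nonincreasing, it yields [u^(j + 1) <= exp (16 x^3)], and [j = 64 x^2] gives
    [u <= exp (x / 4)]. So [M j] is below [th] by a factor [exp (- 3 x / 4)], which beats any power
    of [j]. *)
Lemma node_height_decay j : 64 * b ^+ 2 <= j%:R -> M j <= K1 / j%:R ^+ 3 * th.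
Proof.
move=> bj.
have M0 i : 0 <= M i by exact: sqrtr_ge0.
have b1 : 1 <= b by apply: le_trans b0b.
have dec i k : (i <= k)%N -> M k <= M i.
  by move=> /subnKC <-; elim: (k - i)%N => [|u IH]; rewrite ?addn0// addnS (le_trans (node_height_nincr _)).
have j0 : 0 < j%:R :> R by apply: lt_le_trans bj; rewrite mulr_gt0// exprn_gt0//; lra.
have [x x0 x2] : exists2 x : R, 0 <= x & j%:R = 64 * x ^+ 2.
  exists (Num.sqrt j%:R / 8); first by rewrite divr_ge0// sqrtr_ge0.
  by rewrite expr_div_n sqr_sqrtr ?(ltW j0)//; field.
have bx : b <= x.
  rewrite -ler_sqr ?nnegrE//; last by lra.
  by move: bj; rewrite x2; lra.
pose u := M j * expR (b + x - artanh r).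
have u0 : 0 <= u by rewrite mulr_ge0// expR_ge0.
have hb : b0 <= b + x by rewrite (le_trans b0b)// lerDl.
have pw : u ^+ j.+1 <= expR (16 * x ^+ 3).
  apply: le_trans (_ : \prod_(i < j.+1) (M i * expR (b + x - artanh r)) <= _).
    rewrite -[j.+1 in leLHS]card_ord -prodr_const ler_prod// => i _.
    by rewrite u0 /= ler_pM2r ?expR_gt0// dec// -ltnS.
  have h' : 0 <= b + x by lra.
  apply: le_trans (node_height_prod_le j.+1 n00 ta0 h' r1 yr) _.
  rewrite ler_expR; apply: le_trans (hE hb) _.
  have h2 : (b + x) ^+ 3 <= (2 * x) ^+ 3 by rewrite lerXn2r ?nnegrE//; lra.
  by apply: le_trans (ler_wpM2l _ h2) _ => //; rewrite exprMn; lra.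
have ux : u <= expR (x / 4).
  rewrite -(@ler_pXn2r _ j.+1)// ?nnegrE ?expR_ge0//; apply: le_trans pw _.
  rewrite -expRM_natl ler_expR -(natr1 j) x2.
  have : 0 <= x ^+ 3 by rewrite exprn_ge0.
  by rewrite (_ : (64 * x ^+ 2 + 1) * (x / 4) = 16 * x ^+ 3 + x / 4); [lra|field].
have Mu : M j = u * (expR (- x) * th).
  by rewrite /u /th -mulrA -!expRD (_ : _ + (_ + _) = 0) ?expR0 ?mulr1//; ring.
rewrite Mu mulrA ler_pM2r ?expR_gt0//.
apply: le_trans (_ : expR (- (3 / 4 * x)) <= _).
  by apply: le_trans (ler_wpM2r (expR_ge0 _) ux) _; rewrite -expRD ler_expR; lra.
have z0 : 0 <= 3 / 4 * x by rewrite mulr_ge0// divr_ge0.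
have xp : 0 < x by apply: lt_le_trans bx; lra.
(* The constant in [K1E] comes from [e^z >= z^6 / 720] with [z = 3 x / 4] and [j^3 = (8 x)^6], the
   ratio of the bases being [32 / 3]. *)
rewrite expRN -[leRHS]invrK lef_pV2 ?posrE ?expR_gt0 ?invr_gt0 ?divr_gt0 ?exprn_gt0//.
apply: le_trans (expR_ge_pow6 z0).
rewrite invf_div ler_pdivrMr// x2.
have -> : (64 * x ^+ 2) ^+ 3 = (3 / 4 * x) ^+ 6 / 720 * (720 * (32 / 3) ^+ 6) :> R by field.
exact: ler_wpM2l (divr_ge0 (exprn_ge0 6 z0) (ler0n R 720)) _ _ K1E.
Qed.

Lemma node_height_tail J0 J : 64 * b ^+ 2 <= J0%:R ->
  \sum_(J0 <= j < J) 8 * j.+3%:R * M j <= 384 * K1 * th.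
Proof.
move=> bJ.
have b1 : 1 <= b by apply: le_trans b0b.
have J0p : 1 <= J0%:R :> R by apply: le_trans bJ; nra.
apply: le_trans (_ : \sum_(J0 <= j < J) 192 * K1 * th * (j.+1%:R ^+ 2)^-1 <= _).
  rewrite big_nat_cond [leRHS]big_nat_cond; apply: ler_sum => j; rewrite andbT => /andP[Jj _].
  have j1 : 1 <= j%:R :> R by apply: le_trans J0p _; rewrite ler_nat.
  have hj : 64 * b ^+ 2 <= j%:R by apply: le_trans bJ _; rewrite ler_nat.
  apply: le_trans (ler_wpM2l _ (node_height_decay hj)) _; first by rewrite mulr_ge0.
  have t0 : 0 <= th := expR_ge0 _.
  have -> : j.+3%:R = j%:R + 3 :> R by rewrite -natrD addn3.
  rewrite -(natr1 j); move: (j%:R : R) j1 => x x1.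
  rewrite -subr_ge0.
  have -> : 192 * K1 * th * ((x + 1) ^+ 2)^-1 - 8 * (x + 3) * (K1 / x ^+ 3 * th) =
     8 * K1 * th * ((x + 1) ^+ 2 * x ^+ 3)^-1 * (24 * x ^+ 3 - (x + 3) * (x + 1) ^+ 2).
    by field; repeat (apply/andP; split); rewrite gt_eqF//; lra.
  have x3 : 0 <= x ^+ 3 by rewrite exprn_ge0//; lra.
  have q0 : 0 <= ((x + 1) ^+ 2 * x ^+ 3)^-1 by rewrite invr_ge0 mulr_ge0 ?sqr_ge0.
  have q1 : 0 <= 8 * K1 * th := mulr_ge0 (mulr_ge0 (ler0n R 8) (ltW K1_gt0)) t0.
  apply: mulr_ge0; first exact: mulr_ge0.
  have h1 : x + 1 <= 2 * x by lra.
  have h2 : (x + 1) ^+ 2 <= (2 * x) ^+ 2 by rewrite lerXn2r ?nnegrE//; lra.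
  have h3 : (x + 3) * (x + 1) ^+ 2 <= (4 * x) * (2 * x) ^+ 2.
    by rewrite ler_pM ?sqr_ge0//; lra.
  by move: h3; rewrite exprMn (exprS x 2); move: x3; rewrite (exprS x 2); lra.
rewrite -mulr_sumr; apply: le_trans (_ : 192 * K1 * th * 2 <= _); last first.
  by rewrite le_eqVlt; apply/orP; left; apply/eqP; ring.
have q1 : 0 <= 192 * K1 * th := mulr_ge0 (mulr_ge0 (ler0n R 192) (ltW K1_gt0)) (expR_ge0 _).
apply: ler_wpM2l => //; apply: le_trans (sum_inv_sqr_le J).
have [JJ|JJ] := leqP J0 J; last by rewrite big_geq ?(ltnW JJ)// sumr_ge0.
rewrite -(big_mkord xpredT (fun j => (j.+1%:R ^+ 2)^-1 : R)) [leRHS](@big_cat_nat _ _ _ J0)//=.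
by rewrite lerDr sumr_ge0.
Qed.

(** Replacing [8 j u + 1] by a multiple of [max 1 u] separates the energy from a factor
    [exp (O (J0 ln J0))], which is negligible because [J0] will be of order [l^2]. *)
Lemma node_height_width_le J0 :
  \prod_(j < J0) (8 * j.+3%:R * M j / th + 1) <=
  (9 * (J0%:R + 3)) ^+ J0 * expR (energy_bound n0 ta b).
Proof.
have b1 : 1 <= b by apply: le_trans b0b.
have M0 i : 0 <= M i by exact: sqrtr_ge0.
have thV : th^-1 = expR (b - artanh r) by rewrite /th -expRN opprB.
apply: le_trans (_ : \prod_(j < J0) (9 * (J0%:R + 3) * Num.max 1 (M j / th)) <= _).
  apply: ler_prod => j _.
  have u0 : 0 <= M j / th by rewrite divr_ge0// expR_ge0.
  rewrite addr_ge0 ?mulr_ge0 ?invr_ge0 ?expR_ge0//= -[8 * _ * _ / _]mulrA.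
  have j3 : j.+3%:R <= J0%:R + 3 :> R by rewrite -natrD addn3 ler_nat !ltnS ltnW.
  have j30 : 1 <= j.+3%:R :> R by rewrite ler1n.
  set w := Num.max _ _.
  have w1 : 1 <= w by rewrite le_max lexx.
  have uw : M j / th <= w by rewrite le_max lexx orbT.
  move: (M j / th) u0 uw => u u0 uw.
  have h1 : j.+3%:R * u <= (J0%:R + 3) * w by rewrite ler_pM.
  have h2 : 1 <= (J0%:R + 3) * w by rewrite -[leLHS]mulr1 ler_pM//; lra.
  by lra.
rewrite big_split /= prodr_const card_ord ler_wpM2l ?exprn_ge0 ?mulr_ge0 ?addr_ge0//.
apply: (@prod_max1_le (fun j => M j / th)) => [j|j|D].
- by rewrite divr_ge0// expR_ge0.
- by rewrite ler_wpM2r ?invr_ge0 ?expR_ge0// node_height_nincr.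
rewrite thV; apply: node_height_prod_le => //; lra.
Qed.

End Heights.
End SmallBallLower.

Section SmallBallLowerBound.
Variable R : realType.

Let c0 : R := 4 / (3 * pi ^+ 2).

Lemma cubic_slack (c d l b : R) : 0 < c -> c <= 1 / 3 -> 0 < d -> d <= 1 ->
  0 <= l -> 0 <= b -> b <= (1 + d / 21) * l ->
  (c + d / 3) * b ^+ 3 <= (c + 2 * d / 3) * l ^+ 3.
Proof.
move=> c00 c01 d0 d1 l0 b0 b2.
have A4 : b ^+ 3 <= (1 + d / 3) * l ^+ 3.
  have : b ^+ 3 <= ((1 + d / 21) * l) ^+ 3 by rewrite lerXn2r ?nnegrE// mulr_ge0//; lra.
  rewrite exprMn => /le_trans; apply; rewrite ler_wpM2r ?exprn_ge0 ?l0//.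
  have [e eE] : exists e, e = d / 21 by eexists.
  rewrite -eE (_ : d / 3 = 7 * e); last by rewrite eE; field.
  have e0 : 0 <= e by lra.
  have e1 : e <= 1 by lra.
  have : e ^+ 2 <= e by nra.
  have : e ^+ 3 <= e by rewrite exprS; nra.
  by rewrite (_ : (1 + e) ^+ 3 = 1 + 3 * e + 3 * e ^+ 2 + e ^+ 3); [lra|ring].
apply: le_trans (ler_wpM2l _ A4) _; first by lra.
rewrite mulrA ler_wpM2r ?exprn_ge0 ?l0//.
by move: c01 c00; move: (c) => C; nra.
Qed.

Lemma cover_parameters (S b0 d : R) : 0 <= S -> 0 < d -> d <= 1 ->
  exists2 L : R, 1 <= L & forall l, L <= l -> exists (b : R) (J0 : nat),
  [/\ b0 <= b, 64 * b ^+ 2 <= J0%:R,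
      (J0%:R + S + 1) * (2 * expR (- b)) <= expR (- l) / 2 &
      4 * ((9 * (J0%:R + 3)) ^+ J0 * expR ((c0 + d / 3) * b ^+ 3)) <=
      expR ((c0 + d) * l ^+ 3)].
Proof.
move=> S0 d0 d1; have /andP[c00 c01] := c0_bounds R; move: c00 c01; rewrite -/c0; move: c0 => c c00 c01.
have [K KE] : exists K, K = 4 * (259 + S) by eexists.
have K1 : 1 <= K by lra.
have K0 : 0 < K by lra.
have lnK0 : 0 <= ln K by rewrite ln_ge0.
have [C1 C1E] : exists C1, C1 = ln K + 2 by eexists.
have C10 : 0 < C1 by lra.
have d21 : 0 < d / 21 by lra.
have [L1 L11 HL1] := ln_le_linear C10 d21.
have [u [u0 u9]] : exists u : R, 0 <= u /\ u = 2 * ln 50.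
  by exists (2 * ln 50); rewrite mulr_ge0 ?ln_ge0 ?ler1n.
have [C2 C2E] : exists C2 : R, C2 = 3 + 257 * u + 514 by eexists.
have C20 : 0 < C2 by lra.
have d3 : 0 < d / 3 by lra.
have [L2 L21 HL2] := ln_le_linear C20 d3.
exists (Num.max (Num.max L1 L2) b0); first by rewrite !le_max L11.
move=> l; rewrite !ge_max => /andP[/andP[lL1 lL2] lb0].
have l1 : 1 <= l by apply: le_trans lL1.
have l0 : 0 < l by lra.
have lnl : 0 <= ln l by rewrite ln_ge0.
have {HL1} h1 := HL1 _ lL1; have {HL2} h2 := HL2 _ lL2.
(* The surplus over [l] makes [e^(- b) = e^(- l) / (K l^2)], which compensates the [J0] errors of
   size [th], as [J0 <= 257 l^2]. *)
have [b bE] : exists b, b = l + ln K + 2 * ln l by eexists.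
have b2 : b <= (1 + d / 21) * l.
  by move: h1; rewrite C1E; move: (mulr_ge0 lnK0 lnl); lra.
have lb : l <= b by lra.
have bl2 : b <= 2 * l by apply: le_trans b2 _; rewrite ler_pM2r//; lra.
(* [256 l^2] is [64 (2 l)^2], and [b <= 2 l]. *)
have [J0 J0g J0l] : exists2 J0 : nat, 256 * l ^+ 2 <= J0%:R & J0%:R <= 257 * l ^+ 2.
  exists (Num.truncn (256 * l ^+ 2)).+1; first exact/ltW/truncnS_gt.
  have l20 : 0 <= 256 * l ^+ 2 by apply: mulr_ge0 (sqr_ge0 _); exact: ler0n.
  rewrite -(natr1 (Num.truncn _)).
  have : (Num.truncn (256 * l ^+ 2))%:R <= 256 * l ^+ 2 by rewrite truncn_le.
  have : 1 <= l ^+ 2 by rewrite exprn_ege1.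
  by lra.
have l21 : 1 <= l ^+ 2 by rewrite exprn_ege1.
exists b, J0; split; first exact: le_trans lb.
- clear KE C2E h1 h2 C1E u9.
  apply: le_trans J0g.
  have : b ^+ 2 <= (2 * l) ^+ 2 by rewrite lerXn2r ?nnegrE//; lra.
  by rewrite exprMn; lra.
- have -> : expR (- b) = expR (- l) / (K * l ^+ 2).
    rewrite (_ : - b = - l + - (ln K + 2 * ln l)); last by rewrite bE; ring.
    rewrite expRD (expRN (_ + _)); congr (_ / _).
    by rewrite expRD expRM_natl !lnK ?posrE.
  have q0 : 0 < K * l ^+ 2 by rewrite mulr_gt0// exprn_gt0.
  rewrite (_ : _ * (2 * _) = expR (- l) * ((J0%:R + S + 1) * 2 / (K * l ^+ 2))); last by ring.
  rewrite ler_pM2l ?expR_gt0// ler_pdivrMr// KE.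
  have : 0 <= S * (l ^+ 2 - 1) by rewrite mulr_ge0// subr_ge0.
  by lra.
clear KE C1E h1 bE K1 K0 lnK0.
have w0 : 0 < 9 * (J0%:R + 3) :> R by rewrite mulr_gt0// ltr_wpDl.
have -> : 4 = expR (ln 4) :> R by rewrite lnK ?posrE.
rewrite -[9 * _]lnK ?posrE// -expRM_natl -!expRD ler_expR.
have ln4 : ln 4 <= 3 :> R by have := @le_ln1Dx R 3; rewrite (_ : 1 + 3 = 4); [apply; lra|ring].
have lnw : ln (9 * (J0%:R + 3)) <= u + 2 * ln l.
  rewrite u9.
  have l50 : 0 < 50 * l by rewrite mulr_gt0.
  have -> : 2 * ln 50 + 2 * ln l = ln ((50 * l) ^+ 2).
    by rewrite lnXn// lnM ?posrE// mulr2n; ring.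
  by rewrite ler_ln ?posrE ?exprn_gt0// exprMn; lra.
have lnw0 : 0 <= ln (9 * (J0%:R + 3)) :> R.
  by rewrite ln_ge0//; have := ler0n R J0; lra.
have A1 : J0%:R * ln (9 * (J0%:R + 3)) <= 257 * l ^+ 2 * (u + 2 * ln l).
  by rewrite ler_pM.
have A2 : l ^+ 2 * (C2 * ln l + C2) <= l ^+ 2 * (d / 3 * l).
  by rewrite ler_wpM2l// sqr_ge0.
have A3 : 3 + 257 * l ^+ 2 * (u + 2 * ln l) <= l ^+ 2 * (C2 * ln l + C2).
  rewrite C2E.
  have : 0 <= u * ln l by rewrite mulr_ge0.
  have : 0 <= l ^+ 2 * (u * ln l) := mulr_ge0 (sqr_ge0 l) (mulr_ge0 u0 lnl).
  have : 0 <= l ^+ 2 * ln l := mulr_ge0 (sqr_ge0 l) lnl.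
  by move: (l ^+ 2) (ln l) l21 => p q p1; lra.
have A5 : (c + d / 3) * b ^+ 3 <= (c + 2 * d / 3) * l ^+ 3.
  by apply: cubic_slack; rewrite ?(ltW l0)//; apply: le_trans lb; exact: ltW.
rewrite (exprS l 2) in A5 *; move: A1 A2 A3 A5 ln4.
move: (J0%:R * _) (l ^+ 2) => X p; move: (_ * b ^+ 3) (ln 4) => Y Z.
by lra.
Qed.

Lemma expR_artanh (n : nat) : expR (artanh (n%:R / n.+1%:R : R)) = Num.sqrt (2 * n%:R + 1).
Proof.
have n1 : 0 < n%:R + 1 :> R by rewrite ltr_wpDl.
have -> : artanh (n%:R / n.+1%:R : R) = ln (2 * n%:R + 1) / 2.
  rewrite /artanh -natr1; congr (ln _ / 2).
  by field; repeat (apply/andP; split); rewrite gt_eqF//; lra.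
have h : 0 < 2 * n%:R + 1 :> R by rewrite ltr_wpDl// mulr_ge0.
apply/eqP; rewrite -(@eqrXn2 _ 2)// ?expR_ge0 ?sqrtr_ge0// sqr_sqrtr ?(ltW h)//.
by rewrite -expRM_natl mulrC mulfVK// lnK ?posrE.
Qed.

Lemma small_ball_lower (d : R) : 0 < d ->
  exists2 L, 1 <= L & forall l m, L <= l -> expR (8 * l) <= (4 * m)%:R ->
  expR (- ((c0 + d) * l ^+ 3)) <=
  sign_prob (4 * m) (fun s => forall x : R, `|x| <= 1 ->
    `|\sum_(k < 4 * m) s k * x ^+ k| <= expR (- l) * Num.sqrt (4 * m)%:R).
Proof.
move=> d0; have /andP[c00 c01] := c0_bounds R; rewrite -/c0 in c00 c01.
have [e [e0 e1 ed]] : exists e, [/\ 0 < e, e <= 1 & e <= d].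
  exists (Num.min 1 d); split; last by rewrite ge_min lexx orbT.
    by rewrite lt_min ltr01.
  by rewrite ge_min lexx.
have e3 : 0 < e / 3 by rewrite divr_gt0.
have [n0 [ta [b0 [n00 ta0 b01 hE]]]] := energy_bound_asymptotic e3.
have [K1 K1_gt0 K1E] : exists2 K1 : R, 0 < K1 & 720 * (32 / 3) ^+ 6 <= K1.
  exists (1 + 720 * (32 / 3) ^+ 6); last by rewrite lerDr.
  apply: ltr_wpDr ltr01.
  exact: mulr_ge0 (ler0n R 720) (exprn_ge0 6 (divr_ge0 (ler0n R 32) (ler0n R 3))).
have [S S0 SE] : exists2 S : R, 0 <= S & S = 384 * K1.
  have h : 0 <= 384 * K1 := mulr_ge0 (ler0n R 384) (ltW K1_gt0).
  by exists (384 * K1); first exact: h.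
have [L L1 HL] := cover_parameters b0 S0 e0 e1.
exists L => // l m Ll nl; have [b [J0 [b0b J0b hJ hP]]] := HL _ Ll.
have {HL} l1 : 1 <= l := le_trans L1 Ll.
have hE2 b' : b0 <= b' -> energy_bound n0 ta b' <= 2 * b' ^+ 3.
  move=> h; apply: le_trans (hE _ h) _; rewrite ler_wpM2r ?exprn_ge0//.
    by apply: le_trans h; apply: le_trans b01.
  by move: c01 e1; rewrite -/c0; move: (c0) => C; lra.
have m0 : (0 < m)%N.
  by case: (m) nl => //; rewrite muln0 leNgt expR_gt0.
have [n nE] : exists n, n = (4 * m)%N by eexists.
have n_gt0 : (0 < n)%N by rewrite nE muln_gt0.
have n_gt0R : 1 <= n%:R :> R by rewrite ler1n.
have r0 : 0 <= n%:R / n.+1%:R :> R by rewrite divr_ge0.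
have r1 : n%:R / n.+1%:R < 1 :> R by rewrite ltr_pdivrMr// mul1r ltr_nat.
have [y [yr ymax]] := @greedy_nodes R (n%:R / n.+1%:R) ltac:(by rewrite r0).
have [th thE] : exists th, th = expR (artanh (n%:R / n.+1%:R : R) - b) by eexists.
have th0 : 0 < th by rewrite thE expR_gt0.
have th2 : th <= 2 * Num.sqrt n%:R * expR (- b).
  rewrite thE expRD ler_pM2r ?expR_gt0// expR_artanh.
  have -> : 2 * Num.sqrt n%:R = Num.sqrt (2 ^+ 2 * n%:R) :> R.
    by rewrite sqrtrM ?sqr_ge0// sqrtr_sqr ger0_norm.
  by rewrite ler_wsqrtr// expr2; lra.
(* Large enough that the decay [K1 / J^3] outweighs the [2 m] terms of the remainder. *)
pose J := maxn J0 (Num.truncn (16 * m%:R * K1)).+1.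
have tailM : \sum_(J0 <= j < J) 8 * j.+3%:R * node_height y j <= S * th.
  by rewrite SE thE; exact: (node_height_tail n00 ta0 b01 b0b K1_gt0 K1E hE2 r1 yr ymax).
have lastM : 16 * m%:R * node_height y J <= th.
  have J0J : 64 * b ^+ 2 <= J%:R by apply: le_trans J0b _; rewrite ler_nat leq_maxl.
  have JK : 16 * m%:R * K1 <= J%:R.
    by apply: le_trans (ltW (truncnS_gt _)) _; rewrite ler_nat leq_maxr.
  have J1 : 1 <= J%:R :> R by rewrite ler1n /J leq_max orbT.
  have J3 : J%:R <= J%:R ^+ 3 :> R by rewrite ler_eXnr.
  have h16 : 0 <= 16 * m%:R :> R by rewrite mulr_ge0.
  have := node_height_decay n00 ta0 b01 b0b K1_gt0 K1E hE2 r1 yr ymax J0J.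
  rewrite -thE => /(ler_wpM2l h16)/le_trans; apply.
  rewrite !mulrA ler_piMl ?(ltW th0)// ler_pdivrMr ?mul1r ?exprn_gt0//; first exact: le_trans J3.
  by lra.
have := cover_prob m0 th0 (leq_maxl _ _) _ _ tailM lastM; rewrite -nE.
move=> /(_ yr ymax) hc.
apply: le_trans (le_trans _ hc) _.
- rewrite expRN lef_pV2 ?posrE ?expR_gt0//; last first.
    rewrite mulr_gt0// prodr_gt0// => j _.
    by rewrite ltr_wpDl// divr_ge0 ?(ltW th0)// !mulr_ge0 ?sqrtr_ge0.
  apply: le_trans (_ : expR ((c0 + e) * l ^+ 3) <= _); last first.
    by rewrite ler_expR ler_wpM2r ?exprn_ge0 ?lerD2l//; lra.
  apply: le_trans hP; rewrite ler_pM2l//.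
  have := node_height_width_le n00 ta0 b01 b0b r1 yr ymax J0.
  rewrite -thE => /le_trans; apply.
  rewrite ler_wpM2l ?exprn_ge0 ?mulr_ge0 ?addr_ge0// ler_expR; exact: hE.
apply: le_sign_prob => s _ + x x1 => /(_ x x1)/le_trans; apply.
have sn : expR (4 * l) <= Num.sqrt n%:R.
  rewrite -nE in nl; rewrite -[leLHS]ger0_norm ?expR_ge0// -sqrtr_sqr ler_wsqrtr//.
  by rewrite -expRM_natl mulrA -natrM.
(* The additive [2] of [cover_prob] is absorbed because [e^(- l) sqrt n >= e^(3 l)]. *)
have w2 : 2 <= expR (- l) / 2 * Num.sqrt n%:R.
  apply: le_trans (_ : expR (- l) / 2 * expR (4 * l) <= _); last first.
    by rewrite ler_wpM2l// divr_ge0// expR_ge0.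
  rewrite mulrAC -expRD ler_pdivlMr//.
  have := expR_ge1Dx (- l + 4 * l); lra.
have w3 : (J0%:R + S + 1) * th <= expR (- l) / 2 * Num.sqrt n%:R.
  apply: le_trans (ler_wpM2l _ th2) _; first by rewrite !addr_ge0.
  apply: le_trans (ler_wpM2r (sqrtr_ge0 n%:R) hJ).
  by rewrite le_eqVlt; apply/orP; left; apply/eqP; ring.
move: w2 w3; lra.
Qed.

End SmallBallLowerBound.

(** * Transfer to the probability space *)

Section OuterBound.
Context d (T : measurableType d) (R : realType) (P : probability T R).

(* Outer probability bounds: the events below need not be known to be measurable. *)
Definition dominated (E : set T) (p : R) :=
  exists A, [/\ measurable A, E `<=` A & (P A <= p%:E)%E].

Lemma dominatedS E F p q : E `<=` F -> p <= q -> dominated F p -> dominated E q.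
Proof.
move=> EF pq [A [mA FA PA]]; exists A; split => //; first exact: subset_trans FA.
by apply: le_trans PA _; rewrite lee_fin.
Qed.

Lemma dominatedU E F p q : dominated E p -> dominated F q -> dominated (E `|` F) (p + q).
Proof.
move=> [A [mA EA PA]] [B [mB FB PB]]; exists (A `|` B); split.
- exact: measurableU.
- exact: setUSS.
- by apply: le_trans (measureU2 _ _ _) _ => //; rewrite EFinD leeD.
Qed.

Lemma dominated0 p : 0 <= p -> dominated set0 p.
Proof. by move=> p0; exists set0; split=> //; rewrite measure0 lee_fin. Qed.

Lemma dominated_bigcup m (E : nat -> set T) (p : R) :
  (forall i, (i < m)%N -> dominated (E i) p) ->
  dominated [set w | exists2 i, (i < m)%N & E i w] (m%:R * p).
Proof.
elim: m => [|m IH] h.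
  by rewrite mul0r; apply: dominatedS (dominated0 (lexx 0)) => // w [].
have h1 : forall i, (i < m)%N -> dominated (E i) p by move=> i im; apply: h; rewrite ltnW.
rewrite -natr1 mulrDl mul1r; apply: dominatedS (dominatedU (IH h1) (h m (ltnSn m))) => //.
move=> w [i]; rewrite ltnS leq_eqVlt => /orP[/eqP ->|im] Ei; first by right.
by left; exists i.
Qed.

Lemma borel_cantelli (E : nat -> set T) (p : nat -> R) (C : R) :
  (forall i, 0 <= p i) -> (forall n, \sum_(0 <= i < n) p i <= C) ->
  (forall i, dominated (E i) (p i)) ->
  {ae P, forall w, exists N, forall i, (N <= i)%N -> ~ E i w}.
Proof.
move=> p0 pC /(_ _)/cid hE; pose A i := sval (hE i).
have mA i : measurable (A i) by rewrite /A; case: (hE i) => /= ? [].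
have EA i : E i `<=` A i by rewrite /A; case: (hE i) => /= ? [].
have PA i : (P (A i) <= (p i)%:E)%E by rewrite /A; case: (hE i) => /= ? [].
have sumA : (\sum_(n <oo) P (A n) < +oo)%E.
  apply: le_lt_trans (_ : (C%:E < +oo)%E); last exact: ltry.
  apply: lime_le; first exact: is_cvg_nneseries.
  apply: nearW => n; apply: le_trans (_ : ((\sum_(0 <= i < n) p i)%:E <= _)%E).
    by rewrite -sumEFin; apply: lee_sum.
  by rewrite lee_fin.
exists (lim_sup_set A); split.
- apply: bigcapT_measurable => n; exact: bigcup_measurable.
- exact: lim_sup_set_cvg0.
move=> w /= h n _; apply: contrapT => hn; apply: h; exists n => i ni Ei.
by apply: hn; exists i => //; exact: EA.
Qed.

(** The event that all [E i] with [i >= N] occur is contained in each of them, so its outer measure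
    is at most every late [p i], hence zero; the countable union over [N] is still null. *)
Lemma infinitely_often_ae (E : nat -> set T) (p : nat -> R) :
  (forall e, 0 < e -> exists N, forall i, (N <= i)%N -> p i <= e) ->
  (\forall i \near \oo, dominated (E i) (p i)) ->
  {ae P, forall w, forall N, exists2 i, (N <= i)%N & ~ E i w}.
Proof.
move=> plim [N0 _ hE].
apply/ae_foralln => N.
have /choice[A hA] : forall i, exists A, (N0 <= i)%N ->
    [/\ measurable A, E i `<=` A & (P A <= (p i)%:E)%E].
  move=> i; case: (leqP N0 i) => [/hE[A hA]|_]; first by exists A.
  by exists set0.
have mA i : (N0 <= i)%N -> measurable (A i) by move=> /hA[].
pose M := maxn N N0; pose B := \bigcap_(i in [set i | (M <= i)%N]) A i.
have N0M i : (M <= i)%N -> (N0 <= i)%N by apply: leq_trans; rewrite leq_maxr.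
have mB : measurable B.
  by apply: bigcap_measurable => [|i /N0M/mA//]; exists M => /=.
exists B; split => //.
- apply/eqP; rewrite eq_le measure_ge0 andbT; apply/lee_addgt0Pr => e e0; rewrite add0e.
  have [N1 h1] := plim _ e0.
  have iM : (M <= maxn M N1)%N by rewrite leq_maxl.
  have [m1 _ pA] := hA _ (N0M _ iM).
  apply: le_trans (_ : (P (A (maxn M N1)) <= _)%E).
    by apply: le_measure; rewrite ?inE// => w; exact.
  by apply: le_trans pA _; rewrite lee_fin h1// leq_maxr.
- move=> w /= h i iM; have [_ EA _] := hA _ (N0M _ iM); apply: EA.
  apply: contrapT => nE; apply: h; exists i => //.
  by apply: leq_trans iM; rewrite leq_maxl.
Qed.

End OuterBound.

(** * Rademacher sequences and finite sign averages *)

Section Rademacher.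
Context d (T : measurableType d) (R : realType) (P : probability T R).
Variable eps : nat -> {RV P >-> R}.
Hypothesis heps : iid_rademacher eps.

Definition is_sign_path (w : T) := forall k, eps k w = 1 \/ eps k w = -1.

(** The zero padding matches the sequences that [sign_avg] averages over. *)
Definition window (o n : nat) (w : T) (k : nat) : R :=
  if (k < n)%N then eps (o + k) w else 0.

Lemma window_cons o n w :
  window o n.+1 w = scons (eps o w) (window o.+1 n w).
Proof.
by apply/funext => -[|k]; rewrite /window /= ?addn0// ltnS addnS addSn.
Qed.

Lemma measurable_eps_eq k (c : R) : measurable [set w | eps k w = c].
Proof.
by rewrite (_ : [set w | _] = eps k @^-1` [set c]).
Qed.

Lemma cylinder_prob o n (c : nat -> R) : (forall k, c k = 1 \/ c k = -1) ->
  P [set w | forall k, (o <= k < o + n)%N -> eps k w = c k] = ((2^-1) ^+ n)%:E.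
Proof.
move=> hc; have [indep rad] := heps.
pose J : {fset nat} := seq_fset tt (index_iota o (o + n)).
have := indep J (fun i => [set c i]) (fun i => measurable_set1 _).
have -> : \bigcap_(i in [set` J]) (eps i @^-1` [set c i]) =
    [set w | forall k, (o <= k < o + n)%N -> eps k w = c k].
  apply/seteqP; split => w /= h k hk; first by apply: h; rewrite /= seq_fsetE mem_index_iota.
  by apply: h; move: hk; rewrite /= seq_fsetE mem_index_iota.
move=> ->; rewrite (eq_bigr (fun=> (2^-1)%:E)); last first.
  by move=> i _; have [h1 h2] := rad i; case: (hc i) => ->.
rewrite (perm_big _ (seq_fset_perm _ _)) undup_id ?iota_uniq//.
by rewrite prodEFin prodr_const_nat addKn.
Qed.

Lemma sign_path_ae : exists N, [/\ measurable N, P N = 0%E &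
  forall w, ~ N w -> is_sign_path w].
Proof.
have [_ rad] := heps.
pose B k := [set w | eps k w = 1] `|` [set w | eps k w = -1].
have mB k : measurable (B k) by apply: measurableU; exact: measurable_eps_eq.
have PB k : P (~` B k) = 0%E.
  rewrite probability_setC// measureU//; try exact: measurable_eps_eq.
    have [h1 h2] := rad k.
    apply: (@etrans _ _ (1 - ((2^-1)%:E + (2^-1)%:E))%E).
      by congr (1 - (_ + _))%E; [exact: h1|exact: h2].
    have -> : ((2^-1)%:E + (2^-1)%:E = 1 :> \bar R)%E by rewrite -EFinD; congr EFin; lra.
    by rewrite subee.
  by apply/seteqP; split => w //= [e1 e2]; move: e2; rewrite e1; lra.
have nB k : P.-negligible (~` B k).
  by exists (~` B k); split => //; exact: measurableC.
have [N [mN PN BN]] := negligible_bigcup nB.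
exists N; split => // w Nw k; apply: contrapT => h; apply: Nw; apply: BN; exists k => //.
Qed.

(** The first [k] signs are prescribed by [c]; each induction step moves one sign from the window
    into the prefix, mirroring the recursion of [sign_avg]. The covering set is thus a finite union
    of cylinders, whatever [Q] is. *)
Lemma window_prefix_dominated n o k (c : nat -> R) (Q : (nat -> R) -> Prop) :
  (forall i, c i = 1 \/ c i = -1) ->
  exists A, [/\ measurable A,
    (forall w, is_sign_path w -> (forall i, (o <= i < o + k)%N -> eps i w = c i) ->
       Q (window (o + k) n w) -> A w) &
    (P A <= ((2^-1) ^+ k * sign_prob n Q)%:E)%E].
Proof.
elim: n k c Q => [|n IH] k c Q hc.
  pose C := [set w | forall i, (o <= i < o + k)%N -> eps i w = c i].
  have mC : measurable C.
    rewrite (_ : C = \bigcap_(i in [set i | (o <= i < o + k)%N]) [set w | eps i w = c i])//.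
    have [->|k0] := posnP k.
      rewrite (_ : [set i | _] = set0) ?bigcap_set0//.
      by apply/seteqP; split => i //=; rewrite addn0; case: ltngtP.
    apply: bigcap_measurable => [|i _]; last exact: measurable_eps_eq.
    by exists o => /=; rewrite leqnn -[ltnLHS]addn0 ltn_add2l.
  rewrite /sign_prob /=; have w0 w : window (o + k) 0 w = fun=> 0 by [].
  case: (asboolP (Q (fun=> 0))) => q0.
    by exists C; split => [//|w _ //|]; rewrite mulr1 cylinder_prob.
  by exists set0; split=> [//|w _ _|]; rewrite ?w0// mulr0 measure0.
pose c1 (a : R) i := if i == (o + k)%N then a else c i.
have hc1 a : a = 1 \/ a = -1 -> forall i, c1 a i = 1 \/ c1 a i = -1.
  by move=> ha i; rewrite /c1; case: eqP.
have [A1 [m1 h1 p1]] := IH k.+1 (c1 1) (Q \o scons 1) (hc1 _ (or_introl erefl)).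
have [A2 [m2 h2 p2]] := IH k.+1 (c1 (-1)) (Q \o scons (-1)) (hc1 _ (or_intror erefl)).
exists (A1 `|` A2); split; first exact: measurableU.
- move=> w hw hcw; rewrite window_cons -addnS => q.
  have ext a : eps (o + k)%N w = a ->
      forall i, (o <= i < o + k.+1)%N -> eps i w = c1 a i.
    move=> ha i; rewrite addnS ltnS /c1; case: eqP => [->//|/eqP ik] /andP[oi ik'].
    by apply: hcw; rewrite oi ltn_neqAle ik.
  case: (hw (o + k)%N) => e.
    by left; apply: h1 => //; [exact: ext|rewrite /= -e].
  by right; apply: h2 => //; [exact: ext|rewrite /= -e].
- apply: le_trans (measureU2 _ m1 m2) _; apply: le_trans (leeD p1 p2) _.
  rewrite -EFinD lee_fin /sign_prob /= exprS le_eqVlt; apply/orP; left; apply/eqP.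
  by rewrite /sign_prob /=; set u := sign_avg _ _; set v := sign_avg _ _; field.
Qed.

Lemma window_dominated o n (Q : (nat -> R) -> Prop) p : sign_prob n Q <= p ->
  dominated P [set w | Q (window o n w)] p.
Proof.
move=> hp; have [N [mN PN hN]] := sign_path_ae.
have [A [mA hA pA]] := @window_prefix_dominated n o 0 (fun=> 1) Q (fun=> or_introl erefl).
exists (A `|` N); split; first exact: measurableU.
- move=> w /= q; have [Nw|Nw] := pselect (N w); first by right.
  left; apply: hA => //; first exact: hN.
    by move=> i; rewrite addn0; case: ltngtP.
  by rewrite addn0.
- have PN0 : (P N <= 0)%E by rewrite PN.
  apply: le_trans (measureU2 _ mA mN) _; apply: le_trans (leeD pA PN0) _.
  by rewrite adde0 expr0 mul1r lee_fin.
Qed.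

End Rademacher.

(** * The limit inferior *)

Section DyadicBlock.
Context d (T : measurableType d) (R : realType) (P : probability T R).
Variable eps : nat -> {RV P >-> R}.
Hypothesis heps : iid_rademacher eps.

Let c0 : R := 4 / (3 * pi ^+ 2).

Lemma dyadic_bracket (x : R) : 1 <= x -> exists k, x <= (2 ^ k)%:R <= 2 * x.
Proof.
move=> x1; have x0 : 0 <= x by lra.
pose n := Num.truncn x; exists (trunc_log 2 n).+1.
have n0 : (0 < n)%N by rewrite truncn_gt0.
have /andP[h1 h2] := trunc_log_bounds (ltnSn 1) n0.
have nx : n%:R <= x by rewrite truncn_le.
have xn : x < n.+1%:R := truncnS_gt x.
apply/andP; split; first by apply: le_trans (ltW xn) _; rewrite ler_nat.
by rewrite expnS natrM ler_pM2l// (le_trans _ nx)// ler_nat.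
Qed.

Lemma window_sum o n w k (x : R) : (k <= n)%N ->
  \sum_(i < k) window eps o n w i * x ^+ i = \sum_(i < k) eps (o + i)%N w * x ^+ i.
Proof.
move=> kn; apply: eq_bigr => i _; congr (_ * _).
by rewrite /window (leq_trans (ltn_ord i) kn).
Qed.

Lemma eps_sum_split a b w (x : R) :
  \sum_(k < a + b) eps k w * x ^+ k =
  \sum_(k < a) eps k w * x ^+ k + x ^+ a * \sum_(k < b) eps (a + k)%N w * x ^+ k.
Proof.
rewrite big_split_ord /=; congr (_ + _); rewrite mulr_sumr; apply: eq_bigr => k _.
by rewrite exprD; ring.
Qed.

Lemma norm_pow_le1 (x : R) n : `|x| <= 1 -> `|x ^+ n| <= 1.
Proof. by move=> x1; rewrite normrX exprn_ile1. Qed.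

Lemma expR_dominates_cube (l : R) : 20 <= l -> 4 * expR (- (expR (2 * l) / 2)) <= expR (- (c0 * l ^+ 3)).
Proof.
move=> l5; have /andP[c00 c01] := c0_bounds R; rewrite -/c0 in c00 c01.
have e4 : 4 <= expR 3 :> R by have := expR_ge1Dx (3 : R); lra.
apply: le_trans (_ : expR 3 * expR (- (expR (2 * l) / 2)) <= _).
  by rewrite ler_pM2r ?expR_gt0.
rewrite -expRD ler_expR.
have l3 : 20 <= l ^+ 3 by rewrite (le_trans l5)// ler_eXnr// (le_trans _ l5)// ler1n.
have h : l / 2 * (l / 2) ^+ 3 <= expR (2 * l).
  rewrite -exprS (_ : 2 * l = 4%:R * (l / 2)); last by lra.
  rewrite expRM_natl lerXn2r ?nnegrE ?expR_ge0//; first by lra.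
  by have := expR_ge1Dx (l / 2); lra.
rewrite expr_div_n in h; move: (expR (2 * l)) (l ^+ 3) l3 h => E p p1 h.
have h2 : 5 / 4 * p <= E.
  apply: le_trans h; rewrite (_ : 2 ^+ 3 = 8); last by rewrite -natrX.
  by rewrite (_ : l / 2 * (p / 8) = l / 16 * p); [rewrite ler_wpM2r; lra|field].
have : c0 * p <= 1 / 3 * p by rewrite ler_wpM2r//; lra.
by lra.
Qed.

(** If a polynomial in the stretch after [a * M] is small, then either the one with [a * M] terms is
    at most [e^(2 - l) sqrt (a M)], where [2 + 1 <= e^2] gives the exponent [2], or the next signs,
    at most [M] of them, contribute exceptionally much. Their typical size is
    [sqrt M <= e^(- 2 l) sqrt (a M)], so this has doubly exponentially small probability. *)
Lemma grid_point_dominated (dl : R) : 0 < dl -> exists2 L, 1 <= L &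
  forall l a M, L <= l -> expR (8 * l) <= (a * M)%:R -> (0 < M)%N -> expR (4 * l) <= a%:R ->
  dominated P [set w | exists b, [/\ (b <= M)%N, (a * M + b <= 4 * (a * M))%N &
      forall x : R, `|x| <= 1 -> `|\sum_(k < a * M + b) eps k w * x ^+ k| <=
         expR (- l) * Num.sqrt (a * M + b)%:R]]
    (2 * expR (- ((c0 - dl) * l ^+ 3))).
Proof.
move=> d0; have [L L1 HL] := @small_ball_upper R dl 2 d0 (ler0n R 2).
exists (Num.max L 20); first by rewrite le_max L1.
move=> l a M; rewrite ge_max => /andP[lL l5] aM M0 al.
have t0 : 0 <= expR (- l) * Num.sqrt (a * M)%:R.
  by rewrite mulr_ge0 ?expR_ge0 ?sqrtr_ge0.
have M0R : 0 < M%:R :> R by rewrite ltr0n.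
have h1 := HL l (a * M)%N lL aM.
have h2 := poly_sup_tail t0 M0.
have {}h2 : 4 * expR (- ((expR (- l) * Num.sqrt (a * M)%:R) ^+ 2 / (2 * M%:R)))
    <= expR (- ((c0 - dl) * l ^+ 3)).
  apply: le_trans (_ : 4 * expR (- (expR (2 * l) / 2)) <= _).
    rewrite ler_pM2l// ler_expR lerN2 exprMn sqr_sqrtr// natrM -expRM_natl.
    rewrite [leRHS](_ : _ = expR (2 * - l) * a%:R / 2); last first.
      by field; rewrite gt_eqF.
    rewrite ler_pM2r//; apply: le_trans (ler_wpM2l (expR_ge0 _) al).
    by rewrite -expRD ler_expR; lra.
  apply: le_trans (expR_dominates_cube l5) _; rewrite ler_expR lerN2 ler_wpM2r//.
    by rewrite exprn_ge0//; lra.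
  by rewrite gerBl ltW.
have D1 := window_dominated heps 0 h1.
have D2 := window_dominated heps (a * M) (le_trans (poly_sup_tail t0 M0) h2).
rewrite (_ : 2 * _ = expR (- ((c0 - dl) * l ^+ 3)) + expR (- ((c0 - dl) * l ^+ 3))); last by ring.
apply: dominatedS (dominatedU D1 D2) => // w /= [b [bM bM4 hb]].
have [h|h] := pselect (exists2 k, (k <= M)%N & exists2 x : R, `|x| <= 1 &
   expR (- l) * Num.sqrt (a * M)%:R < `|\sum_(i < k) window eps (a * M) M w i * x ^+ i|).
  by right.
left => x x1; rewrite window_sum//.
under eq_bigr do rewrite add0n.
have hq : `|\sum_(i < b) eps (a * M + i)%N w * x ^+ i| <= expR (- l) * Num.sqrt (a * M)%:R.
  rewrite -(@window_sum _ M)// leNgt; apply/negP => hlt; apply: h.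
  by exists b => //; exists x.
have := hb x x1; rewrite eps_sum_split => hs.
apply: le_trans (_ : expR (- l) * Num.sqrt (a * M + b)%:R + expR (- l) * Num.sqrt (a * M)%:R <= _).
  apply: le_trans (lerD hs hq); set u := \sum_(k < a * M) _; set v := \sum_(i < b) _.
  rewrite -[in leLHS](addrK (x ^+ (a * M) * v) u).
  apply: le_trans (ler_normB _ _) _; rewrite lerD2l normrM ler_piMl//.
  exact: norm_pow_le1.
have sq : Num.sqrt (a * M + b)%:R <= 2 * Num.sqrt (a * M)%:R :> R.
  apply: le_trans (_ : Num.sqrt (2 ^+ 2 * (a * M)%:R) <= _).
    by rewrite ler_wsqrtr// -natrX -natrM ler_nat.
  by rewrite sqrtrM ?sqr_ge0// sqrtr_sqr ger0_norm.
rewrite expRD; have e2 : 3 <= expR 2 :> R by have := expR_ge1Dx (2 : R); lra.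
have e0 := expR_ge0 (- l); have s0 := sqrtr_ge0 ((a * M)%:R : R).
have h3 : expR (- l) * Num.sqrt (a * M + b)%:R <= expR (- l) * (2 * Num.sqrt (a * M)%:R).
  by rewrite ler_wpM2l.
have h4 : 3 * (expR (- l) * Num.sqrt (a * M)%:R) <= expR 2 * (expR (- l) * Num.sqrt (a * M)%:R).
  by rewrite ler_wpM2r.
by move: h3 h4; lra.
Qed.

(** The grid has step [2 ^ (j - k)] with [2 ^ k] of order [e^(4 l)], as [grid_point_dominated] asks;
    the number of grid points is only exponential in [l] and disappears in [dl l^3 / 2]. *)
Lemma dyadic_block_dominated (dl : R) : 0 < dl -> exists2 L, 1 <= L &
  forall l j, L <= l -> expR (8 * l) <= (2 ^ j)%:R ->
  dominated P [set w | exists2 N, (2 ^ j <= N <= 2 ^ j.+1)%N &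
      forall x : R, `|x| <= 1 -> `|\sum_(k < N) eps k w * x ^+ k| <=
         expR (- l) * Num.sqrt N%:R]
    (expR (- ((c0 - dl) * l ^+ 3))).
Proof.
move=> d0; have d2 : 0 < dl / 2 by lra.
have [L L1 HL] := grid_point_dominated d2.
have q0 : 0 <= 18 / dl by rewrite divr_ge0// ltW.
exists (L + 18 / dl); first by lra.
move=> l j lL hj.
have l1 : 1 <= l by lra.
have [k /andP[k1 k2]] := @dyadic_bracket (expR (4 * l)) ltac:(by rewrite -[leLHS]expR0 ler_expR; lra).
have kj : (k <= j)%N.
  rewrite -(leq_exp2l _ _ (ltnSn 1)) -(ler_nat R); apply: le_trans k2 (le_trans _ hj).
  rewrite (_ : 8 * l = 4 * l + 4 * l); last by lra.
  by rewrite expRD ler_pM2r ?expR_gt0//; have := expR_ge1Dx (4 * l); lra.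
pose M := (2 ^ (j - k))%N.
have M0 : (0 < M)%N by rewrite expn_gt0.
have kM : (2 ^ k * M = 2 ^ j)%N by rewrite -expnD subnKC.
pose Ev a := [set w | exists b, [/\ (b <= M)%N, (a * M + b <= 4 * (a * M))%N &
      forall x : R, `|x| <= 1 -> `|\sum_(k < a * M + b) eps k w * x ^+ k| <=
         expR (- l) * Num.sqrt (a * M + b)%:R]].
have D a' : (a' < (2 ^ k).+1)%N ->
    dominated P (Ev (2 ^ k + a')%N) (2 * expR (- ((c0 - dl / 2) * l ^+ 3))).
  move=> _; apply: HL => //; first by lra.
    by apply: le_trans hj _; rewrite ler_nat mulnDl kM leq_addr.
  by apply: le_trans k1 _; rewrite ler_nat leq_addr.
apply: dominatedS (dominated_bigcup D).
  move=> w /= [N /andP[N1 N2] hN].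
  have Na : (2 ^ k <= N %/ M)%N by rewrite leq_divRL// kM.
  have Nb : (N %/ M <= 2 ^ k.+1)%N.
    by rewrite -(leq_pmul2r M0) expnS -mulnA kM -expnS (leq_trans (leq_divM _ _)).
  exists (N %/ M - 2 ^ k)%N.
    by rewrite ltnS leq_subLR addnn -mul2n -expnS.
  rewrite subnKC//; exists (N %% M)%N; rewrite -divn_eq; split => //.
    exact/ltnW/ltn_pmod.
  have h1 : (2 ^ j <= N %/ M * M)%N by rewrite -kM leq_mul2r Na orbT.
  apply: leq_trans N2 _; rewrite expnS (leq_trans (leq_mul (leqnn 2) h1))//.
  by rewrite leq_mul2r orbT.
have e5 : 6 <= expR 5 :> R by have := expR_ge1Dx (5 : R); lra.
have E1 : 1 <= expR (4 * l) by rewrite -[leLHS]expR0 ler_expR; lra.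
apply: le_trans (_ : 3 * expR (4 * l) * (2 * expR (- ((c0 - dl / 2) * l ^+ 3))) <= _).
  by rewrite ler_pM2r ?mulr_gt0 ?expR_gt0// -natr1; lra.
apply: le_trans (_ : expR 5 * expR (4 * l) * expR (- ((c0 - dl / 2) * l ^+ 3)) <= _).
  rewrite [leLHS](_ : _ = 6 * expR (4 * l) * expR (- ((c0 - dl / 2) * l ^+ 3))); last by ring.
  by rewrite !ler_pM2r ?expR_gt0.
rewrite -!expRD ler_expR.
suff : 9 * l <= dl / 2 * l ^+ 3.
  by rewrite (_ : (c0 - dl / 2) * l ^+ 3 = (c0 - dl) * l ^+ 3 + dl / 2 * l ^+ 3); [lra|field].
have h : 18 <= l * dl by rewrite -ler_pdivrMr//; lra.
rewrite exprS expr2; have : 9 * l * l <= dl / 2 * l * (l * l) by nra.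
by nra.
Qed.

End DyadicBlock.

(** * Lower bound on the limit inferior *)

Section LowerBoundLiminf.
Variable R : realType.

Definition cbrt (x : R) : R := x `^ 3^-1.

Lemma cbrtK x : 0 <= x -> cbrt x ^+ 3 = x.
Proof. by move=> x0; rewrite -powR_mulrn ?powR_ge0// -powRrM mulVf// powRr1. Qed.

Lemma cbrt_ge0 x : 0 <= cbrt x.
Proof. exact: powR_ge0. Qed.

Lemma ler_cbrt x y : 0 <= x -> x <= y -> cbrt x <= cbrt y.
Proof.
by move=> x0 xy; apply: ge0_ler_powR; rewrite ?invr_ge0// nnegrE// (le_trans x0).
Qed.

Lemma ln2_bounds : 1 / 2 <= ln (2 : R) <= 1.
Proof.
have /andP[_ e4] := expR1_bounds R.
have l2 : ln 2 <= 1 :> R by have := @le_ln1Dx R 1; rewrite (_ : 1 + 1 = 2) => [|//]; apply; lra.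
rewrite l2 andbT -ler_expR lnK ?posrE//.
rewrite -(@ler_pXn2r _ 2)// ?nnegrE ?expR_ge0// -expRM_natl.
by rewrite (_ : 2%:R * (1 / 2) = 1); [apply: le_trans e4 _; rewrite -natrX|field].
Qed.

Lemma expR_natM_ln2 n : expR (n%:R * ln 2) = (2 ^ n)%:R :> R.
Proof. by rewrite expRM_natl lnK ?posrE// natrX. Qed.

Lemma pow2_dominates (A : R) : exists I, forall i, (I <= i)%N -> A * i%:R <= (2 ^ i)%:R.
Proof.
have /andP[l2 _] := ln2_bounds.
exists (Num.truncn (8 * `|A|)).+1 => i Ii.
have Ai : 8 * `|A| <= i%:R by apply: le_trans (ltW (truncnS_gt _)) _; rewrite ler_nat.
have i0 : 0 <= i%:R :> R by [].
have h : i%:R * (1 / 2) <= i%:R * ln 2 := ler_wpM2l i0 l2.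
rewrite -expR_natM_ln2.
apply: le_trans (_ : expR (i%:R / 2) <= _); last by rewrite ler_expR; lra.
have i2 : 0 <= i%:R / 2 :> R by lra.
apply: le_trans (expR_ge_quad i2).
have : A * i%:R <= `|A| * i%:R by rewrite ler_wpM2r// ler_norm.
move: (i%:R : R) (`|A|) i0 Ai => x B x0 Bx.
by nra.
Qed.

Lemma geometric_sum_le (C q : R) n : 0 <= C -> 0 < q < 1 ->
  \sum_(0 <= i < n) C * q ^+ i <= C / (1 - q).
Proof.
move=> C0 /andP[q0 q1].
by have := @geometric_le_lim R n C q C0 q0; rewrite gtr0_norm// => /(_ q1).
Qed.

Lemma lnln_ge (n i : nat) : (2 ^ 2 ^ i.+1 <= n)%N -> i%:R * ln 2 <= ln (ln n%:R) :> R.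
Proof.
move=> h; have /andP[l2 _] := ln2_bounds.
have h1 : (2 ^ i.+1)%:R * ln 2 <= ln n%:R :> R.
  rewrite -ler_expR expR_natM_ln2 lnK ?posrE ?ler_nat//.
  by rewrite ltr0n; apply: leq_trans h; rewrite expn_gt0.
have h2 : (2 ^ i)%:R <= ln n%:R :> R.
  apply: le_trans h1; rewrite expnS natrM; have : 0 <= (2 ^ i)%:R :> R by [].
  by nra.
have h0 : 0 < (2 ^ i)%:R :> R by rewrite ltr0n expn_gt0.
by rewrite -ler_expR expR_natM_ln2 lnK ?posrE// (lt_le_trans h0).
Qed.

Context d (T : measurableType d) (P : probability T R).
Variable eps : nat -> {RV P >-> R}.
Hypothesis heps : iid_rademacher eps.

Let c0 : R := 4 / (3 * pi ^+ 2).
Let cb : R := 3 * pi ^+ 2 / 4.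

Lemma sup_norm_lower_ae (rho : R) : 1 < rho ->
  {ae P, forall w, exists N, forall n, (N <= n)%N ->
    ~ (forall x : R, `|x| <= 1 -> `|\sum_(k < n.+1) eps k w * x ^+ k| <=
      expR (- (rho * cbrt cb * cbrt (ln (ln n%:R)))) * Num.sqrt n%:R)}.
Proof.
move=> r1; have r0 : 0 < rho by lra.
have /andP[l2 l2'] := ln2_bounds.
have /andP[p4 p16] := pi_sqr_bounds R.
have cb0 : 0 < cb by rewrite /cb; lra.
have c0b : c0 * cb = 1.
  by rewrite /c0 /cb; have p0 := @pi_gt0 R; move: (@pi R) p0 => p p0; field; rewrite gt_eqF.
have c00 : 0 < c0 by have /andP[] := c0_bounds R.
have r3 : 1 < rho ^+ 3 by rewrite exprn_egt1.
(* Strictly between [1] and [rho ^+ 3]. By [cost] a dyadic block at level [i] has probability at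
   most [2^(- s i)]; a level has [2^(i + 1)] blocks, so the sum over levels converges. *)
have [s sE] : exists s, s = (1 + rho ^+ 3) / 2 by eexists.
have s1 : 1 < s by lra.
have d0 : 0 < c0 * (1 - s / rho ^+ 3).
  by rewrite mulr_gt0// subr_gt0 ltr_pdivrMr; lra.
have [L L1 HL] := dyadic_block_dominated heps d0.
(* The threshold of level [i] has [i ln 2] in place of [ln (ln n)]; by [lnln_ge] this is the smaller
   value for all degrees of the level. *)
pose ell (i : nat) := rho * cbrt cb * cbrt (i%:R * ln 2).
have ell3 i : ell i ^+ 3 = rho ^+ 3 * cb * (i%:R * ln 2).
  rewrite /ell !exprMn !cbrtK ?(ltW cb0)// mulr_ge0//; lra.
have ell0 i : 0 <= ell i by rewrite !mulr_ge0 ?cbrt_ge0// ltW.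
have cost i : (c0 - c0 * (1 - s / rho ^+ 3)) * ell i ^+ 3 = s * ln 2 * i%:R.
  rewrite ell3 (_ : _ * _ = (c0 * cb) * s * ln 2 * i%:R * (rho ^+ 3 / rho ^+ 3)); last by ring.
  by rewrite c0b divff ?gt_eqF// ?mul1r ?mulr1//; lra.
have [I1 HI1] := pow2_dominates (16 * (rho ^+ 3 * cb)).
have [I2 HI2] : exists I, forall i, (I <= i)%N -> L <= ell i.
  have q0 : 0 < rho ^+ 3 * cb by rewrite mulr_gt0//; lra.
  exists (Num.truncn (2 * (L ^+ 3 / (rho ^+ 3 * cb)))).+1 => i Ii.
  have L0 : 0 <= L by lra.
  rewrite -(@ler_pXn2r _ 3)// ?nnegrE ?ell0// ell3 mulrC -ler_pdivrMr//.
  have h : 2 * (L ^+ 3 / (rho ^+ 3 * cb)) <= i%:R.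
    by apply: le_trans (ltW (truncnS_gt _)) _; rewrite ler_nat.
  by have i0 : 0 <= i%:R :> R by []; move: h; move: (_ / _) (i%:R : R) i0 => X Y Y0 h; nra.
have [I [II1 II2]] : exists I, (I1 <= I /\ I2 <= I)%N.
  by exists (maxn I1 I2); rewrite leq_maxl leq_maxr.
have small i : (I <= i)%N -> expR (8 * ell i) <= (2 ^ 2 ^ i)%:R.
  move=> Ii; rewrite -expR_natM_ln2 ler_expR.
  have Le := HI2 i (leq_trans II2 Ii).
  have le3 : ell i <= ell i ^+ 3 by rewrite ler_eXnr//; lra.
  have h1 := HI1 i (leq_trans II1 Ii).
  have h2 : ell i ^+ 3 <= rho ^+ 3 * cb * i%:R.
    have q0 : 0 <= rho ^+ 3 * cb by rewrite mulr_ge0 ?(ltW cb0)// exprn_ge0// ltW.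
    by rewrite ell3; apply: (ler_wpM2l q0); rewrite ler_piMr.
  have h3 : 8 * ell i <= (2 ^ i)%:R * (1 / 2) by move: h1 h2 le3; lra.
  by apply: le_trans h3 _; rewrite ler_wpM2l//; lra.
pose Ev i := [set w | (I <= i)%N /\ exists2 j, (j < 2 ^ i.+1)%N &
  exists2 N, (2 ^ (2 ^ i.+1 + j) <= N <= 2 ^ (2 ^ i.+1 + j).+1)%N &
      forall x : R, `|x| <= 1 -> `|\sum_(k < N) eps k w * x ^+ k| <=
         expR (- ell i) * Num.sqrt N%:R].
have q1 : 0 < expR (- ((s - 1) * ln 2)) < 1.
  rewrite expR_gt0 /= -[ltRHS]expR0 ltr_expR oppr_lt0 mulr_gt0//; lra.
have dom i : dominated P (Ev i) (2 * expR (- ((s - 1) * ln 2)) ^+ i).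
  have q0 : 0 <= 2 * expR (- ((s - 1) * ln 2)) ^+ i.
    by rewrite mulr_ge0// exprn_ge0// expR_ge0.
  have [Ii|Ii] := leqP I i; last first.
    by apply: dominatedS (dominated0 _ q0) => // w []; rewrite leqNgt Ii.
  have D (j : nat) : (j < 2 ^ i.+1)%N -> dominated P
    [set w | exists2 N, (2 ^ (2 ^ i.+1 + j) <= N <= 2 ^ (2 ^ i.+1 + j).+1)%N &
      forall x : R, `|x| <= 1 -> `|\sum_(k < N) eps k w * x ^+ k| <=
         expR (- ell i) * Num.sqrt N%:R] (expR (- (s * ln 2 * i%:R))).
    move=> _; rewrite -cost; apply: HL; first exact: HI2 (leq_trans II2 Ii).
    apply: le_trans (small i Ii) _; rewrite ler_nat leq_exp2l//.
    by rewrite (leq_trans _ (leq_addr _ _))// leq_exp2l.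
  apply: dominatedS (dominated_bigcup D); first by move=> w [].
  rewrite expnS natrM -mulrA ler_wpM2l// -expR_natM_ln2 -expRM_natl -expRD ler_expR.
  by rewrite le_eqVlt; apply/orP; left; apply/eqP; ring.
have C0 : 0 <= (2 : R) by [].
have p0 i : 0 <= 2 * expR (- ((s - 1) * ln 2)) ^+ i.
  by rewrite mulr_ge0// exprn_ge0// expR_ge0.
have := borel_cantelli p0 (fun n => geometric_sum_le n C0 q1) dom.
apply: filterS => w [N hN].
exists (2 ^ 2 ^ (maxn N I).+1)%N => n hn hsmall.
have n0 : (0 < n)%N by apply: leq_trans hn; rewrite expn_gt0.
pose j := trunc_log 2 n.
have /andP[jn nj] : (2 ^ j <= n < 2 ^ j.+1)%N by exact: trunc_log_bounds.
have jm : (2 ^ (maxn N I).+1 <= j)%N by rewrite -ltnS -(ltn_exp2l _ _ (ltnSn 1)) (leq_ltn_trans hn).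
have j0 : (0 < j)%N by apply: leq_trans jm; rewrite expn_gt0.
have /andP[ij ji] : (2 ^ (trunc_log 2 j) <= j < 2 ^ (trunc_log 2 j).+1)%N by exact: trunc_log_bounds.
move: (trunc_log 2 j) ij ji => i ij ji.
have mi : (maxn N I < i)%N by rewrite -ltnS -(ltn_exp2l _ _ (ltnSn 1)) (leq_ltn_trans jm).
case: i ij ji mi => // i ij ji; rewrite ltnS geq_max => /andP[Ni Ii].
apply: (hN i Ni); split=> //; exists (j - 2 ^ i.+1)%N.
  by rewrite ltn_subLR// addnn -mul2n -expnS.
rewrite subnKC//; exists n.+1; first by rewrite (leqW jn).
move=> x x1; apply: le_trans (hsmall x x1) _.
rewrite ler_pM ?expR_ge0 ?sqrtr_ge0 ?ler_wsqrtr ?ler_nat// ler_expR lerN2.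
rewrite ler_wpM2l ?mulr_ge0 ?cbrt_ge0 ?(ltW r0)// ler_cbrt// ?mulr_ge0//; first by lra.
by apply: lnln_ge; apply: leq_trans jn; rewrite leq_exp2l.
Qed.

End LowerBoundLiminf.

(** * Upper bound on the limit inferior *)

Section IndependentBlocks.
Variable R : realType.

(** Given the signs before [u J], whatever they are, block [J] succeeds with probability at least
    [p], while the earlier blocks are already decided; so each block contributes a factor
    [1 - p]. *)
Lemma sign_prob_no_block (u : nat -> nat) (G : nat -> (nat -> R) -> Prop) (p : R) J :
  (forall j, u j <= u j.+1)%N ->
  (forall j s s', (forall k, (k < u j.+1)%N -> s k = s' k) -> G j s -> G j s') ->
  p <= 1 ->
  (forall j s, (j < J)%N -> p <= sign_prob (u j.+1 - u j) (fun t => G j (scat (u j) s t))) ->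
  sign_prob (u J) (fun s => forall j, (j < J)%N -> ~ G j s) <= (1 - p) ^+ J.
Proof.
move=> u_incr G_local p1.
have u_le i j : (i <= j)%N -> (u i <= u j)%N.
  by move=> /subnKC <-; elim: (j - i)%N => [|k IH]; rewrite ?addn0// addnS (leq_trans IH).
elim: J => [|J IH] h; first by rewrite expr0 sign_prob_le1.
have {}IH := IH (fun j s jJ => h j s (ltnW jJ)).
rewrite -(subnKC (u_incr J)) /sign_prob sign_avg_cat exprSr.
apply: le_trans (ler_wpM2r _ IH); last by rewrite subr_ge0.
rewrite mulrC /sign_prob -sign_avgZ; apply: le_sign_avg => s _.
apply: le_trans (_ : (`[< forall j, (j < J)%N -> ~ G j s >])%:R *
   sign_prob (u J.+1 - u J) (fun t => ~ G J (scat (u J) s t)) <= _); last first.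
  by rewrite mulrC ler_wpM2r ?ler0n// sign_prob_not lerD2l lerN2 h.
rewrite -sign_avgZ; apply: le_sign_avg => t _; rewrite -natrM mulnb ler_nat.
case: (asboolP (forall j, (j < J.+1)%N -> _)) => // hj.
have -> : `[< forall j, (j < J)%N -> ~ G j s >].
  apply/asboolP => j jJ Gj; apply: (hj j (ltnW jJ)); apply: G_local Gj => k kj.
  by rewrite /scat (leq_trans kj) ?u_le.
by have -> : `[< ~ G J (scat (u J) s t) >] by apply/asboolP; exact: hj.
Qed.

Lemma expRN_le_inv (y : R) : 0 < y -> expR (- y) <= y^-1.
Proof.
by move=> y0; rewrite expRN lef_pV2 ?posrE ?expR_gt0//; have := expR_ge1Dx y; lra.
Qed.

End IndependentBlocks.

Section UpperBoundLiminf.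
Context (R : realType) d (T : measurableType d) (P : probability T R).
Variable eps : nat -> {RV P >-> R}.
Hypothesis heps : iid_rademacher eps.

Let c0 : R := 4 / (3 * pi ^+ 2).
Let cb : R := 3 * pi ^+ 2 / 4.

Section Level.
Variables (i : nat) (l p : R).
Hypothesis i2 : (2 <= i)%N.

(* The prefixes of length [level_end j], [j <= 2 ^ i], grow by the factor [2 ^ i]:
   each one is negligible against the next. *)
Let level_end j := (2 ^ (i * (2 ^ i + j)))%N.

Let level_endS j : level_end j.+1 = (2 ^ i * level_end j)%N.
Proof. by rewrite /level_end addnS mulnS expnD. Qed.

Let level_end_le j : (level_end j <= level_end j.+1)%N.
Proof. by rewrite level_endS leq_pmull// expn_gt0. Qed.

Let block j := (level_end j.+1 - level_end j)%N.

Let block_ge j : (2 ^ i <= block j)%N.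
Proof.
rewrite /block level_endS -[X in (_ - X)%N]mul1n -mulnBl.
have h1 : (2 ^ i <= level_end j)%N.
  by rewrite /level_end leq_exp2l// leq_pmulr// addn_gt0 expn_gt0.
apply: leq_trans h1 _; rewrite leq_pmull// subn_gt0.
by rewrite -[X in (X < _)%N](expn0 2) ltn_exp2l// ltnW.
Qed.

(** Lengths divisible by [4] are those covered by [small_ball_lower]. *)
Let block4 j : exists m, block j = (4 * m)%N.
Proof.
exists (block j %/ 4)%N; rewrite mulnC divnK// /block dvdn_sub//.
  by rewrite level_endS dvdn_mulr// (_ : 4 = 2 ^ 2)%N// dvdn_exp2l.
rewrite /level_end (_ : 4 = 2 ^ 2)%N// dvdn_exp2l//.
by rewrite (leq_trans i2)// leq_pmulr// addn_gt0 expn_gt0.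
Qed.

Hypothesis p1 : p <= 1.
Hypothesis small : forall m, expR (8 * l) <= (4 * m)%:R ->
  p <= sign_prob (4 * m) (fun s => forall x : R, `|x| <= 1 ->
    `|\sum_(k < 4 * m) s k * x ^+ k| <= expR (- l) * Num.sqrt (4 * m)%:R).
Hypothesis li : 8 * l <= i%:R * ln 2.

Let good j (s : nat -> R) := forall x : R, `|x| <= 1 ->
  `|\sum_(k < block j) s (level_end j + k)%N * x ^+ k| <= expR (- l) * Num.sqrt (block j)%:R.

Lemma no_good_block_dominated :
  dominated P [set w | forall j, (j < 2 ^ i)%N -> ~ good j (window eps 0 (level_end (2 ^ i)) w)]
    ((1 - p) ^+ (2 ^ i)).
Proof.
apply: (@window_dominated _ _ _ _ _ heps 0 _ (fun s => forall j, (j < 2 ^ i)%N -> ~ good j s)).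
apply: sign_prob_no_block => //.
  move=> j s s' ss Gs x x1; move: (Gs x x1); congr (`|_| <= _).
  apply: eq_bigr => k _; rewrite ss// -[X in (_ < X)%N](subnKC (level_end_le j)).
  by rewrite ltn_add2l.
move=> j s _; have [m bE] := block4 j; rewrite -/(block j).
have hm : expR (8 * l) <= (4 * m)%:R.
  rewrite -bE; apply: le_trans (_ : (2 ^ i)%:R <= _); last by rewrite ler_nat.
  by rewrite -expR_natM_ln2 ler_expR.
apply: le_trans (small hm) _; rewrite -bE; apply: le_sign_prob => t _ ht x x1.
move: (ht x x1); congr (`|_| <= _); apply: eq_bigr => k _.
by rewrite /scat ltnNge leq_addr /= addKn.
Qed.

Lemma level_prefix_dominated :
  dominated P [set w | exists2 j, (j < 2 ^ i)%N & exists2 k, (k <= level_end j)%N &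
     exists2 x : R, `|x| <= 1 & expR (- l) * Num.sqrt (level_end j.+1)%:R <
       `|\sum_(n < k) window eps 0 (level_end j) w n * x ^+ n|]
    ((2 ^ i)%:R * (4 * expR (- (expR (- (2 * l)) * (2 ^ i)%:R / 2)))).
Proof.
apply: dominated_bigcup => j _.
apply: (@window_dominated _ _ _ _ _ heps 0 _ (fun s => exists2 k, (k <= level_end j)%N &
  exists2 x : R, `|x| <= 1 & expR (- l) * Num.sqrt (level_end j.+1)%:R <
    `|\sum_(n < k) s n * x ^+ n|)).
have t0 : 0 <= expR (- l) * Num.sqrt (level_end j.+1)%:R.
  by rewrite mulr_ge0 ?expR_ge0 ?sqrtr_ge0.
have m0 : (0 < level_end j)%N by rewrite expn_gt0.
have M0 : 0 < (level_end j)%:R :> R by rewrite ltr0n.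
apply: le_trans (poly_sup_tail t0 m0) _; rewrite ler_pM2l// ler_expR lerN2.
rewrite exprMn sqr_sqrtr// level_endS natrM -expRM_natl mulrN.
by rewrite le_eqVlt; apply/orP; left; apply/eqP; field; rewrite gt_eqF.
Qed.

Lemma good_block_small_sup w :
  ~ (forall j, (j < 2 ^ i)%N -> ~ good j (window eps 0 (level_end (2 ^ i)) w)) ->
  ~ (exists2 j, (j < 2 ^ i)%N & exists2 k, (k <= level_end j)%N &
     exists2 x : R, `|x| <= 1 & expR (- l) * Num.sqrt (level_end j.+1)%:R <
       `|\sum_(n < k) window eps 0 (level_end j) w n * x ^+ n|) ->
  exists N, [/\ (2 ^ i < N)%N, (N <= 2 ^ (i * 2 ^ i.+1))%N &
    forall x : R, `|x| <= 1 -> `|\sum_(k < N) eps k w * x ^+ k| <=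
       2 * (expR (- l) * Num.sqrt N%:R)].
Proof.
move=> /existsNP[j] /not_implyP[jJ] /contrapT hgood hprefix.
have ujJ : (level_end j.+1 <= level_end (2 ^ i))%N.
  by rewrite /level_end leq_exp2l// leq_mul2l leq_add2l jJ orbT.
exists (level_end j.+1); split.
- rewrite level_endS -[X in (X < _)%N]muln1 ltn_pmul2l ?expn_gt0// /level_end.
  by rewrite -[X in (X < _)%N](expn0 2) ltn_exp2l// muln_gt0 addn_gt0 expn_gt0 andbT ltnW.
- by rewrite (leq_trans ujJ)// /level_end addnn -mul2n -expnS.
move=> x x1; rewrite -[in X in (X <= _)](subnKC (level_end_le j)) eps_sum_split.
have h1 : `|\sum_(k < level_end j) eps k w * x ^+ k| <= expR (- l) * Num.sqrt (level_end j.+1)%:R.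
  rewrite leNgt; apply/negP => h; apply: hprefix; exists j => //.
  exists (level_end j) => //; exists x => //.
  by rewrite window_sum//; under eq_bigr do rewrite add0n.
have h2 : `|\sum_(k < block j) eps (level_end j + k)%N w * x ^+ k| <=
    expR (- l) * Num.sqrt (level_end j.+1)%:R.
  apply: le_trans (_ : expR (- l) * Num.sqrt (block j)%:R <= _); last first.
    by rewrite ler_wpM2l ?expR_ge0// ler_wsqrtr// ler_nat leq_subr.
  move: (hgood x x1); congr (`|_| <= _); apply: eq_bigr => k _; rewrite /window add0n.
  rewrite (leq_trans _ ujJ)// -[X in (_ < X)%N](subnKC (level_end_le j)).
  by rewrite ltn_add2l.
apply: le_trans (ler_normD _ _) _; rewrite mulr2n mulrDl mul1r lerD//.
apply: le_trans h2; rewrite normrM ler_piMl//; exact: norm_pow_le1.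
Qed.

End Level.

Lemma lnln_le (n i : nat) : (0 < i)%N -> (2 ^ i <= n)%N -> (n <= 2 ^ (i * 2 ^ i.+1))%N ->
  ln (ln n%:R) <= ln i%:R + i.+1%:R * ln 2 :> R.
Proof.
move=> i0 h1 h2; have /andP[l2 l2'] := ln2_bounds R.
have n0 : 0 < n%:R :> R by rewrite ltr0n (leq_trans _ h1)// expn_gt0.
have i0R : 0 < i%:R :> R by rewrite ltr0n.
have ln0 : 0 < ln n%:R :> R.
  apply: lt_le_trans (_ : i%:R * ln 2 <= _); first by rewrite mulr_gt0//; lra.
  by rewrite -ler_expR expR_natM_ln2 lnK ?posrE// ler_nat.
rewrite -ler_expR lnK ?posrE// expRD expR_natM_ln2 lnK ?posrE//.
apply: le_trans (_ : (i * 2 ^ i.+1)%:R * ln 2 <= _).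
  by rewrite -ler_expR expR_natM_ln2 lnK ?posrE// ler_nat.
by rewrite natrM ler_piMr.
Qed.

(** With [e^X = 2 ^ i] the two summands bound the failure of all blocks and of some prefix. Decay
    like [1 / X] is enough; for the second, [e^X = z^2] and [e^(- z / 2) <= (6 / z)^3]. *)
Lemma level_cost (l X q : R) : 0 < X -> 0 < q -> 8 * l <= X ->
  expR (- (expR (q * X))) + expR X * (4 * expR (- (expR (- (2 * l)) * expR X / 2))) <=
  (q^-1 + 8 * 6 ^+ 3) / X.
Proof.
move=> X0 q0 lX; rewrite [leRHS]mulrDl; apply: lerD.
  rewrite -invfM; apply: le_trans (_ : expR (- (q * X)) <= _).
    by rewrite ler_expR lerN2; have := expR_ge1Dx (q * X); lra.
  by apply: expRN_le_inv; rewrite mulr_gt0.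
have [z zE] : exists z, z = expR (X / 2) by eexists.
have z0 : 0 < z by rewrite zE expR_gt0.
have zX : expR X = z ^+ 2 by rewrite zE -expRM_natl; congr expR; field.
have h1 : z <= expR (- (2 * l)) * expR X by rewrite zE -expRD ler_expR; lra.
have h2 : expR (- (z / 2)) <= (z / 6)^-1 ^+ 3.
  rewrite (_ : - (z / 2) = 3%:R * - (z / 6)); last by field.
  rewrite expRM_natl lerXn2r ?nnegrE ?expR_ge0 ?invr_ge0 ?divr_ge0 ?(ltW z0)//.
  by apply: expRN_le_inv; rewrite divr_gt0.
apply: le_trans (_ : expR X * (4 * (z / 6)^-1 ^+ 3) <= _).
  rewrite ler_pM2l ?expR_gt0// ler_pM2l//; apply: le_trans h2.
  by rewrite ler_expR lerN2 ler_pM2r.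
have z3 : X / 2 <= z by have := expR_ge1Dx (X / 2); rewrite zE; lra.
rewrite zX invf_div expr_div_n (_ : z ^+ 2 * _ = 4 * 6 ^+ 3 / z); last first.
  by field; rewrite gt_eqF.
have S0 : 0 <= (6 : R) ^+ 3 by rewrite exprn_ge0.
move: (_ ^+ 3) S0 => S S0; rewrite ler_pdivrMr//.
have -> : 8 * S / X * z = 4 * S * (2 * z / X) by field; rewrite gt_eqF.
rewrite ler_peMr ?mulr_ge0// ler_pdivlMr// mul1r; lra.
Qed.

(** The three factors [tau] have separate uses: one lowers [ell] so that blocks succeed often
    enough, one covers [ln (ln n) <= i ln 2 / tau^3], and one leaves room for the constant factor
    [4 <= e^3]. *)
Lemma sup_norm_upper_ae (tau : R) : 0 < tau -> tau < 1 ->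
  {ae P, forall w, forall N, exists2 n, (N <= n)%N &
    forall x : R, `|x| <= 1 -> `|\sum_(k < n.+1) eps k w * x ^+ k| <=
      expR (- (tau ^+ 3 * cbrt cb * cbrt (ln (ln n%:R)))) * Num.sqrt n%:R}.
Proof.
move=> t0 t1.
have /andP[l2 l2'] := ln2_bounds R.
have ln20 : 0 < ln (2 : R) by lra.
have /andP[p4 p16] := pi_sqr_bounds R.
have cb0 : 0 < cb by rewrite /cb; lra.
have c0b : c0 * cb = 1.
  by rewrite /c0 /cb; have p0 := @pi_gt0 R; move: (@pi R) p0 => p p0; field; rewrite gt_eqF.
have c00 : 0 < c0 by have /andP[] := c0_bounds R.
have [s [sE s0 s1]] : exists s, [/\ s = tau ^+ 3, 0 < s & s < 1].
  by exists (tau ^+ 3); rewrite exprn_gt0// exprn_ilt1// ltW.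
(* Strictly between [s] and [1]: a block succeeds with probability at least [2^(- s' i)], and there
   are [2 ^ i] of them. *)
have [s' s'E] : exists s', s' = (1 + s) / 2 by eexists.
have d0 : 0 < c0 * (s' / s - 1).
  by rewrite mulr_gt0// subr_gt0 ltr_pdivlMr; lra.
have [L L1 HL] := small_ball_lower d0.
have e0 : 0 < (s^-1 - 1) * ln 2 by rewrite mulr_gt0// subr_gt0 invf_gt1.
have [L2 L21 HL2] := ln_le_linear (@ltr01 R) e0.
pose ell (i : nat) := tau * cbrt cb * cbrt (i%:R * ln 2).
have X0 (i : nat) : 0 <= i%:R * ln 2 :> R by rewrite mulr_ge0// ltW.
have ell3 i : ell i ^+ 3 = s * cb * (i%:R * ln 2).
  by rewrite /ell !exprMn !cbrtK ?(ltW cb0)// sE.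
have ell0 i : 0 <= ell i by rewrite !mulr_ge0 ?cbrt_ge0// ltW.
have cost i : (c0 + c0 * (s' / s - 1)) * ell i ^+ 3 = s' * (i%:R * ln 2).
  rewrite ell3 (_ : _ * _ = (c0 * cb) * s' * (i%:R * ln 2) * (s / s)); last by ring.
  by rewrite c0b divff ?gt_eqF// ?mul1r ?mulr1.
have [B [B0 BL Bt]] : exists B, [/\ 0 <= B, L <= B & 3 <= (1 - tau) * B].
  have q0 : 0 <= 3 / (1 - tau) by rewrite divr_ge0//; lra.
  exists (L + 3 / (1 - tau)); split; [lra|lra|].
  by rewrite mulrDr [X in _ + X]mulrC divfK ?gt_eqF ?subr_gt0// lerDr mulr_ge0//; lra.
have sc0 : 0 < s * cb by rewrite mulr_gt0.
have [I HI] : exists I : nat, forall i, (I <= i)%N -> [/\ (2 <= i)%N, B <= ell i,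
    8 * ell i <= i%:R * ln 2 & L2 <= i%:R].
  pose x := 2 * (B ^+ 3 / (s * cb)) + 2 * (1 + 8 ^+ 3 * cb) + L2 + 2.
  have q0 : 0 <= B ^+ 3 / (s * cb) by rewrite divr_ge0 ?exprn_ge0// ltW.
  have q1 : 0 <= 8 ^+ 3 * cb by rewrite mulr_ge0 ?exprn_ge0// ltW.
  exists (Num.truncn x).+1 => i Ii.
  have xi : x <= i%:R by apply: le_trans (ltW (truncnS_gt _)) _; rewrite ler_nat.
  have i0 : 0 <= i%:R :> R by [].
  have hX : i%:R * (1 / 2) <= i%:R * ln 2 := ler_wpM2l i0 l2.
  have hX1 : B ^+ 3 / (s * cb) <= i%:R * ln 2 by apply: le_trans hX; rewrite /x in xi; lra.
  have hX2 : 1 + 8 ^+ 3 * cb <= i%:R * ln 2 by apply: le_trans hX; rewrite /x in xi; lra.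
  split; last by rewrite /x in xi; lra.
  - by rewrite -(ler_nat R); rewrite /x in xi; lra.
  - rewrite -(@ler_pXn2r _ 3)// ?nnegrE ?ell0// ell3 mulrC.
    by rewrite -ler_pdivrMr.
  have ne : 8 * ell i \in Num.nneg by rewrite nnegrE mulr_ge0 ?ell0.
  have nX : i%:R * ln 2 \in @Num.nneg R by rewrite nnegrE.
  suff h : (8 * ell i) ^+ 3 <= (i%:R * ln 2) ^+ 3 by rewrite ler_pXn2r in h.
  rewrite exprMn ell3; move: (i%:R * ln 2) hX2 => X hX2.
  have X1 : 1 <= X by lra.
  have h8 : 0 <= (8 : R) ^+ 3 by rewrite exprn_ge0.
  move: (8 ^+ 3) h8 hX2 => E h8 hX2.
  rewrite mulrA [X ^+ 3]exprSr ler_wpM2r//; first by lra.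
  apply: le_trans (_ : E * cb <= _).
    by rewrite ler_wpM2l// ler_piMl// ltW.
  by apply: le_trans (_ : X <= _); [lra|rewrite ler_eXnr].
pose pr i := expR (- (s' * (i%:R * ln 2))) : R.
have pr1 i : pr i <= 1 by rewrite -[leRHS]expR0 ler_expR oppr_le0 mulr_ge0// s'E; lra.
pose Ev i := [set w | ~ exists N, [/\ (2 ^ i < N)%N, (N <= 2 ^ (i * 2 ^ i.+1))%N &
    forall x : R, `|x| <= 1 -> `|\sum_(k < N) eps k w * x ^+ k| <=
       2 * (expR (- ell i) * Num.sqrt N%:R)]].
have q0 : 0 < 1 - s' by lra.
have [C [C0 CE]] : exists C : R, 0 <= C /\ C = ((1 - s')^-1 + 8 * 6 ^+ 3) / ln 2.
  exists (((1 - s')^-1 + 8 * 6 ^+ 3) / ln 2); split => //.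
  by rewrite divr_ge0 ?(ltW ln20)// addr_ge0 ?invr_ge0 ?(ltW q0)// mulr_ge0// exprn_ge0.
have dom i : (I <= i)%N -> dominated P (Ev i) (C / i%:R).
  move=> /HI[i2 Bi li L2i].
  have small m : expR (8 * ell i) <= (4 * m)%:R ->
    pr i <= sign_prob (4 * m) (fun s => forall x : R, `|x| <= 1 ->
    `|\sum_(k < 4 * m) s k * x ^+ k| <= expR (- ell i) * Num.sqrt (4 * m)%:R).
    by rewrite /pr -cost; apply: HL; exact: le_trans Bi.
  have D1 := no_good_block_dominated i2 (pr1 i) small li.
  have D2 := level_prefix_dominated i (ell i).
  apply: dominatedS (dominatedU D1 D2).
    move=> w /= hN; apply: contrapT => /not_orP[h1 h2]; apply: hN.
    exact: good_block_small_sup h1 h2.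
  have Xp : 0 < i%:R * ln 2 :> R by rewrite mulr_gt0// ltr0n ltnW.
  have -> : C / i%:R = ((1 - s')^-1 + 8 * 6 ^+ 3) / (i%:R * ln 2).
    rewrite CE; move: (_^-1 + _) => A.
    by rewrite [i%:R * _]mulrC invfM mulrA.
  apply: le_trans (level_cost Xp q0 li).
  rewrite expR_natM_ln2 lerD2r.
  apply: le_trans (_ : expR (- pr i) ^+ (2 ^ i) <= _).
    rewrite lerXn2r ?nnegrE ?expR_ge0 ?subr_ge0//.
    by have := expR_ge1Dx (- pr i); lra.
  rewrite -expRM_natl -expR_natM_ln2 /pr mulrN -expRD ler_expR lerN2 ler_expR.
  by rewrite le_eqVlt; apply/orP; left; apply/eqP; ring.
have plim e : 0 < e -> exists N, forall i, (N <= i)%N -> C / i%:R <= e.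
  move=> e_gt0; exists (Num.truncn (C / e)).+1 => i Ni.
  have hi : C / e < i%:R by apply: lt_le_trans (truncnS_gt _) _; rewrite ler_nat.
  have i0 : 0 < i%:R :> R by apply: le_lt_trans hi; rewrite divr_ge0// ltW.
  by rewrite ler_pdivrMr// mulrC -ler_pdivrMr// ltW.
have := infinitely_often_ae plim (ex_intro2 _ _ I Logic.I dom).
apply: filterS => w hw N.
have [i Ni /contrapT[K [K1 K2 hK]]] := hw (maxn I N.+1).
clear hw plim dom CE C0 pr1 q0 cost HL L1 BL B0 sc0 d0 s'E c0b c00 p4 p16 s1.
have /HI[i2 Bi li L2i] : (I <= i)%N by apply: leq_trans Ni; rewrite leq_maxl.
have Ni' : (N < i)%N by apply: leq_trans Ni; rewrite leq_maxr.
case: K K1 K2 hK => // n; rewrite ltnS => K1 K2 hK.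
have i_n : (i <= n)%N by apply: leq_trans K1; exact/ltnW/ltn_expl.
exists n; first by rewrite (leq_trans (ltnW Ni')).
have n1 : (1 <= n)%N by apply: leq_trans i_n; exact: ltnW.
move=> x x1; apply: le_trans (hK x x1) _.
have sq : Num.sqrt n.+1%:R <= 2 * Num.sqrt n%:R :> R.
  apply: le_trans (_ : Num.sqrt (2 ^+ 2 * n%:R) <= _).
    rewrite ler_wsqrtr// -natrX -natrM ler_nat (@leq_trans (n + n))//.
      by rewrite -addn1 leq_add2l.
    by rewrite addnn -mul2n leq_mul2r orbT.
  by rewrite sqrtrM ?sqr_ge0// sqrtr_sqr ger0_norm.
have e4 : 4 <= expR 3 :> R by have := expR_ge1Dx (3 : R); lra.
apply: le_trans (_ : expR 3 * expR (- ell i) * Num.sqrt n%:R <= _).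
  apply: le_trans (_ : 4 * (expR (- ell i) * Num.sqrt n%:R) <= _).
    have := ler_wpM2l (expR_ge0 (- ell i)) sq; lra.
  by rewrite -mulrA ler_wpM2r// mulr_ge0 ?expR_ge0 ?sqrtr_ge0.
rewrite ler_wpM2r ?sqrtr_ge0// -expRD ler_expR.
have i0 : (0 < i)%N by exact: ltnW.
have hln : ln (ln n%:R) <= s^-1 * (i%:R * ln 2).
  apply: le_trans (_ : ln i%:R + i.+1%:R * ln 2 <= _).
    by apply: lnln_le => //; exact: ltnW.
  have := HL2 _ L2i; rewrite mul1r -natr1; lra.
have hc : tau * cbrt (ln (ln n%:R)) <= cbrt (i%:R * ln 2).
  have lnln0 : 0 <= ln (ln n%:R) :> R.
    rewrite -[leLHS](mul0r (ln 2)); apply: (@lnln_ge R n 0).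
    by apply: leq_trans K1; rewrite leq_exp2l.
  rewrite -(@ler_pXn2r _ 3)// ?nnegrE ?mulr_ge0 ?cbrt_ge0 ?(ltW t0)//.
  by rewrite exprMn !cbrtK// -sE mulrC -ler_pdivlMr// mulrC.
have : tau ^+ 3 * cbrt cb * cbrt (ln (ln n%:R)) <= tau * ell i.
  rewrite (_ : tau ^+ 3 * _ * _ = tau * (tau * cbrt cb) * (tau * cbrt (ln (ln n%:R)))); last by ring.
  rewrite /ell -!mulrA; do 3 (rewrite ler_wpM2l ?cbrt_ge0 ?(ltW t0)//).
have : (1 - tau) * B <= (1 - tau) * ell i by rewrite ler_wpM2l// subr_ge0 ltW.
by move: Bt; rewrite mulrBl mul1r; lra.
Qed.

End UpperBoundLiminf.

(** * Limit inferior of extended real sequences and conclusion *)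

Section Liminf.
Variable R : realType.
Local Open Scope ereal_scope.
Implicit Types (u : (\bar R)^nat) (l : \bar R).

Lemma limn_einf_le u l : (forall N, exists2 n, (N <= n)%N & u n <= l) -> limn_einf u <= l.
Proof.
move=> h; rewrite limn_einf_lim; apply: lime_le; first exact: is_cvg_einfs.
apply: nearW => N; have [n Nn] := h N; apply: le_trans.
by apply: ereal_inf_lbound; exists n.
Qed.

Lemma limn_einf_ge u l : (exists N, forall n, (N <= n)%N -> l <= u n) -> l <= limn_einf u.
Proof.
move=> [N h]; rewrite limn_einf_lim; apply: lime_ge; first exact: is_cvg_einfs.
exists N => // k /= Nk; apply: le_trans (nondecreasing_einfs u Nk).
by apply: le_ereal_inf_tmp => _ [n Nn <-]; exact: h.
Qed.

End Liminf.

Lemma max_abs_le (R : realType) (a : nat -> R) n v :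
  max_abs (partial_poly a n) <= v <->
  (forall x : R, `|x| <= 1 -> `|\sum_(k < n.+1) a k * x ^+ k| <= v).
Proof.
have [[c cI cE] ub] := max_absP (partial_poly a n).
have E x : (partial_poly a n).[x] = \sum_(k < n.+1) a k * x ^+ k.
  by rewrite horner_poly.
split => [h x x1|h]; first by rewrite -E (le_trans (ub x _))// in_itv /= -ler_norml.
by move: cI; rewrite cE E in_itv /= -ler_norml; exact: h.
Qed.

Unset Implicit Arguments.

Theorem mainTheorem3 (R : realType) (d : measure_display)
    (T : measurableType d) (P : probability T R)
    (eps : nat -> {RV P >-> R}) (heps : iid_rademacher eps) :
  {ae P, forall w : T,
    limn_einf (fun n : nat =>
      (ln (max_abs (partial_poly (fun k => eps k w) n) / Num.sqrt n%:R)
        / ln (ln n%:R) `^ 3^-1)%:E)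
    = (- (3 * pi ^+ 2 / 4) `^ 3^-1)%:E}.
Proof.
(* Countably many rates [1 + 1 / (p + 1)] and [(1 - 1 / (p + 2))^3] suffice, so a single null set
   serves all; the shift [p + 2] keeps [tau] positive. *)
have /ae_foralln low : forall p : nat, {ae P, forall w, exists N, forall n, (N <= n)%N ->
    ~ (forall x : R, `|x| <= 1 -> `|\sum_(k < n.+1) eps k w * x ^+ k| <=
      expR (- ((1 + p.+1%:R^-1) * cbrt (3 * pi ^+ 2 / 4) * cbrt (ln (ln n%:R)))) * Num.sqrt n%:R)}.
  by move=> p; apply: (sup_norm_lower_ae heps); rewrite ltrDl invr_gt0.
have /ae_foralln high : forall p : nat, {ae P, forall w, forall N, exists2 n, (N <= n)%N &
    forall x : R, `|x| <= 1 -> `|\sum_(k < n.+1) eps k w * x ^+ k| <=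
      expR (- ((1 - p.+2%:R^-1) ^+ 3 * cbrt (3 * pi ^+ 2 / 4) * cbrt (ln (ln n%:R)))) * Num.sqrt n%:R}.
  move=> p; have q0 : 0 < p.+2%:R^-1 :> R by rewrite invr_gt0.
  have q1 : p.+2%:R^-1 < 1 :> R by rewrite invf_lt1// ltr1n.
  by apply: (sup_norm_upper_ae heps); rewrite ?subr_gt0// gtrBl.
apply: filterS2 low high => w low high.
rewrite -/(cbrt _).
have [c c0 cE] : exists2 c : R, 0 <= c & cbrt (3 * pi ^+ 2 / 4) = c.
  by exists (cbrt (3 * pi ^+ 2 / 4)) => //; exact: cbrt_ge0.
rewrite cE in low high *.
pose M n := max_abs (partial_poly (fun k => eps k w) n).
have /andP[l2 _] := ln2_bounds R.
(* [16 = 2 ^ 2 ^ 2] ensures [ln (ln n) >= ln 2 > 0]. *)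
have den n : (16 <= n)%N -> 0 < cbrt (ln (ln n%:R)) :> R.
  move=> n16; rewrite powR_gt0//; apply: lt_le_trans (@lnln_ge R n 1 n16); lra.
have sq n : (16 <= n)%N -> 0 < Num.sqrt n%:R :> R.
  by move=> n16; rewrite sqrtr_gt0 ltr0n (leq_trans _ n16).
have Mlow p : exists N, forall n, (N <= n)%N -> [/\ (16 <= n)%N, 0 < M n / Num.sqrt n%:R &
    - ((1 + p.+1%:R^-1) * c) <= ln (M n / Num.sqrt n%:R) / cbrt (ln (ln n%:R))].
  have [N hN] := low p; exists (maxn 16 N) => n; rewrite geq_max => /andP[n16 Nn].
  have h : expR (- ((1 + p.+1%:R^-1) * c * cbrt (ln (ln n%:R)))) * Num.sqrt n%:R < M n.
    by rewrite ltNge; apply/negP => /max_abs_le; exact: hN.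
  rewrite -ltr_pdivlMr ?sq// in h.
  have Mp := lt_trans (expR_gt0 _) h.
  split => //; rewrite ler_pdivlMr ?den// mulNr.
  by rewrite -ler_expR lnK ?posrE// ltW.
apply/eqP; rewrite eq_le; apply/andP; split.
- apply/lee_addgt0Pr => e e0; apply: limn_einf_le => N.
  pose p := Num.truncn (3 * c / e).
  (* The lower estimate enters here to give [M n > 0]: [ln] is [0] by convention at nonpositive
     arguments, so an upper bound on [M n] alone would not bound its logarithm. *)
  have [N0 hN0] := Mlow 0%N; have [n] := high p (maxn N0 N).
  rewrite geq_max => /andP[/hN0[n16 Mp _] Nn] /(iffRL (max_abs_le (fun k => eps k w) n _)); rewrite -/(M n) => hM.
  exists n => //; rewrite -EFinD lee_fin ler_pdivrMr ?den//.
  rewrite -ler_pdivrMr ?sq// in hM.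
  apply: le_trans (_ : - ((1 - p.+2%:R^-1) ^+ 3 * c * cbrt (ln (ln n%:R))) <= _).
    by rewrite -ler_expR lnK ?posrE.
  rewrite -mulNr ler_pM2r ?den//.
  have hp : 3 * c <= e * p.+2%:R.
    rewrite [leRHS]mulrC -ler_pdivrMr//; apply/ltW; apply: lt_trans (truncnS_gt _) _.
    by rewrite ltr_nat.
  have p0 : 0 < p.+2%:R :> R by [].
  have [q [q0 q1 qe]] : exists q : R, [/\ 0 <= q, q <= 1, p.+2%:R^-1 = q & 3 * c * q <= e].
    exists p.+2%:R^-1; split => //; first by rewrite invf_le1// ler1n.
    by rewrite ler_pdivrMr.
  rewrite qe => cq.
  have : 1 - 3 * q <= (1 - q) ^+ 3.
    rewrite (_ : (1 - q) ^+ 3 = 1 - 3 * q + q ^+ 2 * (3 - q)); last by ring.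
    by rewrite lerDl mulr_ge0 ?sqr_ge0//; lra.
  by move=> h; have := ler_wpM2r c0 h; lra.
apply/lee_addgt0Pr => e e0; rewrite -leeBlDr//; apply: limn_einf_ge.
pose p := Num.truncn (c / e); have [N hN] := Mlow p; exists N => n /hN[n16 _ hX].
rewrite -EFinB lee_fin; apply: le_trans hX.
have hp : c <= e * p.+1%:R by rewrite mulrC -ler_pdivrMr// ltW// truncnS_gt.
have p0 : 0 < p.+1%:R :> R by [].
have : p.+1%:R^-1 * c <= e by rewrite mulrC ler_pdivrMr.
by move: (p.+1%:R^-1) => q; lra.
Qed.
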